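(* Let $x:M\rightarrow \mathbb{E}^m$ be an isometric immersion of a compact connected $n$-dimensional Riemannian manifold $M$ into $\mathbb{E}^m$. Assume $x$ is an orthogonal 2-type immersion with spectral decomposition given by $$x=x_1+x_2,\qquad \Delta x_1 = \lambda_1 x_1,\qquad \Delta x_2 = \lambda_2 x_2 .$$ Then (1) $M$ lies in a hypersphere $S^{m-1}(r)$ centered at the origin with radius, say, $r$, as a mass-symmetric submanifold; (2) $M$ has constant mean curvature $\alpha$ in $\mathbb{E}^m$ given by $$\alpha^2=\frac1n(\lambda_1+\lambda_2)-\Big(\frac{r}{n}\Big)^2\lambda_1\lambda_2;$$ (3) both $x_1,x_2$ are mass-symmetric spherical maps; (4) $x_1,x_2$ and the Laplace map $L$ of $x$ satisfy $$x_1=\frac{\lambda_2 x-L}{\lambda_2-\lambda_1},\qquad x_2=\frac{\lambda_1x-L}{\lambda_1-\lambda_2};$$ (5) the spherical maps $\bar x_1,\bar x_2$, induced from $x_1,x_2$, are harmonic maps which have constant energy density.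
   Context: Everything is smooth. $\Delta=-\operatorname{trace}\nabla^2$ is the Laplace operator of $M$. The Laplace map is $L=\Delta x:M\to\mathbb{E}^m$, equal to $-nH$ with $H=\frac1n\operatorname{trace}h$ the mean curvature vector; $\alpha=\|H\|$. In the 2-type spectral decomposition $x_1,x_2:M\to\mathbb{E}^m$ are non-constant maps and $\lambda_1<\lambda_2$. The immersion is orthogonal if the linear subspaces $E_i=\operatorname{Span}\{x_i(p):p\in M\}$, $i=1,2$, are orthogonal in $\mathbb{E}^m$. A map $y:M\to\mathbb{E}^m$ is a mass-symmetric spherical map if its image lies in a hypersphere whose center is the center of mass $\frac{1}{\operatorname{vol}(M)}\int_M y\,dV$ of $y$ (for a submanifold of a hypersphere: its center of mass is the center of the hypersphere); here the spheres are centered at the origin. If $x_i(M)\subset S^{m-1}(r_i)$ (sphere of radius $r_i$ centered at the origin), $\bar x_i:M\to S^{m-1}(r_i)$ is the induced map. The energy density of a map $\phi$ is $\frac12\|d\phi\|^2$. *)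

(* Defs.v *)
From HB Require Import structures.
From mathcomp Require Import all_boot all_order all_algebra.
From mathcomp Require Import all_classical all_reals all_analysis.
From mathcomp Require Import measurable_realfun.

Set Implicit Arguments.
Unset Strict Implicit.
Unset Printing Implicit Defensive.

Import Order.TTheory GRing.Theory Num.Theory.
Import numFieldNormedType.Exports.

Local Open Scope classical_set_scope.
Local Open Scope ring_scope.

(* MathComp-Analysis.  The norm which the library puts on 'rV[R]_m is the sup
   norm; it is only used here through its topology (continuity, derivatives).
   The Euclidean structure of E^m is given by [edot] and [enorm]. *)
Definition edot (R : realType) (m : nat) (v w : 'rV[R]_m) : R :=
  (v *m w^T) 0 0.

Definition enorm (R : realType) (m : nat) (v : 'rV[R]_m) : R :=
  Num.sqrt (edot v v).

Definition pderiv (R : realType) (n : nat) (W : normedModType R)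
    (i : 'I_n) (F : 'rV[R]_n -> W) : 'rV[R]_n -> W :=
  fun u => 'D_(delta_mx 0 i) F u.

Fixpoint Cr_on (R : realType) (n : nat) (W : normedModType R) (k : nat)
    (U : set 'rV[R]_n) (F : 'rV[R]_n -> W) : Prop :=
  (forall u, U u -> {for u, continuous F}) /\
  match k with
  | 0%N => True
  | k'.+1 => forall i : 'I_n,
      (forall u, U u -> derivable F u (delta_mx 0 i)) /\
      Cr_on k' U (pderiv i F)
  end.

(* Meant for open U, where Cr_on only depends on the values of F on U. *)
Definition smooth_on (R : realType) (n : nat) (W : normedModType R)
    (U : set 'rV[R]_n) (F : 'rV[R]_n -> W) : Prop :=
  forall k, Cr_on k U F.

(* A homeomorphism from the open set [cdom] of M onto the open set [cimg] of
   R^n; the values of [cmap] and [cinv] elsewhere are irrelevant. *)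
Record chart (R : realType) (n : nat) (M : topologicalType) := Chart {
  cdom : set M ;
  cimg : set 'rV[R]_n ;
  cmap : M -> 'rV[R]_n ;
  cinv : 'rV[R]_n -> M ;
  cdom_open : open cdom ;
  cimg_open : open cimg ;
  cmap_img : forall p, cdom p -> cimg (cmap p) ;
  cinv_dom : forall u, cimg u -> cdom (cinv u) ;
  cmapK : forall p, cdom p -> cinv (cmap p) = p ;
  cinvK : forall u, cimg u -> cmap (cinv u) = u ;
  cmap_continuous : forall p, cdom p -> {for p, continuous cmap} ;
  cinv_continuous : forall u, cimg u -> {for u, continuous cinv}
}.

Definition overlap (R : realType) (n : nat) (M : topologicalType)
    (c d : chart R n M) : set 'rV[R]_n :=
  [set u | cimg c u /\ cdom d (cinv c u)].

Definition transition (R : realType) (n : nat) (M : topologicalType)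
    (c d : chart R n M) : 'rV[R]_n -> 'rV[R]_n :=
  fun u => cmap d (cinv c u).

Record smooth_atlas (R : realType) (n : nat) (M : topologicalType) :=
  SmoothAtlas {
  charts : set (chart R n M) ;
  charts_cover : forall p, exists2 c, charts c & cdom c p ;
  charts_compat : forall c d, charts c -> charts d ->
    smooth_on (overlap c d) (transition c d)
}.

(* The quantities below which are computed at p in this chosen chart around p
   do not depend on the choice. *)
Definition chart_at (R : realType) (n : nat) (M : topologicalType)
    (A : smooth_atlas R n M) (p : M) : chart R n M :=
  s2val (cid2 (charts_cover A p)).

Definition smooth (R : realType) (n : nat) (M : topologicalType)
    (A : smooth_atlas R n M) (W : normedModType R) (f : M -> W) : Prop :=
  forall c, charts A c -> smooth_on (cimg c) (fun u => f (cinv c u)).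

(* [metric c u] is the matrix (g_ij) at the point of coordinates u in the chart
   c.  The row i of the Jacobian 'J tau u is the derivative of tau along e_i,
   hence the form of the transformation rule. *)
Record riemannian_metric (R : realType) (n : nat) (M : topologicalType)
    (A : smooth_atlas R n M) := RiemannianMetric {
  metric : chart R n M -> 'rV[R]_n -> 'M[R]_n ;
  metric_smooth : forall c, charts A c ->
    forall i j, smooth_on (cimg c) (fun u => metric c u i j : R) ;
  metric_sym : forall c u, charts A c -> cimg c u ->
    (metric c u)^T = metric c u ;
  metric_posdef : forall c u (v : 'rV[R]_n), charts A c -> cimg c u ->
    v != 0 -> 0 < (v *m metric c u *m v^T) 0 0 ;
  metric_change : forall c d u, charts A c -> charts A d -> overlap c d u ->
    metric c u = 'J (transition c d) u *m metric d (transition c d u)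
                 *m ('J (transition c d) u)^T
}.

Section LocalFormulas.
Variables (R : realType) (n m : nat).
Implicit Types (G : 'rV[R]_n -> 'M[R]_n) (u : 'rV[R]_n).

Definition christoffel G u (k i j : 'I_n) : R :=
  2^-1 * \sum_(l < n) invmx (G u) k l *
    (pderiv i (fun v => G v j l : R) u + pderiv j (fun v => G v i l : R) u
     - pderiv l (fun v => G v i j : R) u).

(* (nabla_{d_i} d_j) F *)
Definition nabla_deriv (W : normedModType R) G (F : 'rV[R]_n -> W) u
    (i j : 'I_n) : W :=
  \sum_(k < n) christoffel G u k i j *: pderiv k F u.

Definition hessian (W : normedModType R) G (F : 'rV[R]_n -> W) u
    (i j : 'I_n) : W :=
  pderiv i (pderiv j F) u - nabla_deriv G F u i j.

Definition mtrace (W : normedModType R) G u (B : 'I_n -> 'I_n -> W) : W :=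
  \sum_(i < n) \sum_(j < n) invmx (G u) i j *: B i j.

Definition local_laplacian (W : normedModType R) G (F : 'rV[R]_n -> W) u : W :=
  - mtrace G u (hessian G F u).

(* Component of v normal to the span of the d_k F, for F with Gram matrix G. *)
Definition normal_part G (F : 'rV[R]_n -> 'rV[R]_m) u (v : 'rV[R]_m) :
    'rV[R]_m :=
  v - \sum_(k < n) \sum_(l < n)
        (invmx (G u) k l * edot v (pderiv l F u)) *: pderiv k F u.

(* h(d_i, d_j), by the Gauss formula. *)
Definition second_fundamental_form G (F : 'rV[R]_n -> 'rV[R]_m) u
    (i j : 'I_n) : 'rV[R]_m :=
  normal_part G F u (pderiv i (pderiv j F) u).

Definition local_mean_curvature G (F : 'rV[R]_n -> 'rV[R]_m) u : 'rV[R]_m :=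
  n%:R^-1 *: mtrace G u (second_fundamental_form G F u).

(* Projection of v onto the tangent space at q of the sphere of radius |q|
   centered at the origin. *)
Definition sphere_tangent (q v : 'rV[R]_m) : 'rV[R]_m :=
  v - (edot v q / edot q q) *: q.

(* (nabla dF)(d_i, d_j) for F with values in a sphere centered at the origin,
   whose Levi-Civita connection is the tangential part of the flat one. *)
Definition sphere_map_hessian G (F : 'rV[R]_n -> 'rV[R]_m) u
    (i j : 'I_n) : 'rV[R]_m :=
  sphere_tangent (F u) (pderiv i (pderiv j F) u) - nabla_deriv G F u i j.

Definition local_sphere_tension G (F : 'rV[R]_n -> 'rV[R]_m) u : 'rV[R]_m :=
  mtrace G u (sphere_map_hessian G F u).

Definition local_energy_density G (F : 'rV[R]_n -> 'rV[R]_m) u : R :=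
  2^-1 * mtrace G u
    (fun i j => edot (pderiv i F u) (pderiv j F u) : R).

(* Lebesgue integral over R^n of a nonnegative Borel function, as an iterated
   integral (Tonelli). *)
Fixpoint integral_Rn (k : nat) : ('rV[R]_k -> \bar R) -> \bar R :=
  match k with
  | 0%N => fun f => f 0
  | k'.+1 => fun f => (\int[lebesgue_measure]_t
      integral_Rn (fun v : 'rV[R]_k' => f (row_mx (t%:M : 'rV[R]_1) v)))%E
  end.

End LocalFormulas.

Notation borel M := (g_sigma_algebraType (@open M)).

Section Riemannian.
Variables (R : realType) (n m : nat) (M : ptopologicalType).
Variables (A : smooth_atlas R n M) (g : riemannian_metric A).

Definition at_chart (W : Type) (W' : Type)
    (op : ('rV[R]_n -> 'M[R]_n) -> ('rV[R]_n -> W) -> 'rV[R]_n -> W')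
    (f : M -> W) (p : M) : W' :=
  let c := chart_at A p in
  op (metric g c) (fun u => f (cinv c u)) (cmap c p).

(* Delta = - trace nabla^2, componentwise when W is a Euclidean space. *)
Definition laplacian (W : normedModType R) (f : M -> W) : M -> W :=
  at_chart (@local_laplacian R n W) f.

Definition mean_curvature (x : M -> 'rV[R]_m) : M -> 'rV[R]_m :=
  at_chart (@local_mean_curvature R n m) x.

Definition sphere_tension (y : M -> 'rV[R]_m) : M -> 'rV[R]_m :=
  at_chart (@local_sphere_tension R n m) y.

Definition energy_density (y : M -> 'rV[R]_m) : M -> R :=
  at_chart (@local_energy_density R n m) y.

(* d x is injective because the metric is positive definite. *)
Definition isometric_immersion (x : M -> 'rV[R]_m) : Prop :=
  smooth A x /\
  forall c u i j, charts A c -> cimg c u ->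
    edot (pderiv i (fun v => x (cinv c v)) u)
         (pderiv j (fun v => x (cinv c v)) u) = metric g c u i j.

(* dV = sqrt(det g) du_1 ... du_n in each chart; this determines dV. *)
Definition riemannian_volume (dV : {measure set (borel M) -> \bar R}) : Prop :=
  forall (c : chart R n M) (f : borel M -> \bar R), charts A c ->
    measurable_fun [set: borel M] f -> (forall p, 0 <= f p)%E ->
    (\int[dV]_(p in (cdom c : set (borel M))) f p =
     integral_Rn
       ((fun u => f (cinv c u) * (Num.sqrt (\det (metric g c u)))%:E)
          \_ (cimg c)))%E.

Definition center_of_mass (dV : {measure set (borel M) -> \bar R})
    (y : M -> 'rV[R]_m) : 'rV[R]_m :=
  \row_(j < m) ((fine (dV [set: borel M]))^-1 *
     \int[dV]_(p in [set: borel M]) (y p 0 j)).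

Definition in_hypersphere (o : 'rV[R]_m) (r : R) (y : M -> 'rV[R]_m) : Prop :=
  0 < r /\ forall p, enorm (y p - o) = r.

Definition mass_symmetric_in (dV : {measure set (borel M) -> \bar R})
    (o : 'rV[R]_m) (r : R) (y : M -> 'rV[R]_m) : Prop :=
  in_hypersphere o r y /\ center_of_mass dV y = o.

Definition nonconstant (y : M -> 'rV[R]_m) : Prop :=
  ~ exists v, forall p, y p = v.

Definition two_type_decomposition (x x1 x2 : M -> 'rV[R]_m)
    (lambda1 lambda2 : R) : Prop :=
  [/\ smooth A x1 /\ smooth A x2,
      nonconstant x1 /\ nonconstant x2,
      lambda1 < lambda2,
      forall p, x p = x1 p + x2 p
    & (forall p, laplacian x1 p = lambda1 *: x1 p) /\
      (forall p, laplacian x2 p = lambda2 *: x2 p)].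

Definition span_image (y : M -> 'rV[R]_m) : set 'rV[R]_m :=
  [set v | exists k (a : 'I_k -> R) (p : 'I_k -> M),
     v = \sum_(i < k) a i *: y (p i)].

Definition orthogonal_decomposition (x1 x2 : M -> 'rV[R]_m) : Prop :=
  forall v w, span_image x1 v -> span_image x2 w -> edot v w = 0.

(* The map M -> S^{m-1}(r) induced by y is harmonic. *)
Definition harmonic_into_sphere (r : R) (y : M -> 'rV[R]_m) : Prop :=
  [/\ in_hypersphere 0 r y, smooth A y & forall p, sphere_tension y p = 0].

(* The sphere has the metric induced from E^m, so that the energy density of
   the induced map is the one of y. *)
Definition constant_energy_density (y : M -> 'rV[R]_m) : Prop :=
  exists e, forall p, energy_density y p = e.

End Riemannian.

(* Main.v *)
Require Import Defs.
From HB Require Import structures.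
From mathcomp Require Import all_boot all_order all_algebra.
From mathcomp Require Import all_classical all_reals all_analysis.
From mathcomp Require Import measurable_realfun perm.
From mathcomp Require Import ring lra.

(** Write L for the Laplacian applied to the coordinates of [x]: L = l1 x1 + l2 x2,
and L is normal to M because L = -n H.  Pairing L with a tangent vector and using
orthogonality, l1 |x1|^2 + l2 |x2|^2 is constant, say c.  Then Delta |x|^2 =
2 c - 2 n is constant; since the Laplacian of a function has integral 0, this
constant is 0 and |x|^2 is harmonic, hence constant on the closed manifold M.  As
l1 <> l2, both |x1| and |x2| are constant; c = n gives the formula for
|H|^2 = |L|^2 / n^2, and Delta |xi|^2 = 0 gives the energy densities and the
vanishing of the tensions.  The centers of mass vanish because
xi = li^-1 Delta xi with li <> 0.

The divergence theorem is obtained by cutting a function into pieces supported in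
single charts by C^2 bumps, and integrating the divergence form of the Laplacian
by iterated integration.  Only the metric induced by [x] occurs, so its
Christoffel symbols are g^kl <d_i d_j x, d_l x>, and the invariance of the
Laplacian under changes of charts reduces to the second-order chain rule. *)

Set Implicit Arguments.
Unset Strict Implicit.
Unset Printing Implicit Defensive.

Import Order.TTheory GRing.Theory Num.Theory.
Import numFieldNormedType.Exports.

Local Open Scope classical_set_scope.
Local Open Scope ring_scope.

(** * Directional derivatives and C^1 functions *)

(** [riemannian_volume] gives access to the volume only through iterated integrals, in a single
    chart, of nonnegative functions. The divergence theorem is therefore brought down to the
    fundamental theorem of calculus in one variable, by differentiating iterated integrals of
    continuous functions supported in a cube; a signed integrand is recovered from its positive and
    negative parts. The Laplacian at p is computed in a chart chosen for p, so even its continuity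
    rests on invariance under changes of charts. That a harmonic f is constant comes from
    integrating Delta(-f^2) = 2 |grad f|^2. This requires that a continuous nonnegative function of
    integral 0 vanish, that is, that small chart balls have positive volume. Orthogonality is used
    at two independent points, x1(p) against x2(q): one factor is held fixed while the other is
    differentiated, which removes the mixed terms <d_i x1, x2>. The squared norms of x1 and x2 then
    solve a 2 by 2 linear system with constant right-hand sides and determinant l2 - l1. *)

Lemma cvg_sum (R : realType) (I : finType) (T : Type) (F : set_system T)
    (FF : Filter F) (f : I -> T -> R) (a : I -> R) :
  (forall i, f i x @[x --> F] --> a i) ->
  (\sum_i f i x) @[x --> F] --> \sum_i a i.
Proof. by move=> fa; apply: cvg_big => //; exact: add_continuous. Qed.

Lemma derive1_line (R : realType) (V W : normedModType R) (f : V -> W)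
    (x v : V) : 'D_v f x = 'D_1 (fun h : R => f (h *: v + x)) 0.
Proof.
rewrite /derive; set g1 := fun h => h^-1 *: _; set g2 := fun h => h^-1 *: _.
suff -> : g1 = g2 by [].
by rewrite funeqE /g1 /g2 => h /=; rewrite addr0 scale0r add0r [_%:A]mulr1.
Qed.

Section LineDerivative.
Variables (R : realType) (V : normedModType R).

Lemma is_derive_line (f : V -> R) (u v : V) (s : R) :
  derivable f (s *: v + u) v ->
  is_derive s 1 (fun t : R => f (t *: v + u)) ('D_v f (s *: v + u)).
Proof.
have E : (fun h : R => h^-1 *: (((fun t : R => f (t *: v + u)) \o shift s) (h *: 1)
     - f (s *: v + u))) =
   (fun h => h^-1 *: ((f \o shift (s *: v + u)) (h *: v) - f (s *: v + u))).
  by apply/funext => h /=; rewrite [h *: 1]mulr1 scalerDl addrA.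
by move=> df; split; [rewrite /derivable E|rewrite /derive E].
Qed.

(** The bound [|c| <= |h|] treats both signs of h at once and keeps the intermediate point where
    derivability is assumed. *)
Lemma MVT_line (f : V -> R) (u v : V) (h : R) :
  (forall s : R, `|s| <= `|h| -> derivable f (s *: v + u) v) ->
  exists2 c : R, `|c| <= `|h| & f (h *: v + u) - f u = h * 'D_v f (c *: v + u).
Proof.
move=> df.
have D (s : R) : `|s| <= `|h| ->
    is_derive s 1 (fun t : R => f (t *: v + u)) ('D_v f (s *: v + u)).
  by move=> sh; apply: is_derive_line; exact: df.
have C (a b : R) : (forall s : R, s \in `[a, b] -> `|s| <= `|h|) ->
    {within `[a, b], continuous (fun t : R => f (t *: v + u))}.
  move=> ab; apply: derivable_within_continuous => s sab.
  exact: (@ex_derive _ _ _ _ _ _ _ (D s (ab s sab))).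
have [h0|h0] := leP 0 h.
  have ab (s : R) : s \in `[0, h] -> `|s| <= `|h|.
    by rewrite in_itv/= => /andP[s0 sh]; rewrite !ger0_norm.
  have [||c ch E] := @MVT_segment R (fun t => f (t *: v + u))
    (fun s => 'D_v f (s *: v + u)) 0 h h0.
  - by move=> s sh; apply/D/ab; apply: subset_itv_oo_cc sh.
  - exact: C.
  exists c; first exact: ab.
  by move: E; rewrite scale0r add0r subr0 mulrC.
have ab (s : R) : s \in `[h, 0] -> `|s| <= `|h|.
  by rewrite in_itv/= => /andP[s0 sh]; rewrite !ler0_norm ?lerN2// ltW.
have [||c ch E] := @MVT_segment R (fun t => f (t *: v + u))
  (fun s => 'D_v f (s *: v + u)) h 0 (ltW h0).
- by move=> s sh; apply/D/ab; apply: subset_itv_oo_cc sh.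
- exact: C.
exists c; first exact: ab.
move: E; rewrite scale0r add0r sub0r mulrN => /eqP.
by rewrite -eqr_oppLR opprB => /eqP ->; rewrite mulrC.
Qed.

End LineDerivative.

Section Gradient.
Variables (R : realType) (n : nat).
Implicit Types (f : 'rV[R]_n -> R) (u v : 'rV[R]_n) (U : set 'rV[R]_n).

Notation e_ i := (delta_mx 0 i : 'rV[R]_n).

Lemma norm_coord (v : 'rV[R]_n) i : `|v 0 i| <= `|v|.
Proof.
rewrite [leRHS]/Num.Def.normr/= mx_normrE.
exact: (le_bigmax _ (fun ij : 'I_1 * 'I_n => `|v ij.1 ij.2|) (0, i)).
Qed.

Lemma norm_rV_le (v : 'rV[R]_n) (e : R) : 0 <= e ->
  (forall i, `|v 0 i| <= e) -> `|v| <= e.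
Proof.
move=> e0 H; rewrite [leLHS]/Num.Def.normr/= mx_normrE.
by apply: bigmax_le => // -[i j] _ /=; rewrite ord1.
Qed.

Lemma norm_delta_le (s : R) i : `|s *: e_ i| <= `|s|.
Proof.
apply: norm_rV_le => // j; rewrite !mxE eqxx/=.
by case: eqP => _; rewrite ?mulr1 ?mulr0 ?normr0.
Qed.

(** The partial derivatives exist near u but are continuous at u only: this is exactly what the
    increment estimate consumes. *)
Definition C1_at f u :=
  (\forall w \near u, forall i, derivable f w (e_ i)) /\
  (forall i, {for u, continuous (pderiv i f)}).

(** Vertices of a path from 0 to h that switches on one coordinate at a time. Each edge is parallel
    to an axis, so a single partial derivative controls it, and the path stays within norm [|h|]. *)
Let stair (h : 'rV[R]_n) (k : nat) : 'rV[R]_n :=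
  \row_j (if (j < k)%N then h 0 j else 0).

Let stairS (h : 'rV[R]_n) (k : 'I_n) : stair h k.+1 = h 0 k *: e_ k + stair h k.
Proof.
apply/rowP => j; rewrite !mxE eqxx /= ltnS leq_eqVlt.
case: (eqVneq j k) => [->|jk]; first by rewrite eqxx ltnn mulr1 addr0.
by rewrite (_ : (j == k :> nat) = false) /= ?mulr0 ?add0r//; apply/negbTE.
Qed.

Let stair_le (h : 'rV[R]_n) (k : 'I_n) (s : R) : `|s| <= `|h 0 k| ->
  `|s *: e_ k + stair h k| <= `|h|.
Proof.
move=> sh; apply: norm_rV_le => // j; rewrite !mxE eqxx /=.
case: (eqVneq j k) => [->|jk].
  by rewrite ltnn mulr1 addr0 (le_trans sh)// norm_coord.
rewrite mulr0 add0r; case: ifP => _; last by rewrite normr0.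
exact: norm_coord.
Qed.

Lemma C1_increment f u (e : R) : C1_at f u -> 0 < e ->
  \forall h \near (0 : 'rV[R]_n), `|f (h + u) - f u - \sum_i h 0 i * pderiv i f u|
                     <= e * `|h|.
Proof.
move=> [df cf] e0.
(* Each of the n edges contributes an error of at most [e' * |h|]; dividing by n + 1 also covers n =
   0. *)
pose e' := e / n.+1%:R.
have e'0 : 0 < e' by rewrite divr_gt0.
have cf' : \forall w \near u, forall i, `|pderiv i f u - pderiv i f w| < e'.
  apply: (@filter_forall _ _ _ _ (nbhs_filter u)) => i.
  by have /cvgrPdist_lt := cf i; exact.
have /nbhs_normP[d /= d0 Hd] : \forall w \near u,
   (forall i, derivable f w (e_ i)) /\
   (forall i, `|pderiv i f u - pderiv i f w| < e').
  by near do split.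
near=> h.
have hd : `|h| < d by near: h; exact: (@nbhs0_lt R 'rV[R]_n d d0).
have near_u w : `|w| <= `|h| -> (forall i, derivable f (w + u) (e_ i)) /\
   (forall i, `|pderiv i f u - pderiv i f (w + u)| < e').
  move=> wh; apply: Hd; rewrite /ball_/= opprD addrCA subrr addr0 normrN.
  exact: le_lt_trans hd.
have -> : f (h + u) - f u = \sum_(k < n) (f (stair h k.+1 + u) - f (stair h k + u)).
  rewrite -(big_mkord xpredT (fun k => f (stair h k.+1 + u) - f (stair h k + u))).
  rewrite telescope_sumr//; congr (f (_ + _) - f _).
    by apply/rowP => j; rewrite mxE ltn_ord.
  by rewrite -[LHS]add0r; congr (_ + _); apply/rowP => j; rewrite !mxE.
rewrite -sumrB (le_trans (ler_norm_sum _ _ _))//.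
have step (k : 'I_n) : `|f (stair h k.+1 + u) - f (stair h k + u)
     - h 0 k * pderiv k f u| <= e' * `|h|.
  rewrite stairS -(addrA (_ *: _)).
  have [s sh|c ch E] := @MVT_line R _ f (stair h k + u) (e_ k) (h 0 k).
    by rewrite addrA; apply: (near_u _ (stair_le sh)).1.
  rewrite E -mulrBr normrM mulrC ler_pM//; last exact: norm_coord.
  rewrite distrC addrA ltW//; exact: (near_u _ (stair_le ch)).2.
apply: (@le_trans _ _ (\sum_(k < n) e' * `|h|)); first exact: ler_sum.
rewrite sumr_const card_ord -[X in X <= _]mulr_natr mulrAC ler_wpM2r//.
by rewrite /e' mulrAC ler_pdivrMr// ler_pM2l// ler_nat.
Unshelve. all: by end_near. Qed.

Lemma C1_diff f u : C1_at f u ->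
  differentiable f u /\ forall v, 'd f u v = \sum_i v 0 i * pderiv i f u.
Proof.
move=> C.
pose df (v : 'rV[R]_n) : R := \sum_i v 0 i * pderiv i f u.
have ldf : linear df.
  move=> a v w; rewrite /df scaler_sumr -big_split/=; apply: eq_bigr => i _.
  by rewrite !mxE mulrDl -scalerAl.
pose M := GRing.isLinear.Build _ _ _ _ df ldf.
pose L : {linear 'rV[R]_n -> R} := HB.pack df M.
have cL : continuous (L : _ -> _).
  move=> w; rewrite /= /df; apply: (@cvg_sum _ _ _ _ (nbhs_filter w)) => i; apply: cvgMr_tmp.
  exact: coord_continuous.
have E (e : R) : 0 < e -> \forall h \near (0 : 'rV[R]_n),
    `|((f \o shift u) - (cst (f u) + df)) h| <= e * `|h|.
  move=> e0; have := C1_increment C e0.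
  by apply: filterS => h /=; rewrite !fctE /= opprD addrA.
have dE : 'd f u = df :> (_ -> _).
  by rewrite -[df]/(L : _ -> _); apply: diff_unique cL _; apply/eqaddoP.
split; last by move=> v; rewrite dE.
apply/diff_locallyP; rewrite dE; split; first exact: cL.
by apply/eqaddoP.
Qed.

Lemma C1_differentiable f u : C1_at f u -> differentiable f u.
Proof. by case/C1_diff. Qed.

Lemma C1_derive f u v : C1_at f u -> 'D_v f u = \sum_i v 0 i * pderiv i f u.
Proof. by move=> /C1_diff[df E]; rewrite deriveE. Qed.

(** Derivability of [tau] along v is enough: restricted to the line through p it is a differentiable
    curve, and the chain rule for differentials applies to f along that curve. *)
Lemma is_derive_comp_C1 (V : normedModType R) (tau : V -> 'rV[R]_n) f (p v : V) :
  derivable tau p v -> C1_at f (tau p) ->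
  is_derive p v (fun x => f (tau x))
    (\sum_a pderiv a f (tau p) * 'D_v (fun x => tau x 0 a) p).
Proof.
move=> dt C; have df := C1_differentiable C.
pose phi (h : R) := tau (h *: v + p).
have phi0 : phi 0 = tau p by rewrite /phi scale0r add0r.
have dphi : differentiable phi 0.
  by apply/derivable1_diffP; move/derivable1P : dt.
have dfphi : differentiable (f \o phi) 0.
  by apply: differentiable_comp; rewrite ?phi0.
have dphi1 : 'd phi 0 1 = 'D_v tau p by rewrite -deriveE// [RHS]derive1_line.
have D1 : derivable (fun x => f (tau x)) p v.
  by apply/derivable1P; have /derivable1_diffP := dfphi.
apply: DeriveDef => //.
rewrite derive1_line. rewrite -[X in derive X]/(f \o phi). rewrite deriveE//.
rewrite diff_comp//; last by rewrite phi0.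
rewrite /= dphi1 phi0 (C1_diff C).2.
by apply: eq_bigr => i _; rewrite derive_mx// mxE mulrC.
Qed.

End Gradient.

(** * Functions of class C^k *)

Section CrGeneral.
Variables (R : realType) (n : nat) (W : normedModType R).
Implicit Types (F G : 'rV[R]_n -> W) (U V : set 'rV[R]_n).

Lemma near_openE U u : open U -> U u -> \forall w \near u, U w.
Proof. by move=> oU Uu; exact: open_nbhs_nbhs. Qed.

Lemma near_eq_on U F G u : open U -> {in U, F =1 G} -> U u ->
  \forall w \near u, F w = G w.
Proof.
move=> oU FG Uu; apply: filterS (near_openE oU Uu) => w Uw.
by apply: FG; rewrite inE.
Qed.

Lemma near_eq_continuous (T : topologicalType) (S : topologicalType)
    (f h : T -> S) (u : T) :
  (\forall w \near u, f w = h w) -> {for u, continuous f} -> {for u, continuous h}.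
Proof.
move=> fh cf; rewrite /prop_for /continuous_at -(nbhs_singleton fh).
by apply: cvg_trans cf; apply: near_eq_cvg; apply: filterS fh => w ->.
Qed.

Lemma Cr_on_continuous k U F u : Cr_on k U F -> U u -> {for u, continuous F}.
Proof. by case: k => [|k] [cF _] /cF. Qed.

Lemma Cr_on_derivable k U F u i :
  Cr_on k.+1 U F -> U u -> derivable F u (delta_mx 0 i).
Proof. by move=> [_ /(_ i)[dF _]] /dF. Qed.

Lemma Cr_on_pderiv k U F i : Cr_on k.+1 U F -> Cr_on k U (pderiv i F).
Proof. by move=> [_ /(_ i)[]]. Qed.

Lemma Cr_on_ext k U F G : open U -> {in U, F =1 G} -> Cr_on k U F -> Cr_on k U G.
Proof.
move=> oU; elim: k F G => [|k IH] F G FG [cF dF].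
  by split=> // u Uu; apply: near_eq_continuous (cF u Uu); exact: (near_eq_on oU FG Uu).
split=> [u Uu|i].
  by apply: near_eq_continuous (cF u Uu); exact: (near_eq_on oU FG Uu).
have [dFi CFi] := dF i; split=> [u Uu|].
  by apply: near_eq_derivable (dFi u Uu); exact: (near_eq_on oU FG Uu).
apply: IH CFi => u; rewrite inE => Uu.
by apply: near_eq_derive; exact: (near_eq_on oU FG Uu).
Qed.

(** [Cr_on] is a conjunction of conditions at the single points of U, on derivatives taken in the
    whole space; hence V may vary with u and need not be open. *)
Lemma Cr_on_local k U F :
  (forall u, U u -> exists V, V u /\ Cr_on k V F) -> Cr_on k U F.
Proof.
elim: k F => [|k IH] F H.
  by split=> // u /H [V [Vu [cF _]]]; exact: cF.
split=> [u /H [V [Vu [cF _]]]|i]; first exact: cF.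
split=> [u /H [V [Vu CF]]|]; first exact: Cr_on_derivable CF Vu.
by apply: IH => u /H [V [Vu CF]]; exists V; split => //; exact: Cr_on_pderiv.
Qed.

Lemma Cr_on_sub k U V F : V `<=` U -> Cr_on k U F -> Cr_on k V F.
Proof. by move=> VU CF; apply: Cr_on_local => u /VU Uu; exists U. Qed.

Lemma Cr_onW k U F : Cr_on k.+1 U F -> Cr_on k U F.
Proof.
elim: k F => [|k IH] F [cF dF]; first by split.
by split=> // i; have [? /IH] := dF i.
Qed.

Lemma Cr_on0W k U F : Cr_on k U F -> Cr_on 0 U F.
Proof. by case: k => [//|k] []. Qed.

Lemma Cr_on_cst k U (a : W) : Cr_on k U (fun=> a).
Proof.
elim: k a => [|k IH] a; first by split=> // u _; exact: cst_continuous.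
split=> [u _|i]; first exact: cst_continuous.
split=> [u _|]; first exact: derivable_cst.
rewrite (_ : pderiv i _ = fun=> 0)//.
by apply/funext => u; exact: derive_cst.
Qed.

Lemma Cr_onD k U F G : open U ->
  Cr_on k U F -> Cr_on k U G -> Cr_on k U (fun u => F u + G u).
Proof.
move=> oU; elim: k F G => [|k IH] F G CF CG.
  split=> // u Uu; apply: continuousD; [exact: Cr_on_continuous CF Uu|].
  exact: Cr_on_continuous CG Uu.
split=> [u Uu|i].
  by apply: continuousD; [exact: Cr_on_continuous CF Uu|exact: Cr_on_continuous CG Uu].
split=> [u Uu|].
  by apply: derivableD; [exact: Cr_on_derivable CF Uu|exact: Cr_on_derivable CG Uu].
apply: (@Cr_on_ext _ _ (fun u => pderiv i F u + pderiv i G u)) => //.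
  move=> u; rewrite inE => Uu; rewrite /pderiv deriveD//.
    exact: Cr_on_derivable CF Uu.
  exact: Cr_on_derivable CG Uu.
by apply: IH; exact: Cr_on_pderiv.
Qed.

End CrGeneral.

Arguments Cr_on_continuous {R n W k U F u} _ _.
Arguments Cr_on_derivable {R n W k U F u} i _ _.
Arguments Cr_on_pderiv {R n W k U F} i _.

Section CrScalar.
Variables (R : realType) (n : nat).
Implicit Types (F G : 'rV[R]_n -> R) (U V : set 'rV[R]_n).

Lemma Cr_on_sum k U (I : finType) (F : I -> 'rV[R]_n -> R) : open U ->
  (forall i, Cr_on k U (F i)) -> Cr_on k U (fun u => \sum_i F i u).
Proof.
move=> oU CF; rewrite /index_enum; elim: (Finite.enum _) => [|i s IH].
  rewrite (_ : (fun _ => _) = fun=> 0); first exact: Cr_on_cst.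
  by apply/funext => u; rewrite big_nil.
rewrite (_ : (fun _ => _) = fun u => F i u + \sum_(j <- s) F j u).
  exact: Cr_onD.
by apply/funext => u; rewrite big_cons.
Qed.

Lemma Cr_onM k U F G : open U ->
  Cr_on k U F -> Cr_on k U G -> Cr_on k U (fun u => F u * G u).
Proof.
move=> oU; elim: k F G => [|k IH] F G CF CG.
  split=> // u Uu; apply: continuousM; [exact: Cr_on_continuous CF Uu|].
  exact: Cr_on_continuous CG Uu.
split=> [u Uu|i].
  by apply: continuousM; [exact: Cr_on_continuous CF Uu|exact: Cr_on_continuous CG Uu].
split=> [u Uu|].
  by apply: derivableM; [exact: Cr_on_derivable CF Uu|exact: Cr_on_derivable CG Uu].
apply: (@Cr_on_ext _ _ _ _ _ (fun u => F u * pderiv i G u + G u * pderiv i F u)) => //.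
  move=> u; rewrite inE => Uu; rewrite /pderiv deriveM//.
    exact: Cr_on_derivable CF Uu.
  exact: Cr_on_derivable CG Uu.
by apply: Cr_onD => //; apply: IH;
  [exact: Cr_onW|exact: Cr_on_pderiv|exact: Cr_onW|exact: Cr_on_pderiv].
Qed.

Lemma Cr_on_prod k U (I : finType) (F : I -> 'rV[R]_n -> R) : open U ->
  (forall i, Cr_on k U (F i)) -> Cr_on k U (fun u => \prod_i F i u).
Proof.
move=> oU CF; rewrite /index_enum; elim: (Finite.enum _) => [|i s IH].
  rewrite (_ : (fun _ => _) = fun=> 1); first exact: Cr_on_cst.
  by apply/funext => u; rewrite big_nil.
rewrite (_ : (fun _ => _) = fun u => F i u * \prod_(j <- s) F j u).
  exact: Cr_onM.
by apply/funext => u; rewrite big_cons.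
Qed.

Lemma Cr_onZ k U (a : R) F : open U -> Cr_on k U F -> Cr_on k U (fun u => a * F u).
Proof. by move=> oU CF; apply: Cr_onM => //; exact: Cr_on_cst. Qed.

Lemma Cr_onN k U F : open U -> Cr_on k U F -> Cr_on k U (fun u => - F u).
Proof.
move=> oU CF; rewrite (_ : (fun _ => _) = fun u => -1 * F u); first exact: Cr_onZ.
by apply/funext => u; rewrite mulN1r.
Qed.

Lemma Cr_onB k U F G : open U ->
  Cr_on k U F -> Cr_on k U G -> Cr_on k U (fun u => F u - G u).
Proof. by move=> oU CF CG; apply: Cr_onD => //; exact: Cr_onN. Qed.

Lemma pderiv_coord (m : nat) (F : 'rV[R]_n -> 'rV[R]_m) u i j :
  derivable F u (delta_mx 0 i) ->
  pderiv i F u 0 j = pderiv i (fun v => F v 0 j : R) u.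
Proof. by move=> dF; rewrite /pderiv derive_mx// mxE. Qed.

Lemma Cr_on_coord (m : nat) k U (F : 'rV[R]_n -> 'rV[R]_m) j : open U ->
  Cr_on k U F -> Cr_on k U (fun u => F u 0 j : R).
Proof.
move=> oU; elim: k F => [|k IH] F CF.
  split=> // u Uu; apply: (@continuous_comp _ _ _ F (fun v : 'rV[R]_m => v 0 j)).
    exact: Cr_on_continuous CF Uu.
  exact: coord_continuous.
split=> [u Uu|i].
  apply: (@continuous_comp _ _ _ F (fun v : 'rV[R]_m => v 0 j)).
    exact: Cr_on_continuous CF Uu.
  exact: coord_continuous.
split=> [u Uu|].
  by have /derivable_mxP := Cr_on_derivable i CF Uu; exact.
apply: (Cr_on_ext oU _ (IH _ (Cr_on_pderiv i CF))) => u; rewrite inE => Uu.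
by rewrite pderiv_coord//; exact: Cr_on_derivable CF Uu.
Qed.

Lemma Cr_on_C1_at k U F u : open U -> U u -> Cr_on k.+1 U F -> C1_at F u.
Proof.
move=> oU Uu CF; split.
  apply: filterS (near_openE oU Uu) => w Uw i; exact: Cr_on_derivable CF Uw.
by move=> i; exact: Cr_on_continuous (Cr_on_pderiv i CF) Uu.
Qed.

End CrScalar.

Lemma pderiv_comp (R : realType) (n q : nat) k (U : set 'rV[R]_n) (V : set 'rV[R]_q)
    (tau : 'rV[R]_n -> 'rV[R]_q) (F : 'rV[R]_q -> R) u i :
  open V -> U u -> V (tau u) ->
  Cr_on k.+1 U tau -> Cr_on k.+1 V F ->
  pderiv i (fun w => F (tau w)) u =
    \sum_a pderiv a F (tau u) * pderiv i (fun w => tau w 0 a : R) u.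
Proof.
move=> oV Uu Vu Ct CF.
have := @is_derive_comp_C1 R q _ tau F u (delta_mx 0 i).
by case=> //; [exact: Cr_on_derivable Ct Uu|exact: (Cr_on_C1_at oV Vu CF)].
Qed.

Lemma Cr_on_comp (R : realType) (n q : nat) k (U : set 'rV[R]_n) (V : set 'rV[R]_q)
    (tau : 'rV[R]_n -> 'rV[R]_q) (F : 'rV[R]_q -> R) :
  open U -> open V -> (forall u, U u -> V (tau u)) ->
  Cr_on k U tau -> Cr_on k V F -> Cr_on k U (fun u => F (tau u)).
Proof.
move=> oU oV UV; elim: k F => [|k IH] F Ct CF.
  split=> // u Uu; apply: continuous_comp; first exact: Cr_on_continuous Ct Uu.
  exact: Cr_on_continuous CF (UV _ Uu).
split=> [u Uu|i].
  apply: continuous_comp; first exact: Cr_on_continuous Ct Uu.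
  exact: Cr_on_continuous CF (UV _ Uu).
split=> [u Uu|].
  have := @is_derive_comp_C1 R q _ tau F u (delta_mx 0 i).
  by case=> //; [exact: Cr_on_derivable Ct Uu|exact: (Cr_on_C1_at oV (UV _ Uu) CF)].
apply: (@Cr_on_ext _ _ _ _ _
  (fun u => \sum_a pderiv a F (tau u) * pderiv i (fun w => tau w 0 a : R) u)) => //.
  move=> u; rewrite inE => Uu; apply/esym.
  exact: (pderiv_comp i oV Uu (UV _ Uu) Ct CF).
apply: Cr_on_sum => // a; apply: Cr_onM => //.
  by apply: IH; [exact: Cr_onW|exact: Cr_on_pderiv].
by apply: Cr_on_pderiv; exact: Cr_on_coord.
Qed.

Section Comp1.
Variables (R : realType).

Lemma is_derive_comp1 (V : normedModType R) (s : V -> R) (phi : R -> R) (u v : V) (d : R) :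
  derivable s u v -> is_derive (s u) (1 : R) phi d ->
  is_derive u v (fun w => phi (s w)) (d * 'D_v s u).
Proof.
move=> ds dphi.
have E : s (0 *: v + u) = s u by rewrite scale0r add0r.
have dsl : is_derive (0 : R) (1 : R) (fun h : R => s (h *: v + u)) ('D_v s u).
  by split; [move/derivable1P : ds|rewrite [RHS]derive1_line].
have {}dphi : is_derive (s (0 *: v + u)) (1 : R) phi d by rewrite E.
have [dc cE] := is_derive1_comp dphi dsl.
by split; [apply/derivable1P|rewrite [LHS]derive1_line].
Qed.

(** The successive derivatives of the outer function are supplied as the sequence [phi], the last
    one being merely continuous. It serves the square root in the volume density and the positive
    part in the bumps. *)
Lemma Cr_on_comp1 n k (U : set 'rV[R]_n) (D : set R) (s : 'rV[R]_n -> R)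
    (phi : nat -> R -> R) : open U ->
  (forall u, U u -> D (s u)) ->
  (forall j t, (j < k)%N -> D t -> is_derive t (1 : R) (phi j) (phi j.+1 t)) ->
  (forall t, D t -> {for t, continuous (phi k)}) ->
  Cr_on k U s -> Cr_on k U (fun u => phi 0%N (s u)).
Proof.
move=> oU UD; elim: k phi => [|k IH] phi dphi cphi Cs.
  split=> // u Uu; apply: continuous_comp; first exact: Cr_on_continuous Cs Uu.
  exact/cphi/UD.
have d0 u : U u -> derivable (phi 0%N) (s u) 1.
  by move=> Uu; have [] := dphi 0%N (s u) isT (UD _ Uu).
split=> [u Uu|i].
  apply: continuous_comp; first exact: Cr_on_continuous Cs Uu.
  apply: differentiable_continuous; apply/derivable1_diffP; exact: d0.
have D1 u : U u -> is_derive u (delta_mx 0 i) (fun w => phi 0%N (s w))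
    (phi 1%N (s u) * pderiv i s u).
  move=> Uu; apply: is_derive_comp1; first exact: Cr_on_derivable Cs Uu.
  exact/dphi/UD.
split=> [u /D1 []//|].
apply: (@Cr_on_ext _ _ _ _ _ (fun u => phi 1%N (s u) * pderiv i s u)) => //.
  by move=> u; rewrite inE => /D1 [_ <-].
apply: Cr_onM => //; last exact: Cr_on_pderiv.
apply: (IH (fun j => phi j.+1)) => // [j t jk Dt|]; last exact: Cr_onW.
exact: dphi.
Qed.

End Comp1.

(** * Symmetry of second partial derivatives *)

Section Schwarz.
Variables (R : realType) (n : nat).
Implicit Types (f : 'rV[R]_n -> R) (u : 'rV[R]_n).

(** The mean value theorem is applied twice: in direction i to the first difference [g] of f along
    e_j, then in direction j to [pderiv i f]. *)
Let second_difference f u (U : set 'rV[R]_n) (d h : R) i j :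
  (forall w, `|w - u| < d -> U w) -> Cr_on 2 U f -> 0 < h -> h + h < d ->
  exists2 w, `|w - u| <= h + h &
    f (h *: delta_mx 0 i + (h *: delta_mx 0 j + u)) - f (h *: delta_mx 0 j + u)
    - (f (h *: delta_mx 0 i + u) - f u) = h * (h * pderiv j (pderiv i f) w).
Proof.
move=> HU Cf h0 hd.
have inU (a b : R) : `|a| <= `|h| -> `|b| <= `|h| ->
    `|a *: delta_mx 0 i + (b *: delta_mx 0 j + u) - u| <= h + h.
  move=> ah bh; rewrite addrA addrK (le_trans (ler_normD _ _))//.
  by rewrite lerD// (le_trans (norm_delta_le _ _))// -[leRHS]ger0_norm// ltW.
have inU' (a b : R) : `|a| <= `|h| -> `|b| <= `|h| ->
    U (a *: delta_mx 0 i + (b *: delta_mx 0 j + u)).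
  by move=> ah bh; apply: HU; apply: le_lt_trans hd; exact: inU.
pose g (w : 'rV[R]_n) : R := f (h *: delta_mx 0 j + w) - f w.
have hh : `|h| <= `|h| by [].
have z0 : `|0 : R| <= `|h| by rewrite normr0.
have dg (s : R) : `|s| <= `|h| ->
    is_derive (s *: delta_mx 0 i + u) (delta_mx 0 i) g
     (pderiv i f (s *: delta_mx 0 i + (h *: delta_mx 0 j + u))
       - pderiv i f (s *: delta_mx 0 i + u)).
  move=> sh.
  have D1 : is_derive (s *: delta_mx 0 i + u) (delta_mx 0 i)
      (fun w => f (h *: delta_mx 0 j + w))
      (pderiv i f (s *: delta_mx 0 i + (h *: delta_mx 0 j + u))).
    have E : (fun t : R => t^-1 *:
        (f (h *: delta_mx 0 j + (t *: delta_mx 0 i + (s *: delta_mx 0 i + u))) -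
         f (h *: delta_mx 0 j + (s *: delta_mx 0 i + u)))) =
      (fun t : R => t^-1 *:
        (f (t *: delta_mx 0 i + (s *: delta_mx 0 i + (h *: delta_mx 0 j + u))) -
         f (s *: delta_mx 0 i + (h *: delta_mx 0 j + u)))).
      apply/funext => t; congr (_ *: (f _ - f _)); last by rewrite addrCA.
      by rewrite addrCA; congr (_ + _); rewrite addrCA.
    have := Cr_on_derivable i Cf (inU' s h sh hh).
    by move=> df; split; [rewrite /derivable /= E|rewrite /pderiv /derive /= E].
  have D2 : is_derive (s *: delta_mx 0 i + u) (delta_mx 0 i) f
      (pderiv i f (s *: delta_mx 0 i + u)).
    apply: DeriveDef => //; apply: Cr_on_derivable Cf _.
    by have := inU' s 0 sh z0; rewrite scale0r add0r.
  exact: is_deriveB.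
have [s sh|c ch E] := @MVT_line R _ g u (delta_mx 0 i) h.
  by have [] := dg s sh.
have [s sh|c' ch' E'] := @MVT_line R _ (pderiv i f) (c *: delta_mx 0 i + u) (delta_mx 0 j) h.
  have := inU' c s ch sh; rewrite addrCA => Us.
  exact: Cr_on_derivable (Cr_on_pderiv i Cf) Us.
exists (c *: delta_mx 0 i + (c' *: delta_mx 0 j + u)); first exact: inU.
have := dg c ch => -[_ Dg]; move: E; rewrite Dg.
rewrite (addrCA (c *: _)) E' /g (addrCA (c *: _)) => <-.
by rewrite (addrCA (h *: delta_mx 0 i)); ring.
Qed.

Let eq_limit (a b : 'rV[R]_n -> R) u :
  {for u, continuous a} -> {for u, continuous b} ->
  (forall d : R, 0 < d -> exists w1 w2, [/\ `|w1 - u| < d, `|w2 - u| < d &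
     b w1 = a w2]) -> a u = b u.
Proof.
move=> ca cb H; apply/eqP; rewrite -subr_eq0 -normr_le0.
apply/ler_addgt0Pr => e e0; rewrite add0r.
have e20 : 0 < e / 2 by rewrite divr_gt0.
have /nbhs_normP[d /= d0 Hd] : \forall w \near u, `|a u - a w| < e / 2 /\
    `|b u - b w| < e / 2.
  have /cvgrPdist_lt /(_ _ e20) N2 := ca.
  have /cvgrPdist_lt /(_ _ e20) N3 := cb.
  by apply: filterS2 N2 N3 => w ? ?; split.
have [w1 [w2 [w1u w2u E1]]] := H d d0.
have [_ B1] := Hd w1 ltac:(by rewrite /ball_/= distrC).
have [B2 _] := Hd w2 ltac:(by rewrite /ball_/= distrC).
rewrite -(subrKA (a w2)) (le_trans (ler_normD _ _))//.
by rewrite (splitr e) lerD// ltW// -E1 distrC.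
Qed.

(** The second difference of f is symmetric in i and j, so it is h^2 times either mixed derivative,
    each at some point near u. Continuity of both at u concludes as h tends to 0. *)
Lemma pderivC f u (U : set 'rV[R]_n) i j : open U -> U u -> Cr_on 2 U f ->
  pderiv i (pderiv j f) u = pderiv j (pderiv i f) u.
Proof.
move=> oU Uu Cf; apply: eq_limit.
- exact: (Cr_on_continuous (Cr_on_pderiv i (Cr_on_pderiv j Cf)) Uu).
- exact: (Cr_on_continuous (Cr_on_pderiv j (Cr_on_pderiv i Cf)) Uu).
have /nbhs_normP[d' /= d'0 Hd] := near_openE oU Uu.
move=> d0 d00; pose d := Num.min d0 d'.
have dp : 0 < d by rewrite lt_min d00.
have HU (w : 'rV[R]_n) : `|w - u| < d -> U w.
  by rewrite lt_min => /andP[_ wu]; apply: Hd; rewrite /ball_/= distrC.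
(* The two intermediate points lie within 2h of u, and 2d/3 < d. *)
pose h := d / 3.
have h0 : 0 < h by rewrite divr_gt0.
have hd : h + h < d by rewrite /h; lra.
have [w1 w1u E1] := second_difference i j HU Cf h0 hd.
have [w2 w2u E2] := second_difference j i HU Cf h0 hd.
have hd0 : h + h < d0 by apply: lt_le_trans hd _; rewrite ge_min lexx.
exists w1, w2; split; [exact: le_lt_trans hd0|exact: le_lt_trans hd0|].
have hn : h != 0 by rewrite gt_eqF.
move: E1 E2; move: (pderiv j _ w1) (pderiv i _ w2) => q1 q2.
rewrite (addrCA (h *: delta_mx 0 j)) => E1 E2.
apply: (mulfI hn); apply: (mulfI hn); rewrite -E1 -E2; ring.
Qed.

End Schwarz.

(** * Determinants of positive definite matrices *)

Section Edot.
Variables (R : realType) (m : nat).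
Implicit Types v w : 'rV[R]_m.

Lemma edotE v w : edot v w = \sum_a v 0 a * w 0 a.
Proof. by rewrite /edot mxE; apply: eq_bigr => a _; rewrite mxE. Qed.

Lemma edotC v w : edot v w = edot w v.
Proof. by rewrite !edotE; apply: eq_bigr => a _; rewrite mulrC. Qed.

Lemma edotDl v1 v2 w : edot (v1 + v2) w = edot v1 w + edot v2 w.
Proof. by rewrite /edot mulmxDl mxE. Qed.

Lemma edotZl a v w : edot (a *: v) w = a * edot v w.
Proof. by rewrite /edot -scalemxAl mxE. Qed.

Lemma edotNl v w : edot (- v) w = - edot v w.
Proof. by rewrite /edot mulNmx mxE. Qed.

Lemma edotBl v1 v2 w : edot (v1 - v2) w = edot v1 w - edot v2 w.
Proof. by rewrite edotDl edotNl. Qed.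

Lemma edotDr v w1 w2 : edot v (w1 + w2) = edot v w1 + edot v w2.
Proof. by rewrite edotC edotDl !(edotC v). Qed.

Lemma edotZr a v w : edot v (a *: w) = a * edot v w.
Proof. by rewrite edotC edotZl (edotC v). Qed.

Lemma edot0l w : edot 0 w = 0.
Proof. by rewrite /edot mul0mx mxE. Qed.

Lemma edot_suml (I : Type) (s : seq I) (P : pred I) (F : I -> 'rV[R]_m) w :
  edot (\sum_(i <- s | P i) F i) w = \sum_(i <- s | P i) edot (F i) w.
Proof.
elim/big_rec2: _ => [|i y z _ <-]; first exact: edot0l.
by rewrite edotDl.
Qed.

Lemma edot_ge0 v : 0 <= edot v v.
Proof. by rewrite edotE sumr_ge0// => a _; rewrite -expr2 sqr_ge0. Qed.

Lemma edot_eq0 v : edot v v = 0 -> v = 0.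
Proof.
rewrite edotE => /eqP; rewrite psumr_eq0 => [/allP v0|a _]; last first.
  by rewrite -expr2 sqr_ge0.
apply/rowP => a; rewrite mxE; apply/eqP.
by have := v0 a (mem_index_enum _); rewrite mulf_eq0 orbb.
Qed.

End Edot.

Section BigDerive.
Variables (R : realType) (V : normedModType R).
Implicit Types (x v : V).

Lemma is_derive_bigsum (I : Type) (s : seq I) (h : I -> V -> R) (dh : I -> R) x v :
  (forall i, is_derive x v (h i) (dh i)) ->
  is_derive x v (fun y => \sum_(i <- s) h i y) (\sum_(i <- s) dh i).
Proof.
move=> H; elim: s => [|i s IH].
  rewrite big_nil (_ : (fun _ => _) = cst 0); first exact: is_derive_cst.
  by apply/funext => y; rewrite big_nil.
rewrite big_cons (_ : (fun _ => _) = h i + (fun y => \sum_(j <- s) h j y)).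
  exact: is_deriveD.
by apply/funext => y; rewrite big_cons.
Qed.

Lemma is_derive_bigprod (I : eqType) (s : seq I) (h : I -> V -> R) (dh : I -> R) x v :
  uniq s -> (forall i, is_derive x v (h i) (dh i)) ->
  is_derive x v (fun y => \prod_(i <- s) h i y)
    (\sum_(a <- s) \prod_(i <- s) (if i == a then dh i else h i x)).
Proof.
move=> + H; elim: s => [_|i s IH /= /andP[iNs /IH {}IH]].
  rewrite big_nil (_ : (fun _ => _) = cst 1); first exact: is_derive_cst.
  by apply/funext => y; rewrite big_nil.
rewrite (_ : (fun _ => _) = h i * (fun y => \prod_(j <- s) h j y)); last first.
  by apply/funext => y; rewrite big_cons.
apply: (@is_derive_eq _ _ _ _ _ _ _ _ (is_deriveM (H i) IH)).
rewrite big_cons [RHS]addrC; congr (_ + _).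
  rewrite scaler_sumr !big_seq; apply: eq_bigr => a sa.
  by rewrite big_cons (_ : (i == a) = false)//; apply: contraNF iNs => /eqP ->.
rewrite big_cons eqxx -[LHS]/(_ * _) mulrC; congr (_ * _).
rewrite !big_seq; apply: eq_bigr => j sj.
by rewrite (_ : (j == i) = false)//; apply: contraNF iNs => /eqP <-.
Qed.

(** Jacobi's formula. In the product rule for the Leibniz expansion, the terms that differentiate
    the factor of row a add up to the determinant with row a replaced by that of [dA]; its expansion
    along this row involves only cofactors of A itself. *)
Lemma is_derive_det n (A : V -> 'M[R]_n) (dA : 'M[R]_n) x v :
  (forall i j, is_derive x v (fun y => A y i j) (dA i j)) ->
  is_derive x v (fun y => \det (A y)) (\sum_i \sum_j dA i j * cofactor (A x) i j).
Proof.
move=> H; rewrite /determinant.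
have Hs (s : 'S_n) := is_derive_bigprod (index_enum_uniq 'I_n) (fun i => H i (s i)).
have Hs' (s : 'S_n) := is_deriveZ ((-1) ^+ s) (Hs s).
apply: (is_derive_eq (is_derive_bigsum _ Hs')).
rewrite -/(index_enum _).
under eq_bigr do rewrite scaler_sumr.
rewrite exchange_big /=; apply: eq_bigr => a _.
pose B := \matrix_(i, j) (if i == a then dA i j else A x i j).
transitivity (\det B).
  apply: eq_bigr => s _; congr (_ * _).
  by apply: eq_bigr => i _; rewrite mxE.
rewrite (expand_det_row _ a); apply: eq_bigr => j _.
rewrite mxE eqxx; congr (_ * _); rewrite /cofactor; congr (_ * \det _).
by apply/matrixP => i k; rewrite !mxE eq_sym (negbTE (neq_lift _ _)).
Qed.

End BigDerive.

Section PosDef.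
Variables (R : realType) (n : nat).

Definition posdef (G : 'M[R]_n) :=
  forall v : 'rV[R]_n, v != 0 -> 0 < (v *m G *m v^T) 0 0.

Lemma posdef_det_neq0 (G : 'M[R]_n) : posdef G -> \det G != 0.
Proof.
move=> pG; apply/negP => /det0P [v v0 vG].
by have := pG v v0; rewrite vG mul0mx mxE ltxx.
Qed.

Lemma posdef_scalar : posdef (1%:M : 'M[R]_n).
Proof.
move=> v v0; rewrite mulmx1 -/(edot v v) lt_neqAle edot_ge0 andbT eq_sym.
by apply: contra v0 => /eqP/edot_eq0 ->.
Qed.

Lemma posdef_comb (G H : 'M[R]_n) (a b : R) : posdef G -> posdef H ->
  0 <= a -> 0 <= b -> 0 < a + b -> posdef (a *: G + b *: H).
Proof.
move=> pG pH a0 b0 ab v v0.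
rewrite mulmxDr mulmxDl -!scalemxAr -!scalemxAl mxE [X in X + _]mxE [X in _ + X]mxE.
move: a0; rewrite le_eqVlt => /orP[/eqP a0|a0].
  by rewrite -a0 mul0r add0r mulr_gt0// ?pH//; rewrite -a0 add0r in ab.
by rewrite ltr_pwDl// ?mulr_gt0 ?pG// mulr_ge0// ltW// pH.
Qed.

(* The determinant does not vanish on the segment from the identity to G. *)
Lemma posdef_det_gt0 (G : 'M[R]_n) : posdef G -> 0 < \det G.
Proof.
move=> pG; rewrite lt_neqAle eq_sym posdef_det_neq0//= leNgt; apply/negP => dG.
pose P : 'M[{poly R}]_n := \matrix_(i, j) ('X * ((i == j)%:R)%:P + (1 - 'X) * (G i j)%:P).
have PE t : (\det P).[t] = \det (t *: 1%:M + (1 - t) *: G).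
  rewrite -horner_evalE -det_map_mx; congr (\det _).
  by apply/matrixP => i j; rewrite !mxE /= /horner_eval !hornerE.
have [t /andP[t0 t1]] : exists2 t, 0 <= t <= 1 & root (\det P) t.
  apply: poly_ivt; rewrite ?ler01// !PE.
  rewrite scale0r add0r subr0 scale1r subrr scale0r addr0 scale1r det1.
  by rewrite ltW//= ler01.
rewrite /root PE; apply/negP/posdef_det_neq0/posdef_comb => //.
- exact: posdef_scalar.
- by rewrite subr_ge0.
- by rewrite addrC subrK.
Qed.

End PosDef.

(** * Compactly supported functions *)

Section ConsRow.
Variables (R : realType) (k : nat).
Implicit Types (t s : R) (v w : 'rV[R]_k).

(** The block row with which [integral_Rn] peels off its first variable. *)
Definition row_cons t v : 'rV[R]_k.+1 := row_mx (t%:M : 'rV[R]_1) v.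

Lemma row_cons0 t v : row_cons t v 0 ord0 = t.
Proof.
have E : @ord0 k = lshift k (@ord0 0) by exact/val_inj.
by rewrite E; have := row_mxEl (t%:M : 'rV[R]_1) v 0 ord0; rewrite [RHS]mxE.
Qed.

Lemma row_consS t v i : row_cons t v 0 (lift ord0 i) = v 0 i.
Proof.
have E : lift (@ord0 k) i = rshift 1 i by exact/val_inj.
by rewrite E; exact: (row_mxEr (t%:M : 'rV[R]_1) v 0 i).
Qed.

Lemma row_cons_eq (t : R) v (u : 'rV[R]_k.+1) : u 0 ord0 = t ->
  (forall i, u 0 (lift ord0 i) = v 0 i) -> u = row_cons t v.
Proof.
move=> u0 uS; apply/rowP => j; case: (unliftP ord0 j) => [i ->|->].
  by rewrite uS row_consS.
by rewrite u0 row_cons0.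
Qed.

Lemma row_consB t s v w : row_cons t v - row_cons s w = row_cons (t - s) (v - w).
Proof.
apply: row_cons_eq => [|i].
  by rewrite mxE [X in _ + X]mxE !row_cons0.
by rewrite mxE [X in _ + X]mxE !row_consS mxE [X in _ = _ + X]mxE.
Qed.

Lemma row_cons_delta0 (h t : R) v : h *: delta_mx 0 ord0 + row_cons t v = row_cons (h + t) v.
Proof.
apply: row_cons_eq => [|i].
  by rewrite mxE [X in X + _]mxE mxE row_cons0 !eqxx mulr1.
rewrite mxE [X in X + _]mxE mxE row_consS eqxx andTb.
by rewrite (eq_sym (lift _ _)) (negbTE (neq_lift _ _)) mulr0 add0r.
Qed.

Lemma row_cons_deltaS (h t : R) v i :
  h *: delta_mx 0 (lift ord0 i) + row_cons t v = row_cons t (h *: delta_mx 0 i + v).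
Proof.
apply: row_cons_eq => [|j].
  by rewrite mxE [X in X + _]mxE mxE row_cons0 (negbTE (neq_lift _ _)) andbF mulr0 add0r.
rewrite mxE [X in X + _]mxE mxE row_consS (inj_eq lift_inj).
by rewrite [RHS]mxE [X in _ = X + _]mxE mxE.
Qed.

Lemma norm_row_cons_le t v (e : R) : 0 <= e -> `|t| <= e -> `|v| <= e ->
  `|row_cons t v| <= e.
Proof.
move=> e0 te ve; apply: norm_rV_le => // j.
case: (unliftP ord0 j) => [i ->|->]; last by rewrite row_cons0.
by rewrite row_consS (le_trans (norm_coord _ _)).
Qed.

Lemma norm_row_cons_lt t v (e : R) : `|t| < e -> `|v| < e -> `|row_cons t v| < e.
Proof.
move=> te ve; apply: (@le_lt_trans _ _ (Num.max `|t| `|v|)).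
  by apply: norm_row_cons_le; rewrite le_max ?normr_ge0 ?lexx ?orbT.
by rewrite gt_max te ve.
Qed.

Lemma norm_row_cons_l t v : `|t| <= `|row_cons t v|.
Proof. by rewrite -{1}(row_cons0 t v) norm_coord. Qed.

Lemma norm_row_cons_r t v : `|v| <= `|row_cons t v|.
Proof. by apply: norm_rV_le => // i; rewrite -(row_consS t v) norm_coord. Qed.

End ConsRow.

Lemma nbhs_norm_ball (R : realType) (V : normedModType R) (v0 : V) (d : R) :
  0 < d -> nbhs v0 [set v : V | `|v - v0| < d].
Proof.
move=> d0; have := nbhsx_ballx v0 _ d0; rewrite -ball_normE.
by apply: filterS => y; rewrite /ball_/= distrC.
Qed.

Section CompactSupport.
Variables (R : realType).

(** A cube of half-side L about the origin (the norm is the sup norm) stands for the compact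
    support: slices inherit the same L, and an integral in dimension k is bounded by the sup times
    [(2 L)^k]. *)
Definition cc n (L : R) (f : 'rV[R]_n -> R) :=
  continuous f /\ forall u, L < `|u| -> f u = 0.

Lemma closed_norm_ball_compact n (L : R) : compact [set v : 'rV[R]_n | `|v| <= L].
Proof.
apply: bounded_closed_compact.
  exists L; split; first exact: num_real.
  by move=> M LM v /= /le_trans; apply; exact: ltW.
rewrite -[X in closed X]/((Num.norm : 'rV[R]_n -> R) @^-1` [set x | x <= L]).
apply: preimage_closed; last exact: closed_le.
by move=> v _; exact: norm_continuous.
Qed.

(** Compactness of the cube in v makes the continuity in t uniform in v; outside the cube both
    slices vanish. *)
Lemma cc_near_slice n (L : R) (f : 'rV[R]_n.+1 -> R) (t0 e : R) : cc L f -> 0 < e ->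
  \forall t \near t0, forall v, `|f (row_cons t v) - f (row_cons t0 v)| < e.
Proof.
move=> [cf f0] e0.
have : \forall t \near t0, [set v : 'rV[R]_n | `|v| <= L] `<=`
    [set v | `|f (row_cons t v) - f (row_cons t0 v)| < e].
  have /compact_near_coveringP nc := @closed_norm_ball_compact n L.
  apply: (nc _ _ (fun t v => `|f (row_cons t v) - f (row_cons t0 v)| < e)
    (nbhs_filter t0)) => v0 _.
  have e20 : 0 < e / 2 by rewrite divr_gt0.
  have /cvgrPdist_lt /(_ _ e20) /nbhs_normP [d /= d0 Hd] := cf (row_cons t0 v0).
  have B t v : `|t - t0| < d -> `|v - v0| < d ->
      `|f (row_cons t0 v0) - f (row_cons t v)| < e / 2.
    move=> td vd; apply: Hd; rewrite /ball_/= row_consB.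
    by apply: norm_row_cons_lt; rewrite distrC.
  have Nv := nbhs_norm_ball v0 d0; have Nt := nbhs_norm_ball t0 d0.
  exists ([set v | `|v - v0| < d], [set t | `|t - t0| < d]); first by split.
  move=> [v t] [/= vd td].
  rewrite -(subrKA (f (row_cons t0 v0))) (le_lt_trans (ler_normD _ _))//.
  rewrite (splitr e) ltrD//; first by rewrite distrC; exact: B.
  by apply: B => //; rewrite subrr normr0.
apply: filterS => t H v.
have [vL|Lv] := leP `|v| L; first exact: H.
rewrite !f0 ?subrr ?normr0//; exact: lt_le_trans (norm_row_cons_r _ _).
Qed.

Lemma row_cons_continuous n (t : R) : continuous (fun v : 'rV[R]_n => row_cons t v).
Proof.
move=> v; apply/(@cvgrPdist_lt _ _ _ _ (nbhs_filter v)) => e e0.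
apply: (@filterS _ _ (nbhs_filter v) _ _ _ (nbhs_norm_ball v e0)) => w /= vw.
rewrite row_consB subrr.
by apply: norm_row_cons_lt; rewrite ?normr0// distrC.
Qed.

Lemma cc_slice n (L : R) (f : 'rV[R]_n.+1 -> R) t : cc L f ->
  cc L (fun v => f (row_cons t v)).
Proof.
move=> [cf f0]; split.
  move=> v; apply: (@continuous_comp _ _ _ (fun v : 'rV[R]_n => row_cons t v) f).
    exact: row_cons_continuous.
  exact: cf.
by move=> v Lv; apply: f0; apply: lt_le_trans Lv (norm_row_cons_r _ _).
Qed.

Lemma cc_slice0 n (L : R) (f : 'rV[R]_n.+1 -> R) t : cc L f -> L < `|t| ->
  (fun v => f (row_cons t v)) = fun=> 0.
Proof.
move=> [cf f0] Lt; apply/funext => v; apply: f0.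
exact: lt_le_trans Lt (norm_row_cons_l _ _).
Qed.

Lemma ccD n (L : R) (f h : 'rV[R]_n -> R) : cc L f -> cc L h -> cc L (fun u => f u + h u).
Proof.
move=> [cf f0] [ch h0]; split=> [u|u Lu]; last by rewrite f0// h0// addr0.
by apply: continuousD; [exact: cf|exact: ch].
Qed.

Lemma ccZ n (L a : R) (f : 'rV[R]_n -> R) : cc L f -> cc L (fun u => a * f u).
Proof.
move=> [cf f0]; split=> [u|u Lu]; last by rewrite f0// mulr0.
by apply: continuousM; [exact: cst_continuous|exact: cf].
Qed.

Lemma cc0 n (L : R) : cc L (fun _ : 'rV[R]_n => 0 : R).
Proof. by split=> // u; exact: cst_continuous. Qed.

Lemma cc_sum n (L : R) (I : finType) (f : I -> 'rV[R]_n -> R) :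
  (forall i, cc L (f i)) -> cc L (fun u => \sum_i f i u).
Proof.
move=> H; rewrite /index_enum; elim: (Finite.enum _) => [|i s IH].
  rewrite (_ : (fun _ => _) = fun=> 0); first exact: cc0.
  by apply/funext => u; rewrite big_nil.
rewrite (_ : (fun _ => _) = fun u => f i u + \sum_(j <- s) f j u).
  exact: ccD.
by apply/funext => u; rewrite big_cons.
Qed.

End CompactSupport.

(** * Continuous functions of one variable with bounded support *)

Section OneDim.
Variables (R : realType).
Notation mu := (@lebesgue_measure R).
Implicit Types (F : R -> R) (L : R).

Definition cc1 L F := continuous F /\ forall t, L < `|t| -> F t = 0.

Lemma cc1_restrict L F : cc1 L F -> F = F \_ `[- L, L].
Proof.
move=> [_ F0]; apply/funext => t; rewrite patchE; case: ifPn => // tL.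
apply: F0; rewrite ltNge; apply: contra tL; rewrite ler_norml => tL.
by rewrite inE /= in_itv.
Qed.

Lemma cc1_itv_integrable L F : cc1 L F -> mu.-integrable `[- L, L] (EFin \o F).
Proof.
move=> [cF _]; apply: continuous_compact_integrable; first exact: segment_compact.
exact: continuous_subspaceT.
Qed.

Lemma cc1_integrable L F : cc1 L F -> mu.-integrable setT (EFin \o F).
Proof.
move=> cF; rewrite (cc1_restrict cF) -restrict_EFin.
apply: (integrable_mkcond _ _).1; first exact: measurable_itv.
exact: cc1_itv_integrable cF.
Qed.

Lemma cc1_Rintegral L F : cc1 L F ->
  Rintegral mu setT F = Rintegral mu `[- L, L] F.
Proof. by move=> cF; rewrite [RHS]Rintegral_mkcond -(cc1_restrict cF). Qed.

Lemma cc1_bound L F C : 0 < L -> cc1 L F -> (forall t, `|F t| <= C) ->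
  `|Rintegral mu setT F| <= C * (2 * L).
Proof.
move=> L0 cF FC; rewrite (cc1_Rintegral cF).
apply: le_trans (le_normr_Rintegral _ (cc1_itv_integrable cF)) _ => //.
have mE : fine (mu `[- L, L]) = 2 * L.
  rewrite lebesgue_measure_itv /= lte_fin gtrN//= opprK; ring.
rewrite -mE -Rintegral_cst//.
apply: le_Rintegral => //.
- by apply: integrable_abse (cc1_itv_integrable cF).
- apply: continuous_compact_integrable; first exact: segment_compact.
  by apply: continuous_subspaceT => x; exact: cst_continuous.
Qed.

Lemma cc1_gt0 L F (t0 : R) : cc1 L F -> (forall t, 0 <= F t) -> 0 < F t0 ->
  0 < Rintegral mu setT F.
Proof.
move=> cF Fge0 Ft0.
have e0 : 0 < F t0 / 2 by rewrite divr_gt0.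
have /cvgrPdist_lt /(_ _ e0) /nbhs_normP [d /= d0 Hd] := cF.1 t0.
pose a := t0 - d / 2; pose b := t0 + d / 2.
have ab : a < b by rewrite /a /b ltrBlDr -addrA ltrDl -splitr.
have Fab t : `[a, b]%classic t -> F t0 / 2 <= F t.
  rewrite /= in_itv/= => /andP[at_ tb].
  have /Hd/= : ball_ Num.norm t0 d t.
    rewrite /ball_/= distrC ltr_norml; apply/andP; split.
      apply: (@lt_le_trans _ _ (- (d / 2))).
        by rewrite ltrN2 ltr_pdivrMr// ltr_pMr// ltr1n.
      by rewrite lerBrDl.
    apply: (@le_lt_trans _ _ (d / 2)); first by rewrite lerBlDl.
    by rewrite ltr_pdivrMr// ltr_pMr// ltr1n.
  by rewrite ltr_norml => /andP[_]; lra.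
have Iab : mu.-integrable `[a, b] (EFin \o F).
  apply: continuous_compact_integrable; first exact: segment_compact.
  by apply: continuous_subspaceT; exact: cF.1.
apply: (@lt_le_trans _ _ (Rintegral mu `[a, b] F)).
  apply: (@lt_le_trans _ _ (Rintegral mu `[a, b] (fun=> F t0 / 2))).
    have mE : fine (mu `[a, b]) = b - a.
      by rewrite lebesgue_measure_itv /= lte_fin ab.
    by rewrite Rintegral_cst// mE mulr_gt0// subr_gt0.
  apply: le_Rintegral => //.
  apply: continuous_compact_integrable; first exact: segment_compact.
  by apply: continuous_subspaceT => x; exact: cst_continuous.
rewrite /Rintegral fine_le//.
- exact: integrable_fin_num.
- exact: integrable_fin_num (cc1_integrable cF).
- apply: ge0_subset_integral => //; last by move=> t _; rewrite lee_fin.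
  by have /integrableP[] := cc1_integrable cF.
Qed.

Lemma cc1_derive0 L F (F' : R -> R) : 0 < L -> cc1 L F' ->
  (forall t : R, is_derive t (1 : R) F (F' t)) -> (forall t, L < `|t| -> F t = 0) ->
  Rintegral mu setT F' = 0.
Proof.
move=> L0 cF' dF F0.
(* F is known to vanish only where [|t| > L], so the fundamental theorem is applied on an interval
   reaching one unit beyond L, whose endpoints satisfy this. *)
have cF'1 : cc1 (L + 1) F'.
  split; first exact: cF'.1.
  by move=> t Lt; apply: cF'.2; apply: le_lt_trans Lt; rewrite lerDl.
have L1 : 0 < L + 1 by rewrite addr_gt0.
have FL : L < `|L + 1| by rewrite gtr0_norm// ltrDl.
rewrite (cc1_Rintegral cF'1) /Rintegral.
have cF t : {for t, continuous F}.
  apply/differentiable_continuous/derivable1_diffP; exact: (@ex_derive _ _ _ _ _ _ _ (dF t)).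
rewrite (@continuous_FTC2 R F' F); first last.
- by move=> x _; rewrite derive1E; exact: (@derive_val _ _ _ _ _ _ _ (dF x)).
- split; first by move=> x _; exact: (@ex_derive _ _ _ _ _ _ _ (dF x)).
    exact: cvg_at_right_filter (cF _).
  exact: cvg_at_left_filter (cF _).
- by apply: continuous_subspaceT; exact: cF'.1.
- by rewrite gtrN.
by rewrite !F0 ?normrN// subee.
Qed.

End OneDim.

(** * Iterated integrals *)

Section IteratedIntegral.
Variables (R : realType).
Notation mu := (@lebesgue_measure R).

(** Real-valued counterpart of [integral_Rn], on which linearity and differentiation can be stated
    for signed functions; [integral_Rn_iint] links the two. *)
Fixpoint iint (k : nat) : ('rV[R]_k -> R) -> R :=
  match k with
  | 0%N => fun f => f 0
  | k'.+1 => fun f =>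
      Rintegral mu setT (fun t => iint (fun v : 'rV[R]_k' => f (row_cons t v)))
  end.

Lemma Rintegral0 : Rintegral mu setT (fun=> 0 : R) = 0.
Proof. by rewrite /Rintegral integral0. Qed.

Lemma iint0 k : iint (fun _ : 'rV[R]_k => 0 : R) = 0.
Proof.
elim: k => [//|k IH] /=; rewrite (_ : (fun _ => _) = fun=> 0); first exact: Rintegral0.
by apply/funext.
Qed.

Lemma iint_ge0 k (f : 'rV[R]_k -> R) : (forall u, 0 <= f u) -> 0 <= iint f.
Proof.
elim: k f => [|k IH] f f0 /=; first exact: f0.
rewrite /Rintegral fine_ge0//; apply: integral_ge0 => t _; rewrite lee_fin.
by apply: IH => v; exact: f0.
Qed.

Section FixedSupport.
Variable L : R.
Hypothesis L0 : 0 < L.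

(** The three properties go through the induction together: in dimension k they make the integral of
    a slice continuous in t, and this continuity provides the integrability that linearity requires
    in dimension k + 1. *)
Let iint_props k :=
  [/\ forall f h : 'rV[R]_k -> R, cc L f -> cc L h ->
        iint (fun u => f u + h u) = iint f + iint h,
      forall (a : R) (f : 'rV[R]_k -> R), cc L f -> iint (fun u => a * f u) = a * iint f &
      forall (f : 'rV[R]_k -> R) C, cc L f -> (forall u, `|f u| <= C) ->
        `|iint f| <= C * (2 * L) ^+ k].

Let iint_slice_cc1 k (f : 'rV[R]_k.+1 -> R) : iint_props k -> cc L f ->
  cc1 L (fun t => iint (fun v => f (row_cons t v))).
Proof.
move=> [iD iZ iB] cf; split; last first.
  by move=> t Lt; rewrite (cc_slice0 cf Lt) iint0.
move=> t0; apply/cvgrPdist_lt => e e0.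
(* The 1 added to the volume of the cube makes the final inequality strict. *)
pose K := (2 * L) ^+ k + 1.
have K0 : 0 < K by rewrite ltr_wpDl// exprn_ge0// mulr_ge0// ltW.
have eK : 0 < e / K by rewrite divr_gt0.
apply: filterS (cc_near_slice t0 cf eK) => t Ht.
pose d v := f (row_cons t0 v) + -1 * f (row_cons t v).
have c0 := cc_slice t0 cf; have ct := cc_slice t cf; have ct' := ccZ (-1) ct.
have cd : cc L d := ccD c0 ct'.
have -> : iint (fun v => f (row_cons t0 v)) - iint (fun v => f (row_cons t v)) = iint d.
  by rewrite iD// iZ// mulN1r.
apply: (@le_lt_trans _ _ (e / K * (2 * L) ^+ k)).
  by apply: iB => // v; rewrite /d mulN1r distrC ltW.
by rewrite mulrAC ltr_pdivrMr// ltr_pM2l// ltrDl.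
Qed.

Let iint_propsP k : iint_props k.
Proof.
elim: k => [|k IH].
  by split=> //= f C _ fC; rewrite expr0 mulr1.
have cs := fun f => iint_slice_cc1 IH (f := f).
have [iD iZ iB] := IH; split=> [f h cf ch|a f cf|f C cf fC] /=.
- rewrite -RintegralD//; [|exact: cc1_integrable (cs _ cf)|exact: cc1_integrable (cs _ ch)].
  apply: eq_Rintegral => t _; apply: iD; exact: cc_slice.
- rewrite -RintegralZl//; last exact: cc1_integrable (cs _ cf).
  by apply: eq_Rintegral => t _; apply: iZ; exact: cc_slice.
- rewrite exprSr (mulrA C).
  have B t : `|iint (fun v => f (row_cons t v))| <= C * (2 * L) ^+ k.
    by apply: iB; [exact: cc_slice|move=> v; exact: fC].
  exact: (cc1_bound L0 (cs _ cf) B).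
Qed.

Lemma iintD k (f h : 'rV[R]_k -> R) : cc L f -> cc L h ->
  iint (fun u => f u + h u) = iint f + iint h.
Proof. by have [iD _ _] := iint_propsP k; exact: iD. Qed.

Lemma iintZ k (a : R) (f : 'rV[R]_k -> R) : cc L f ->
  iint (fun u => a * f u) = a * iint f.
Proof. by have [_ iZ _] := iint_propsP k; exact: iZ. Qed.

Lemma iint_bound k (f : 'rV[R]_k -> R) C : cc L f -> (forall u, `|f u| <= C) ->
  `|iint f| <= C * (2 * L) ^+ k.
Proof. by have [_ _ iB] := iint_propsP k; exact: iB. Qed.

Lemma iint_slice k (f : 'rV[R]_k.+1 -> R) : cc L f ->
  cc1 L (fun t => iint (fun v => f (row_cons t v))).
Proof. exact: iint_slice_cc1. Qed.

Lemma iint_sum k (I : finType) (f : I -> 'rV[R]_k -> R) : (forall i, cc L (f i)) ->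
  iint (fun u => \sum_i f i u) = \sum_i iint (f i).
Proof.
move=> cf; rewrite /index_enum.
have H s : cc L (fun u => \sum_(i <- s) f i u) /\
    iint (fun u => \sum_(i <- s) f i u) = \sum_(i <- s) iint (f i).
  elim: s => [|i s [cs IH]].
    rewrite (_ : (fun _ => _) = fun=> 0).
      by split; [exact: cc0|rewrite iint0 big_nil].
    by apply/funext => u; rewrite big_nil.
  rewrite (_ : (fun _ => _) = fun u => f i u + \sum_(j <- s) f j u).
    by split; [exact: ccD|rewrite big_cons iintD// IH].
  by apply/funext => u; rewrite big_cons.
exact: (H _).2.
Qed.

(** At each level the inner integral is continuous with bounded support, hence integrable, so taking
    [fine] loses nothing. *)
Lemma integral_Rn_iint k (f : 'rV[R]_k -> R) : cc L f ->
  integral_Rn (fun u => (f u)%:E) = (iint f)%:E.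
Proof.
elim: k f => [//|k IH] f cf /=.
have ci := cc1_integrable (iint_slice cf).
rewrite /Rintegral fineK; last exact: integrable_fin_num ci.
apply: eq_integral => t _; apply: IH; exact: cc_slice.
Qed.

Lemma iint_gt0 k (f : 'rV[R]_k -> R) u : cc L f -> (forall v, 0 <= f v) ->
  0 < f u -> 0 < iint f.
Proof.
elim: k f u => [|k IH] f u cf f0 fu /=.
  by rewrite (_ : 0 = u)//; apply/rowP => -[].
apply: (@cc1_gt0 _ L _ (u 0 ord0)).
- exact: iint_slice.
- by move=> t; apply: iint_ge0.
apply: (IH _ (\row_i u 0 (lift ord0 i))) => //; first exact: cc_slice.
suff <- : u = row_cons (u 0 ord0) (\row_i u 0 (lift ord0 i)) by [].
by apply: row_cons_eq => // i; rewrite mxE.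
Qed.

Let quotient_slice k (V : 'rV[R]_k.+1 -> R) t v i :
  (fun h : R => h^-1 *: (((fun w => V (row_cons t w)) \o shift v) (h *: delta_mx 0 i)
     - V (row_cons t v))) =
  (fun h : R => h^-1 *: ((V \o shift (row_cons t v)) (h *: delta_mx 0 (lift ord0 i))
     - V (row_cons t v))).
Proof. by apply/funext => h /=; rewrite row_cons_deltaS. Qed.

(** Differentiation under the integral sign. By the mean value theorem in the first variable, h
    times the derivative differs from the increment of V by at most [e / K * |h|], uniformly in v
    because the slices of the derivative vary uniformly. *)
Let iint_is_derive k (V : 'rV[R]_k.+1 -> R) t : cc L V -> cc L (pderiv ord0 V) ->
  (forall u, derivable V u (delta_mx 0 ord0)) ->
  is_derive t (1 : R) (fun s => iint (fun v => V (row_cons s v)))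
    (iint (fun v => pderiv ord0 V (row_cons t v))).
Proof.
move=> cV cD dV; set G := fun s => _; set F' := iint _.
have C : (fun h : R => h^-1 *: ((G \o shift t) (h *: (1 : R)) - G t)) @ 0^' --> F'.
  apply/cvgrPdist_le => e e0.
  pose K := (2 * L) ^+ k + 1.
  have K0 : 0 < K by rewrite ltr_wpDl// exprn_ge0// mulr_ge0// ltW.
  have eK : 0 < e / K by rewrite divr_gt0.
  have /nbhs_normP[d /= d0 Hd] := cc_near_slice t cD eK.
  near=> h.
  have hd : `|h| < d by near: h; exact: dnbhs0_lt.
  have h0 : h != 0 by near: h; exact: nbhs_dnbhs_neq.
  pose q v := h * pderiv ord0 V (row_cons t v) +
    (-1 * V (row_cons (h + t) v) + V (row_cons t v)).
  have c1 := cc_slice t cD; have c2 := cc_slice (h + t) cV; have c3 := cc_slice t cV.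
  have c1' := ccZ h c1; have c2' := ccZ (-1) c2; have c23 := ccD c2' c3.
  have cq : cc L q := ccD c1' c23.
  have E : h * F' - (G (h + t) - G t) = iint q.
    rewrite /q (iintD c1' c23) (iintZ h c1) (iintD c2' c3) (iintZ (-1) c2) /F' /G.
    ring.
  have bq v : `|q v| <= e / K * `|h|.
    have [s _|c ch Ec] := @MVT_line R _ V (row_cons t v) (delta_mx 0 ord0) h.
      exact: dV.
    rewrite row_cons_delta0 in Ec.
    have -> : q v = h * (pderiv ord0 V (row_cons t v) -
        pderiv ord0 V (row_cons (c + t) v)).
      have -> : q v = h * pderiv ord0 V (row_cons t v)
         - (V (row_cons (h + t) v) - V (row_cons t v)) by rewrite /q; ring.
      by rewrite Ec row_cons_delta0 mulrBr.
    rewrite normrM mulrC ler_pM2r ?normr_gt0// distrC ltW//.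
    apply: Hd; rewrite /ball_/= opprD addrCA subrr addr0 normrN.
    exact: le_lt_trans hd.
  rewrite /= [h *: 1]mulr1.
  have -> : F' - h^-1 *: (G (h + t) - G t) = h^-1 * iint q.
    by rewrite -E mulrBr mulrA mulVf// mul1r.
  rewrite normrM normfV ler_pdivrMl ?normr_gt0//.
  apply: le_trans (iint_bound cq bq) _.
  rewrite [_ / _ * _]mulrC -mulrA; apply: ler_wpM2l; first exact: normr_ge0.
  by rewrite mulrAC ler_pdivrMr// ler_pM2l// lerDl.
by split; [apply/cvg_ex; exists F'|exact/cvg_lim].
Unshelve. all: by end_near. Qed.

(** For the first variable, the integral is that of the derivative of a compactly supported function
    of t, so it vanishes by the fundamental theorem. For a later variable, the inner integral of
    every slice already vanishes by induction. *)
Lemma iint_pderiv k (V : 'rV[R]_k -> R) i : cc L V -> cc L (pderiv i V) ->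
  (forall u, derivable V u (delta_mx 0 i)) -> iint (pderiv i V) = 0.
Proof.
elim: k V i => [V []//|k IH] V i cV cD dV /=.
case: (unliftP ord0 i) cD dV => [j ->|->] cD dV; last first.
  have G0 t : L < `|t| -> iint (fun v => V (row_cons t v)) = 0.
    by move=> Lt; rewrite (cc_slice0 cV Lt) iint0.
  apply: (cc1_derive0 L0 (iint_slice cD) _ G0) => t.
  exact: iint_is_derive.
rewrite -[RHS]Rintegral0; apply: eq_Rintegral => t _.
have E v : pderiv (lift ord0 j) V (row_cons t v) =
    pderiv j (fun w => V (row_cons t w)) v.
  by rewrite /pderiv /derive quotient_slice.
have {}E : (fun v => pderiv (lift ord0 j) V (row_cons t v)) =
  pderiv j (fun w => V (row_cons t w)) by apply/funext.
rewrite E; apply: IH; first exact: cc_slice.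
  by rewrite -E; exact: cc_slice.
by move=> u; rewrite /derivable quotient_slice; exact: dV.
Qed.

End FixedSupport.
End IteratedIntegral.

(** * The divergence form of the Laplacian *)

Section PderivRules.
Variables (R : realType) (n : nat).
Implicit Types (f h : 'rV[R]_n -> R) (U : set 'rV[R]_n).

Lemma Cr_on_is_derive k U f u i : Cr_on k.+1 U f -> U u ->
  is_derive u (delta_mx 0 i) f (pderiv i f u).
Proof. by move=> Cf Uu; apply: DeriveDef => //; exact: (Cr_on_derivable i Cf Uu). Qed.

Lemma pderivM_on k U f h u i : Cr_on k.+1 U f -> Cr_on k.+1 U h -> U u ->
  pderiv i (fun v => f v * h v) u = f u * pderiv i h u + h u * pderiv i f u.
Proof.
move=> Cf Ch Uu; apply: deriveM; first exact: (Cr_on_derivable i Cf Uu).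
exact: (Cr_on_derivable i Ch Uu).
Qed.

Lemma pderivD_on k U f h u i : Cr_on k.+1 U f -> Cr_on k.+1 U h -> U u ->
  pderiv i (fun v => f v + h v) u = pderiv i f u + pderiv i h u.
Proof.
move=> Cf Ch Uu; apply: deriveD; first exact: (Cr_on_derivable i Cf Uu).
exact: (Cr_on_derivable i Ch Uu).
Qed.

Lemma pderiv_near_eq (W : normedModType R) U (f h : 'rV[R]_n -> W) u i : open U ->
  {in U, f =1 h} -> U u -> pderiv i f u = pderiv i h u.
Proof. by move=> oU fh Uu; apply: near_eq_derive; exact: (near_eq_on oU fh Uu). Qed.

Lemma pderiv_sum_on (I : finType) k U (f : I -> 'rV[R]_n -> R) u i :
  (forall a, Cr_on k.+1 U (f a)) -> U u ->
  pderiv i (fun v => \sum_a f a v) u = \sum_a pderiv i (f a) u.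
Proof.
move=> Cf Uu; have H a := Cr_on_is_derive i (Cf a) Uu.
by have [_ <-] := is_derive_bigsum (index_enum I) H.
Qed.

Lemma Cr_onV k U f : open U -> (forall u, U u -> f u != 0) ->
  Cr_on k U f -> Cr_on k U (fun u => (f u)^-1).
Proof.
move=> oU f0; elim: k => [|k IH] Cf.
  split=> // u Uu; apply: continuousV; first exact: f0.
  exact: (Cr_on_continuous Cf Uu).
split=> [u Uu|i].
  apply: continuousV; first exact: f0.
  exact: (Cr_on_continuous Cf Uu).
split=> [u Uu|].
  by apply: derivableV; [exact: f0|exact: (Cr_on_derivable i Cf Uu)].
apply: (@Cr_on_ext _ _ _ _ _
  (fun u => - ((f u)^-1 * ((f u)^-1 * pderiv i f u)))) => //.
  move=> u; rewrite inE => Uu; rewrite [RHS]deriveV ?f0//.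
    by rewrite scaleNr -exprVn expr2 /GRing.scale/= -mulrA.
  exact: (Cr_on_derivable i Cf Uu).
apply: Cr_onN => //; apply: Cr_onM => //; first exact/IH/Cr_onW.
by apply: Cr_onM => //; [exact/IH/Cr_onW|exact: Cr_on_pderiv].
Qed.

Lemma Cr_on_det k U q (A : 'rV[R]_n -> 'M[R]_q) : open U ->
  (forall i j, Cr_on k U (fun u => A u i j : R)) -> Cr_on k U (fun u => \det (A u)).
Proof.
move=> oU CA; rewrite /determinant; apply: Cr_on_sum => // s.
by apply: Cr_onZ => //; apply: Cr_on_prod => // i; exact: CA.
Qed.

End PderivRules.

Section DivergenceAlgebra.
Variables (R : realType) (n : nat).

Lemma exchange_big3 (I : finType) (F : I -> I -> I -> I -> R) (D : I -> I -> I -> I -> R) :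
  (forall i j k l, F i j k l = D k i j l) ->
  \sum_i \sum_j \sum_k \sum_l F i j k l = \sum_k \sum_i \sum_j \sum_l D k i j l.
Proof.
move=> FD; transitivity (\sum_i \sum_k \sum_j \sum_l F i j k l).
  by apply: eq_bigr => i _; rewrite exchange_big.
rewrite exchange_big; apply: eq_bigr => k _; apply: eq_bigr => i _.
by apply: eq_bigr => j _; apply: eq_bigr => l _.
Qed.

(** The index computation behind the divergence form of the Laplacian. Here g stands for the inverse
    metric, [P l a b] for the derivative of the metric entry (a, b) along l, p and q for the first
    and second derivatives of a function, D for the volume density. The left side is the expanded
    divergence of D grad f, the right side D times the trace of the Hessian with its Christoffel
    symbols. *)
Lemma divergence_identity (g : 'I_n -> 'I_n -> R) (P : 'I_n -> 'I_n -> 'I_n -> R)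
    (p : 'I_n -> R) (q : 'I_n -> 'I_n -> R) (D : R) :
  (forall i j, g i j = g j i) -> (forall i j k, P i j k = P i k j) ->
  \sum_i (D * (\sum_j (g i j * q i j + p j * - \sum_a \sum_b g i a * P i a b * g b j))
     + (\sum_j g i j * p j) * (2^-1 * D * \sum_a \sum_b g a b * P i a b)) =
  D * \sum_i \sum_j g i j * (q i j
    - \sum_k (2^-1 * \sum_l g k l * (P i j l + P j i l - P l i j)) * p k).
Proof.
move=> gC PC.
pose S1 := \sum_j \sum_i \sum_a \sum_b p j * g i a * P i a b * g b j.
pose S2 := \sum_j \sum_i \sum_a \sum_b p j * g i j * g a b * P i a b.
pose Q := \sum_i \sum_j g i j * q i j.
transitivity (D * (Q - S1 + 2^-1 * S2)).
  rewrite big_split /= -mulr_sumr 2!mulrDr; congr (_ + _).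
    rewrite -mulrDr; congr (_ * _); rewrite -sumrN.
    under eq_bigr do rewrite big_split /=.
    rewrite big_split /= ; congr (_ + _).
    rewrite exchange_big; apply: eq_bigr => j _; rewrite -sumrN; apply: eq_bigr => i _.
    rewrite mulrN mulr_sumr; congr (- _); apply: eq_bigr => a _.
    by rewrite mulr_sumr; apply: eq_bigr => b _; rewrite !mulrA.
  rewrite /S2 exchange_big 2!mulr_sumr; apply: eq_bigr => i _.
  rewrite mulr_suml [in RHS]mulr_sumr [RHS]mulr_sumr; apply: eq_bigr => j _.
  rewrite !mulr_sumr; apply: eq_bigr => a _.
  by rewrite !mulr_sumr; apply: eq_bigr => b _; ring.
congr (_ * _).
(* Of the three terms of the Christoffel symbol, the first two both contract to [S1] after
   relabelling, by symmetry of g, and the third contracts to [S2]. *)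
have -> : Q - S1 + 2^-1 * S2 = Q - 2^-1 * (S1 + S1 - S2) by field.
under [RHS]eq_bigr do under eq_bigr do rewrite mulrBr.
under [RHS]eq_bigr do rewrite big_split /=.
rewrite big_split /=; congr (_ + _).
under [RHS]eq_bigr do rewrite sumrN.
rewrite sumrN; congr (- _).
transitivity (2^-1 * \sum_i \sum_j \sum_k \sum_l
    g i j * g k l * p k * (P i j l + P j i l - P l i j)); last first.
  rewrite mulr_sumr; apply: eq_bigr => i _; rewrite mulr_sumr; apply: eq_bigr => j _.
  rewrite 2!mulr_sumr; apply: eq_bigr => k _.
  rewrite -mulrA mulr_suml !mulr_sumr; apply: eq_bigr => l _.
  ring.
congr (_ * _).
pose E i j k l := g i j * g k l * p k.
transitivity (\sum_i \sum_j \sum_k \sum_l E i j k l * P i j l +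
  \sum_i \sum_j \sum_k \sum_l E i j k l * P j i l -
  \sum_i \sum_j \sum_k \sum_l E i j k l * P l i j); last first.
  rewrite -big_split -sumrB /=; apply: eq_bigr => i _.
  rewrite -big_split -sumrB /=; apply: eq_bigr => j _.
  rewrite -big_split -sumrB /=; apply: eq_bigr => k _.
  rewrite -big_split -sumrB /=; apply: eq_bigr => l _.
  by rewrite /E; ring.
congr (_ + _ - _).
- rewrite /S1; apply/esym/exchange_big3 => i j k l.
  by rewrite /E (gC k l); ring.
- rewrite [RHS]exchange_big /=; rewrite /S1; apply/esym/exchange_big3 => i j k l.
  by rewrite /E (gC k l) (gC j i); ring.
- rewrite /S2; apply/esym.
  transitivity (\sum_k \sum_i \sum_j \sum_l E i j k l * P l i j).
    by apply: exchange_big3.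
  apply: eq_bigr => k _.
  transitivity (\sum_i \sum_l \sum_j E i j k l * P l i j).
    by apply: eq_bigr => i _; rewrite exchange_big.
  rewrite exchange_big; apply: eq_bigr => l _; apply: eq_bigr => i _.
  by apply: eq_bigr => j _; rewrite /E (gC k l); ring.
Qed.

End DivergenceAlgebra.

Section LocalMetric.
Variables (R : realType) (n : nat) (U : set 'rV[R]_n) (G : 'rV[R]_n -> 'M[R]_n).
Hypothesis oU : open U.
Hypothesis Gsym : forall u, U u -> (G u)^T = G u.
Hypothesis Gpos : forall u, U u -> posdef (G u).
Hypothesis Gsmooth : forall k i j, Cr_on k U (fun u => G u i j : R).

Notation gi u := (invmx (G u)).
Notation vol u := (Num.sqrt (\det (G u))).

Lemma metric_unit u : U u -> G u \in unitmx.
Proof. by move=> /Gpos/posdef_det_neq0; rewrite unitmxE unitfE. Qed.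

Lemma inv_metric_sym u i j : U u -> gi u i j = gi u j i.
Proof. by move=> Uu; rewrite -{1}(Gsym Uu) -trmx_inv mxE. Qed.

Lemma inv_metricK u i j : U u -> \sum_k gi u i k * G u k j = (i == j)%:R.
Proof.
move=> Uu; have /matrixP/(_ i j) := mulVmx (metric_unit Uu).
by rewrite !mxE.
Qed.

Lemma metricK u i j : U u -> \sum_k G u i k * gi u k j = (i == j)%:R.
Proof.
move=> Uu; have /matrixP/(_ i j) := mulmxV (metric_unit Uu).
by rewrite !mxE.
Qed.

Lemma cofactor_metric u i j : U u -> cofactor (G u) i j = \det (G u) * gi u j i.
Proof.
move=> Uu; rewrite /invmx (metric_unit Uu) !mxE mulrA divff ?mul1r//.
exact/posdef_det_neq0/Gpos.
Qed.

Lemma Cr_on_inv_metric k i j : Cr_on k U (fun u => gi u i j : R).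
Proof.
apply: (@Cr_on_ext _ _ _ _ _ (fun u => (\det (G u))^-1 * cofactor (G u) j i)) => //.
  move=> u; rewrite inE => Uu; rewrite cofactor_metric// mulrA mulVf ?mul1r//.
  exact/posdef_det_neq0/Gpos.
apply: Cr_onM => //.
  apply: Cr_onV => // [u Uu|]; first exact/posdef_det_neq0/Gpos.
  by apply: Cr_on_det => // a b; exact: Gsmooth.
apply: Cr_onZ => //; apply: Cr_on_det => // a b.
under eq_fun do rewrite !mxE; exact: Gsmooth.
Qed.

Lemma vol_gt0 u : U u -> 0 < vol u.
Proof. by move=> Uu; rewrite sqrtr_gt0; exact/posdef_det_gt0/Gpos. Qed.

Lemma is_derive_vol u l : U u -> is_derive u (delta_mx 0 l) (fun v => vol v)
  (2^-1 * vol u * \sum_a \sum_b gi u a b * pderiv l (fun v => G v a b : R) u).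
Proof.
move=> Uu.
pose dG := \matrix_(i, j) pderiv l (fun v => G v i j : R) u.
have HG i j : is_derive u (delta_mx 0 l) (fun v => G v i j : R) (dG i j).
  by rewrite mxE; exact: (Cr_on_is_derive l (Gsmooth 1 i j) Uu).
have D1 := is_derive_det HG.
have D2 := is_derive_comp1 (@ex_derive _ _ _ _ _ _ _ D1)
  (is_derive1_sqrt (posdef_det_gt0 (Gpos Uu))).
apply: (is_derive_eq D2); rewrite (@derive_val _ _ _ _ _ _ _ D1).
have v0 := vol_gt0 Uu.
have d0 : \det (G u) = vol u * vol u.
  by rewrite -expr2 sqr_sqrtr// ltW// posdef_det_gt0//; exact: Gpos.
move: v0 d0; set s := Num.sqrt _ => s0 d0.
rewrite !mulr_sumr; apply: eq_bigr => a _; rewrite !mulr_sumr; apply: eq_bigr => b _.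
rewrite mxE cofactor_metric// (inv_metric_sym b a Uu) d0.
by move: (pderiv _ _ _) => q; field; rewrite gt_eqF.
Qed.

(** Class C^1 is the order used: the density is differentiated once, in the divergence. *)
Lemma Cr_on_vol : Cr_on 1 U (fun u => vol u).
Proof.
have cd : Cr_on 1 U (fun u => \det (G u)).
  by apply: Cr_on_det => // i j; exact: Gsmooth.
pose phi (j : nat) : R -> R :=
  if j is 0%N then Num.sqrt else fun t => (2 * Num.sqrt t)^-1.
apply: (@Cr_on_comp1 _ _ 1 U [set t | 0 < t] _ phi) => //.
- by move=> u /Gpos/posdef_det_gt0.
- by move=> [|//] t _ t0; exact: is_derive1_sqrt.
- move=> t t0; apply: continuousV; first by rewrite mulf_neq0// gt_eqF// sqrtr_gt0.
  apply: continuousM; first exact: cst_continuous.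
  exact: sqrt_continuous.
Qed.

(** Differentiate the relation [gi * G = 1], then multiply by [gi] on the right. *)
Lemma pderiv_inv_metric u l i j : U u ->
  pderiv l (fun v => gi v i j : R) u =
  - \sum_a \sum_b gi u i a * pderiv l (fun v => G v a b : R) u * gi u b j.
Proof.
move=> Uu.
have E b : \sum_a (gi u i a * pderiv l (fun v => G v a b : R) u
    + G u a b * pderiv l (fun v => gi v i a : R) u) = 0.
  transitivity (pderiv l (fun v => \sum_a gi v i a * G v a b) u).
    have Cp a : Cr_on 1 U (fun v => gi v i a * G v a b).
      by apply: Cr_onM; [exact: oU|exact: Cr_on_inv_metric|exact: Gsmooth].
    rewrite (pderiv_sum_on l Cp Uu); apply: eq_bigr => a _; apply/esym.
    apply: (@pderivM_on _ _ 0 U) => //; exact: Cr_on_inv_metric.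
  rewrite (@pderiv_near_eq _ _ R U _ (fun=> (i == b)%:R : R) _ _ oU _ Uu).
    exact: derive_cst.
  by move=> v; rewrite inE => Uv; rewrite inv_metricK.
transitivity (\sum_a \sum_b (pderiv l (fun v => gi v i a : R) u * (G u a b * gi u b j))).
  rewrite (bigD1 j)//= [X in _ + X]big1 ?addr0 => [|a aj]; last first.
    by rewrite -mulr_sumr metricK// (negbTE aj) mulr0.
  by rewrite -mulr_sumr metricK// eqxx mulr1.
rewrite exchange_big [in RHS]exchange_big -sumrN; apply: eq_bigr => b _.
have := E b; rewrite big_split /= => /eqP; rewrite addrC addr_eq0 => /eqP Eb.
transitivity ((\sum_a G u a b * pderiv l (fun v => gi v i a : R) u) * gi u b j).
  by rewrite mulr_suml; apply: eq_bigr => a _; ring.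
by rewrite Eb mulNr mulr_suml.
Qed.

(** The formula Delta f = - div grad f, multiplied by the volume density so that the left side is a
    plain coordinate divergence, which iterated integration can treat. *)
Lemma divergence_laplacian (f : 'rV[R]_n -> R) u : U u -> Cr_on 2 U f ->
  \sum_i pderiv i (fun v => vol v * \sum_j gi v i j * pderiv j f v) u =
  - (vol u * local_laplacian G f u).
Proof.
move=> Uu Cf.
have Ci i j := Cr_on_inv_metric 1 i j.
have Cs i : Cr_on 1 U (fun v => \sum_j gi v i j * pderiv j f v).
  apply: Cr_on_sum => // j; apply: Cr_onM => //.
  exact: (Cr_on_pderiv j Cf).
transitivity (\sum_i (vol u * (\sum_j (gi u i j * pderiv i (pderiv j f) u + pderiv j f u *
   - \sum_a \sum_b gi u i a * pderiv i (fun v => G v a b : R) u * gi u b j))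
   + (\sum_j gi u i j * pderiv j f u) *
     (2^-1 * vol u * \sum_a \sum_b gi u a b * pderiv i (fun v => G v a b : R) u))).
  apply: eq_bigr => i _.
  rewrite (pderivM_on i Cr_on_vol (Cs i) Uu); congr (_ * _ + _ * _).
    have Cp j : Cr_on 1 U (fun v => gi v i j * pderiv j f v).
      exact: (Cr_onM oU (Ci i j) (Cr_on_pderiv j Cf)).
    rewrite (pderiv_sum_on i Cp Uu); apply: eq_bigr => j _.
    rewrite (pderivM_on i (Ci i j) (Cr_on_pderiv j Cf) Uu); congr (_ + _ * _).
    exact: pderiv_inv_metric.
  exact: (@derive_val _ _ _ _ _ _ _ (is_derive_vol i Uu)).
rewrite (@divergence_identity _ _ (fun i j => gi u i j)
  (fun i a b => pderiv i (fun v => G v a b : R) u) (fun j => pderiv j f u)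
  (fun i j => pderiv i (pderiv j f) u)); first last.
- move=> i a b; apply: (pderiv_near_eq i oU _ Uu) => v; rewrite inE => Uv.
  by rewrite -{1}(Gsym Uv) mxE.
- by move=> i j; exact: inv_metric_sym.
by rewrite /local_laplacian mulrN opprK.
Qed.

(** The inner product of the gradients of f and h for the metric G. *)
Definition gradot (f h : 'rV[R]_n -> R) u : R :=
  \sum_i \sum_j gi u i j * (pderiv i f u * pderiv j h u).

Lemma laplacianM (f h : 'rV[R]_n -> R) u : U u -> Cr_on 2 U f -> Cr_on 2 U h ->
  local_laplacian G (fun v => f v * h v) u =
  f u * local_laplacian G h u + h u * local_laplacian G f u - 2 * gradot f h u.
Proof.
move=> Uu Cf Ch.
have d1 v i : U v ->
    pderiv i (fun v => f v * h v) v = f v * pderiv i h v + h v * pderiv i f v.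
  by move=> Uv; exact: (pderivM_on i Cf Ch Uv).
have d2 i j : pderiv i (pderiv j (fun v => f v * h v)) u =
   f u * pderiv i (pderiv j h) u + pderiv j h u * pderiv i f u
   + (h u * pderiv i (pderiv j f) u + pderiv j f u * pderiv i h u).
  have Ch' := Cr_on_pderiv j Ch; have Cf' := Cr_on_pderiv j Cf.
  have Cf1 := Cr_onW Cf; have Ch1 := Cr_onW Ch.
  rewrite (@pderiv_near_eq _ _ R U _
    (fun v => f v * pderiv j h v + h v * pderiv j f v) _ _ oU _ Uu).
    rewrite (@pderivD_on _ _ 0 U _ _ _ _ (Cr_onM oU Cf1 Ch') (Cr_onM oU Ch1 Cf') Uu).
    by rewrite (pderivM_on _ Cf1 Ch' Uu) (pderivM_on _ Ch1 Cf' Uu).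
  by move=> v; rewrite inE; exact: d1.
rewrite /local_laplacian /mtrace /hessian /nabla_deriv.
under eq_bigr do under eq_bigr do rewrite d2.
under eq_bigr do under eq_bigr do under eq_bigr do rewrite d1//.
rewrite !mulrN.
have -> : 2 * gradot f h u = \sum_i \sum_j gi u i j * (pderiv i f u * pderiv j h u)
  + \sum_i \sum_j gi u i j * (pderiv j f u * pderiv i h u).
  rewrite mulr_natl mulr2n; congr (_ + _); rewrite /gradot exchange_big.
  by apply: eq_bigr => i _; apply: eq_bigr => j _; rewrite inv_metric_sym.
rewrite -!opprD; congr (- _).
rewrite !mulr_sumr -!big_split /=; apply: eq_bigr => i _.
rewrite !mulr_sumr -!big_split /=; apply: eq_bigr => j _.
set A := \sum_k _; set B := \sum_k _; set C := \sum_k _.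
have -> : A = f u * B + h u * C.
  rewrite /A /B /C !mulr_sumr -big_split /=; apply: eq_bigr => k _.
  rewrite /GRing.scale/=.
  by move: (christoffel _ _ _ _ _) (pderiv _ _ _) (pderiv _ _ _) => a b c; ring.
rewrite /GRing.scale/=.
move: (pderiv i (pderiv j h) u) (pderiv i (pderiv j f) u) (pderiv i f u) (pderiv j h u)
 (pderiv j f u) (pderiv i h u) => a b c d e e'; ring.
Qed.

End LocalMetric.

(** * Isometric immersions in a chart *)

(* Without this, unifying two different partial derivatives unfolds their limits. *)
Local Opaque pderiv edot.

Section VectorPderiv.
Variables (R : realType) (n m : nat).
Implicit Types (F H : 'rV[R]_n -> 'rV[R]_m) (U : set 'rV[R]_n).

Lemma pderiv_edot k U F H u i : open U -> Cr_on k.+1 U F -> Cr_on k.+1 U H -> U u ->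
  pderiv i (fun v => edot (F v) (H v)) u =
  edot (pderiv i F u) (H u) + edot (F u) (pderiv i H u).
Proof.
move=> oU CF CH Uu.
have cF c := Cr_on_coord c oU CF.
have cH c := Cr_on_coord c oU CH.
have -> : (fun v => edot (F v) (H v)) = fun v => \sum_c F v 0 c * H v 0 c.
  by apply/funext => v; exact: edotE.
rewrite (pderiv_sum_on i (fun c => Cr_onM oU (cF c) (cH c)) Uu).
rewrite !edotE -big_split /=; apply: eq_bigr => c _.
rewrite (pderivM_on i (cF c) (cH c) Uu) (pderiv_coord c (Cr_on_derivable i CF Uu)).
rewrite (pderiv_coord c (Cr_on_derivable i CH Uu)).
by move: (pderiv _ _ _) (pderiv _ _ _) => a b; ring.
Qed.

Lemma pderiv2_coord U F u i j c : open U -> Cr_on 2 U F -> U u ->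
  pderiv i (pderiv j F) u 0 c = pderiv i (pderiv j (fun v => F v 0 c : R)) u.
Proof.
move=> oU CF Uu.
rewrite (pderiv_coord c (Cr_on_derivable i (Cr_on_pderiv j CF) Uu)).
apply: (pderiv_near_eq i oU _ Uu) => v; rewrite inE => Uv.
exact: (pderiv_coord c (Cr_on_derivable j CF Uv)).
Qed.

Lemma pderivC_vec U F u i j : open U -> Cr_on 2 U F -> U u ->
  pderiv i (pderiv j F) u = pderiv j (pderiv i F) u.
Proof.
move=> oU CF Uu.
apply/rowP => c.
have := pderivC i j oU Uu (Cr_on_coord c oU CF).
rewrite -(pderiv2_coord i j c oU CF Uu).
rewrite -(pderiv2_coord j i c oU CF Uu).
exact.
Qed.

Lemma local_laplacian_coord U (G : 'rV[R]_n -> 'M[R]_n) F u c :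
  open U -> Cr_on 2 U F -> U u ->
  local_laplacian G F u 0 c = local_laplacian G (fun v => F v 0 c : R) u.
Proof.
move=> oU CF Uu.
rewrite /local_laplacian mxE.
apply: (congr1 (@GRing.opp R)).
rewrite /mtrace summxE.
apply: eq_bigr => i _.
rewrite summxE.
apply: eq_bigr => j _.
rewrite mxE /hessian mxE [X in _ * (_ + X)]mxE.
rewrite (pderiv2_coord i j c oU CF Uu) summxE.
congr (_ * (_ - _)).
by apply: eq_bigr => k _; rewrite mxE (pderiv_coord c (Cr_on_derivable k CF Uu)).
Qed.

End VectorPderiv.

Section LocalIsometric.
Variables (R : realType) (n m : nat) (U : set 'rV[R]_n) (G : 'rV[R]_n -> 'M[R]_n).
Hypothesis oU : open U.
Hypothesis Gsym : forall u, U u -> (G u)^T = G u.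
Hypothesis Gpos : forall u, U u -> posdef (G u).
Variable X : 'rV[R]_n -> 'rV[R]_m.
Hypothesis CX : forall k, Cr_on k U X.
Hypothesis GX : forall u i j, U u -> edot (pderiv i X u) (pderiv j X u) = G u i j.

Notation gi u := (invmx (G u)).
Notation Xc c := (fun v => X v 0 c : R).

Lemma pderiv_metric u l i j : U u ->
  pderiv l (fun v => G v i j : R) u =
  edot (pderiv l (pderiv i X) u) (pderiv j X u) +
  edot (pderiv i X u) (pderiv l (pderiv j X) u).
Proof.
move=> Uu; have C1 i' : Cr_on 1 U (pderiv i' X) by exact: Cr_on_pderiv.
rewrite -(pderiv_edot l oU (C1 i) (C1 j) Uu).
apply: (pderiv_near_eq l oU _ Uu) => v; rewrite inE => Uv.
by rewrite GX.
Qed.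

(** The cancellation of the Koszul formula, with D for the second and p for the first derivatives of
    the immersion. *)
Let koszul (D : 'I_n -> 'I_n -> 'rV[R]_m) (p : 'I_n -> 'rV[R]_m) i j l :
  (forall a b, D a b = D b a) ->
  2^-1 * (edot (D i j) (p l) + edot (p j) (D i l) +
    (edot (D j i) (p l) + edot (p i) (D j l)) -
    (edot (D l i) (p j) + edot (p i) (D l j))) = edot (D i j) (p l).
Proof.
move=> DC; rewrite (DC j i) (DC l i) (DC l j) (edotC (D i l)); by field.
Qed.

Lemma christoffel_isometric u k i j : U u ->
  christoffel G u k i j =
  \sum_l gi u k l * edot (pderiv i (pderiv j X) u) (pderiv l X u).
Proof.
move=> Uu; rewrite /christoffel mulr_sumr; apply: eq_bigr => l _.
rewrite mulrCA; congr (_ * _); rewrite !pderiv_metric//.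
apply: (koszul (D := fun a b => pderiv a (pderiv b X) u) (fun a => pderiv a X u)).
by move=> a b; exact: (pderivC_vec a b oU (CX 2) Uu).
Qed.

(** The Laplacian without its connection term, up to sign; by itself it depends on the
    coordinates. *)
Definition tr2 (f : 'rV[R]_n -> R) u : R :=
  \sum_i \sum_j gi u i j * pderiv i (pderiv j f) u.

Lemma nabla_deriv_isometric (W : normedModType R) (F : 'rV[R]_n -> W) u i j : U u ->
  nabla_deriv G F u i j = \sum_k \sum_l
    (gi u k l * edot (pderiv i (pderiv j X) u) (pderiv l X u)) *: pderiv k F u.
Proof.
move=> Uu; apply: eq_bigr => k _; rewrite christoffel_isometric//.
by rewrite scaler_suml.
Qed.

(** Inserting the extrinsic Christoffel symbols and summing over the ambient coordinate c last turns
    the connection term into products of [tr2] and [gradot]. A change of charts then only has to be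
    followed through these two. *)
Lemma local_laplacian_isometric (f : 'rV[R]_n -> R) u : U u ->
  local_laplacian G f u = - (tr2 f u - \sum_c tr2 (Xc c) u * gradot G f (Xc c) u).
Proof.
move=> Uu; congr (- _).
transitivity (\sum_i \sum_j (gi u i j * pderiv i (pderiv j f) u -
  \sum_c \sum_k \sum_l gi u i j * pderiv i (pderiv j (Xc c)) u *
    (gi u k l * (pderiv k f u * pderiv l (Xc c) u)))).
  apply: eq_bigr => i _; apply: eq_bigr => j _.
  rewrite /hessian [LHS]mulrBr; congr (_ - _).
  rewrite nabla_deriv_isometric// mulr_sumr exchange_big; apply: eq_bigr => k _.
  rewrite mulr_sumr exchange_big; apply: eq_bigr => l _.
  rewrite -[LHS]/(_ * (_ * _)) edotE mulr_sumr mulr_suml mulr_sumr; apply: eq_bigr => c _.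
  rewrite (pderiv2_coord i j c oU (CX 2) Uu).
  rewrite (pderiv_coord c (Cr_on_derivable l (CX 2) Uu)).
  move: (pderiv _ _ _) (pderiv _ _ _) (pderiv _ _ _) => a b d; ring.
under eq_bigr do rewrite sumrB.
rewrite sumrB; congr (_ - _).
under eq_bigr do rewrite exchange_big.
rewrite exchange_big; apply: eq_bigr => c _.
rewrite mulr_suml; apply: eq_bigr => i _.
rewrite mulr_suml; apply: eq_bigr => j _.
rewrite mulr_sumr; apply: eq_bigr => k _.
by rewrite mulr_sumr.
Qed.

(** The connection term subtracted in the Hessian of X is the tangential projection of its second
    derivative, so every entry of the Hessian is already normal, not only the trace. *)
Lemma edot_laplacian_tangent u l : U u ->
  edot (local_laplacian G X u) (pderiv l X u) = 0.
Proof.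
move=> Uu; rewrite /local_laplacian edotNl; apply/eqP; rewrite oppr_eq0; apply/eqP.
rewrite /mtrace edot_suml big1// => i _; rewrite edot_suml big1// => j _.
rewrite edotZl /hessian edotBl nabla_deriv_isometric// edot_suml.
set w := pderiv i (pderiv j X) u.
rewrite (_ : \sum_k _ = edot w (pderiv l X u)) ?subrr ?mulr0//.
under eq_bigr do rewrite edot_suml.
rewrite exchange_big /= (bigD1 l)//= [X in _ + X]big1 => [|b bl].
  transitivity ((\sum_k gi u l k * G u k l) * edot w (pderiv l X u) + 0).
    rewrite mulr_suml; congr (_ + _); apply: eq_bigr => k _.
    by rewrite edotZl GX// (inv_metric_sym Gsym _ _ Uu) mulrAC.
  by rewrite (inv_metricK Gpos)// eqxx mul1r addr0.
transitivity ((\sum_k gi u b k * G u k l) * edot w (pderiv b X u)).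
  rewrite mulr_suml; apply: eq_bigr => k _.
  by rewrite edotZl GX// (inv_metric_sym Gsym _ _ Uu) mulrAC.
by rewrite (inv_metricK Gpos)// (negbTE bl) mul0r.
Qed.

Lemma mean_curvature_laplacian u : U u ->
  local_mean_curvature G X u = - (n%:R^-1 *: local_laplacian G X u).
Proof.
move=> Uu; rewrite /local_mean_curvature /local_laplacian scalerN opprK.
congr (_ *: _); apply: eq_bigr => i _; apply: eq_bigr => j _; congr (_ *: _).
by rewrite /second_fundamental_form /normal_part /hessian nabla_deriv_isometric.
Qed.

Lemma trace_metric u : U u ->
  \sum_i \sum_j gi u i j * edot (pderiv i X u) (pderiv j X u) = n%:R.
Proof.
move=> Uu; transitivity (\sum_(i < n) (1 : R)).
  apply: eq_bigr => i _; transitivity (\sum_k gi u i k * G u k i).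
    apply: eq_bigr => k _; rewrite GX//.
    by have /matrixP/(_ k i) := Gsym Uu; rewrite mxE => ->.
  by rewrite (inv_metricK Gpos)// eqxx.
by rewrite sumr_const card_ord.
Qed.

End LocalIsometric.

(** * Invariance of the Laplacian under a change of coordinates [tau] *)

Section Invariance.
Variables (R : realType) (n m : nat) (U V : set 'rV[R]_n).
Variables (G G' : 'rV[R]_n -> 'M[R]_n).
Variables (X X' : 'rV[R]_n -> 'rV[R]_m) (tau : 'rV[R]_n -> 'rV[R]_n).
Hypotheses (oU : open U) (oV : open V).
Hypothesis Gpos : forall u, U u -> posdef (G u).
Hypothesis CX : forall k, Cr_on k U X.
Hypothesis GX : forall u i j, U u -> edot (pderiv i X u) (pderiv j X u) = G u i j.
Hypothesis Gsym' : forall u, V u -> (G' u)^T = G' u.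
Hypothesis Gpos' : forall u, V u -> posdef (G' u).
Hypothesis CX' : forall k, Cr_on k V X'.
Hypothesis GX' : forall u i j, V u -> edot (pderiv i X' u) (pderiv j X' u) = G' u i j.
Hypothesis tauV : forall u, U u -> V (tau u).
Hypothesis Ct : Cr_on 2 U tau.
Hypothesis XX' : forall u, U u -> X u = X' (tau u).

Let J (i a : 'I_n) u := pderiv i (fun w => tau w 0 a : R) u.

Let pderiv_tau (h : 'rV[R]_n -> R) u i : U u -> Cr_on 2 V h ->
  pderiv i (fun v => h (tau v)) u = \sum_a pderiv a h (tau u) * J i a u.
Proof. by move=> Uu Ch; exact: (pderiv_comp i oV Uu (tauV Uu) Ct Ch). Qed.

Let CJ i a : Cr_on 1 U (J i a).
Proof. exact: (Cr_on_pderiv i (Cr_on_coord a oU Ct)). Qed.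

Let pderiv2_tau (h : 'rV[R]_n -> R) u i j : U u -> Cr_on 2 V h ->
  pderiv i (pderiv j (fun v => h (tau v))) u =
  \sum_a (pderiv a h (tau u) * pderiv i (J j a) u +
     J j a u * \sum_b pderiv b (pderiv a h) (tau u) * J i b u).
Proof.
move=> Uu Ch.
have Ch1 a : Cr_on 1 V (pderiv a h) by exact: Cr_on_pderiv.
have Ct1 := Cr_onW Ct.
have Cht a : Cr_on 1 U (fun v => pderiv a h (tau v)).
  exact: (Cr_on_comp oU oV tauV Ct1 (Ch1 a)).
rewrite (@pderiv_near_eq _ _ R U _
  (fun v => \sum_a pderiv a h (tau v) * J j a v) _ _ oU _ Uu); last first.
  by move=> v; rewrite inE => Uv; rewrite pderiv_tau.
rewrite (pderiv_sum_on i (fun a => Cr_onM oU (Cht a) (CJ j a)) Uu).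
apply: eq_bigr => a _; rewrite (pderivM_on i (Cht a) (CJ j a) Uu).
congr (_ + _ * _).
exact: (pderiv_comp i oV Uu (tauV Uu) Ct1 (Ch1 a)).
Qed.

Let CXc c : Cr_on 2 V (fun v => X' v 0 c : R).
Proof. exact: Cr_on_coord. Qed.

Let XcE c u i : U u -> pderiv i (fun v => X v 0 c : R) u =
  pderiv i (fun v => X' (tau v) 0 c : R) u.
Proof.
move=> Uu; apply: (pderiv_near_eq i oU _ Uu) => v; rewrite inE => Uv.
by rewrite XX'.
Qed.

(** Both sides are Gram matrices, of the derivatives of X = X' o tau and of those of X'. *)
Let metric_tau u i j : U u ->
  G u i j = \sum_a \sum_b J i a u * G' (tau u) a b * J j b u.
Proof.
move=> Uu; have Vu := tauV Uu; rewrite -GX// edotE.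
have coordX i' c : pderiv i' X u 0 c =
    \sum_a pderiv a (fun v => X' v 0 c : R) (tau u) * J i' a u.
  rewrite (pderiv_coord c (Cr_on_derivable i' (CX 2) Uu)).
  by rewrite XcE// (pderiv_tau _ Uu (CXc c)).
under eq_bigr do rewrite !coordX mulr_suml.
rewrite exchange_big; apply: eq_bigr => a _.
under eq_bigr do rewrite mulr_sumr.
rewrite exchange_big; apply: eq_bigr => b _.
rewrite -GX'// edotE mulr_sumr mulr_suml; apply: eq_bigr => c _.
rewrite (pderiv_coord c (Cr_on_derivable a (CX' 2) Vu)).
rewrite (pderiv_coord c (Cr_on_derivable b (CX' 2) Vu)).
move: (pderiv _ _ _) (pderiv _ _ _) => p q; ring.
Qed.

Let inv_metric_tau u a b : U u ->
  \sum_i \sum_j invmx (G u) i j * (J i a u * J j b u) = invmx (G' (tau u)) a b.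
Proof.
move=> Uu; have Vu := tauV Uu.
pose A : 'M[R]_n := \matrix_(i, a) J i a u.
have GE : G u = A *m G' (tau u) *m A^T.
  apply/matrixP => i j; rewrite metric_tau// mxE exchange_big /=.
  apply: eq_bigr => c _; rewrite !mxE mulr_suml; apply: eq_bigr => d _.
  by rewrite !mxE.
have uG := metric_unit Gpos Uu; have uG' := metric_unit Gpos' Vu.
(* The Jacobian is invertible because it is a factor of the invertible matrix [G u]. *)
have uA : A \in unitmx.
  by move: uG; rewrite GE !unitmx_mul => /andP[/andP[]].
have uAT : A^T \in unitmx by rewrite unitmx_tr.
have E : A^T *m invmx (G u) *m A = invmx (G' (tau u)).
  have -> : invmx (G u) = invmx A^T *m invmx (G' (tau u)) *m invmx A.
    apply: (can_inj (mulKmx uG)); rewrite mulmxV// GE.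
    rewrite !mulmxA mulmxK// mulmxK// mulmxV//.
  by rewrite !mulmxA mulmxV// mul1mx -mulmxA mulVmx// mulmx1.
rewrite -E mxE exchange_big /=; apply: eq_bigr => j _.
rewrite !mxE mulr_suml; apply: eq_bigr => i _.
by rewrite !mxE; ring.
Qed.

Let sum_tau (F : 'I_n -> 'I_n -> R) u : U u ->
  \sum_i \sum_j invmx (G u) i j * (\sum_a \sum_b F a b * (J i a u * J j b u)) =
  \sum_a \sum_b invmx (G' (tau u)) a b * F a b.
Proof.
move=> Uu.
transitivity (\sum_a \sum_b \sum_i \sum_j F a b * (invmx (G u) i j * (J i a u * J j b u))).
  under eq_bigr => i _.
    under eq_bigr => j _.
      rewrite mulr_sumr; under eq_bigr => a _.
        rewrite mulr_sumr; under eq_bigr => b _ do rewrite mulrCA.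
        over.
      over.
    rewrite exchange_big /=; under eq_bigr => a _ do rewrite exchange_big /=.
    over.
  rewrite exchange_big /=; apply: eq_bigr => a _.
  by rewrite exchange_big.
apply: eq_bigr => a _; apply: eq_bigr => b _.
rewrite -inv_metric_tau// mulr_suml; apply: eq_bigr => i _.
by rewrite mulr_suml; apply: eq_bigr => j _; rewrite mulrC.
Qed.

Let gradot_tau (f h : 'rV[R]_n -> R) u : U u -> Cr_on 2 V f -> Cr_on 2 V h ->
  gradot G (fun v => f (tau v)) (fun v => h (tau v)) u = gradot G' f h (tau u).
Proof.
move=> Uu Cf Ch; rewrite /gradot -sum_tau//.
apply: eq_bigr => i _; apply: eq_bigr => j _; congr (_ * _).
rewrite (pderiv_tau _ Uu Cf) (pderiv_tau _ Uu Ch) mulr_suml; apply: eq_bigr => a _.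
rewrite mulr_sumr; apply: eq_bigr => b _; rewrite mulrACA; congr (_ * _).
Qed.

(** The second-order chain rule. The last sum, of first order in h, is the failure of [tr2] to be
    invariant. *)
Let tr2_tau (h : 'rV[R]_n -> R) u : U u -> Cr_on 2 V h ->
  tr2 G (fun v => h (tau v)) u = tr2 G' h (tau u)
    + \sum_a tr2 G (fun v => tau v 0 a : R) u * pderiv a h (tau u).
Proof.
move=> Uu Ch; rewrite /tr2.
transitivity (\sum_i \sum_j invmx (G u) i j * (\sum_a \sum_b
    pderiv a (pderiv b h) (tau u) * (J i a u * J j b u)) +
  \sum_a (\sum_i \sum_j invmx (G u) i j *
     pderiv i (pderiv j (fun v => tau v 0 a : R)) u) * pderiv a h (tau u)); last first.
  congr (_ + _); exact: (sum_tau (fun a b => pderiv a (pderiv b h) (tau u)) Uu).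
under [X in _ + X]eq_bigr => a _.
  rewrite mulr_suml; under eq_bigr do rewrite mulr_suml.
  over.
rewrite [X in _ + X]exchange_big -big_split /=; apply: eq_bigr => i _.
rewrite [X in _ + X]exchange_big -big_split /=; apply: eq_bigr => j _.
rewrite (pderiv2_tau _ _ Uu Ch) big_split /= mulrDr addrC; congr (_ + _).
  by rewrite mulr_sumr; apply: eq_bigr => a _; rewrite -mulrA; congr (_ * _); rewrite mulrC.
congr (_ * _); under eq_bigr do rewrite mulr_sumr.
rewrite exchange_big /=; apply: eq_bigr => a _; apply: eq_bigr => b _.
by rewrite mulrCA; congr (_ * _); rewrite mulrC.
Qed.

(** The sum over c pairs the tangent vector d_a X' with the image of grad f in the ambient space;
    since the Gram matrix of the d_a X' is G', this is the derivative of f along a. *)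
Let gradot_coord (f : 'rV[R]_n -> R) u a : V u ->
  \sum_c pderiv a (fun v => X' v 0 c : R) u * gradot G' f (fun v => X' v 0 c : R) u
  = pderiv a f u.
Proof.
move=> Vu.
transitivity (\sum_d \sum_e invmx (G' u) d e * pderiv d f u * G' u a e).
  under eq_bigr => c _.
    rewrite mulr_sumr; under eq_bigr do rewrite mulr_sumr.
    over.
  rewrite exchange_big; apply: eq_bigr => d _; rewrite exchange_big; apply: eq_bigr => e _.
  rewrite -GX'// edotE mulr_sumr; apply: eq_bigr => c _.
  rewrite (pderiv_coord c (Cr_on_derivable a (CX' 2) Vu)).
  rewrite (pderiv_coord c (Cr_on_derivable e (CX' 2) Vu)).
  move: (pderiv _ _ _) (pderiv _ _ _) (pderiv _ _ _) => p q r; ring.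
transitivity (\sum_d pderiv d f u * (a == d)%:R).
  apply: eq_bigr => d _; rewrite -(metricK Gpos' a d Vu) mulr_sumr.
  apply: eq_bigr => e _.
  by rewrite (inv_metric_sym Gsym' d e Vu); ring.
rewrite (bigD1 a)//= eqxx mulr1 big1 ?addr0// => d da.
by rewrite eq_sym (negbTE da) mulr0.
Qed.

(** The non-invariant term of [tr2 f] is the sum of [tr2 tau_a] times the derivative of f along a.
    The coordinates of X produce the same sum with the opposite sign, by [gradot_coord], and the two
    cancel. *)
Lemma local_laplacian_change (f : 'rV[R]_n -> R) u : U u -> Cr_on 2 V f ->
  local_laplacian G (fun v => f (tau v)) u = local_laplacian G' f (tau u).
Proof.
move=> Uu Cf; have Vu := tauV Uu.
rewrite (local_laplacian_isometric oU CX GX)//.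
rewrite (local_laplacian_isometric oV CX' GX')//; congr (- _).
have e1 c : tr2 G (fun v => X v 0 c : R) u = tr2 G (fun v => X' (tau v) 0 c : R) u.
  rewrite /tr2; apply: eq_bigr => i _; apply: eq_bigr => j _.
  apply: (congr1 (fun r : R => invmx (G u) i j * r)).
  apply: (pderiv_near_eq i oU _ Uu) => v; rewrite inE => Uv; exact: XcE.
have e2 c : gradot G (fun v => f (tau v)) (fun v => X v 0 c : R) u =
    gradot G (fun v => f (tau v)) (fun v => X' (tau v) 0 c : R) u.
  rewrite /gradot; apply: eq_bigr => i _; apply: eq_bigr => j _.
  apply: (congr1 (fun r : R => invmx (G u) i j *
    (pderiv i (fun v => f (tau v)) u * r))).
  exact: XcE.
under eq_bigr => c _ do rewrite e1 e2 (gradot_tau Uu Cf (CXc c)) (tr2_tau Uu (CXc c)) mulrDl.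
rewrite big_split /= opprD (tr2_tau Uu Cf) addrACA -[RHS]addr0; congr (_ + _).
apply/eqP; rewrite subr_eq0; apply/eqP; under [RHS]eq_bigr do rewrite mulr_suml.
rewrite exchange_big; apply: eq_bigr => a _ /=.
rewrite -(gradot_coord f a Vu) mulr_sumr; apply: eq_bigr => c _.
by rewrite mulrA.
Qed.

End Invariance.

(** * The Laplacian on the manifold *)

Section LocalLaplacianRules.
Variables (R : realType) (n : nat) (U : set 'rV[R]_n) (G : 'rV[R]_n -> 'M[R]_n).
Hypothesis oU : open U.
Implicit Types f h : 'rV[R]_n -> R.

Lemma local_laplacian_ext f h u : {in U, f =1 h} -> U u ->
  local_laplacian G f u = local_laplacian G h u.
Proof.
move=> fh Uu.
have e1 v i : U v -> pderiv i f v = pderiv i h v.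
  by move=> Uv; exact: (pderiv_near_eq i oU fh Uv).
have e2 i j : pderiv i (pderiv j f) u = pderiv i (pderiv j h) u.
  by apply: (pderiv_near_eq i oU _ Uu) => v; rewrite inE => Uv; exact: e1.
rewrite /local_laplacian /mtrace; apply: (congr1 (@GRing.opp R)).
apply: eq_bigr => i _; apply: eq_bigr => j _.
apply: (congr1 (fun r : R => invmx (G u) i j *: r)).
rewrite /hessian e2; apply: (congr1 (fun r : R => pderiv i (pderiv j h) u - r)).
by rewrite /nabla_deriv; apply: eq_bigr => k _; rewrite e1.
Qed.

Lemma local_laplacianD f h u : U u -> Cr_on 2 U f -> Cr_on 2 U h ->
  local_laplacian G (fun v => f v + h v) u = local_laplacian G f u + local_laplacian G h u.
Proof.
move=> Uu Cf Ch.
have e1 v i : U v -> pderiv i (fun v => f v + h v) v = pderiv i f v + pderiv i h v.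
  by move=> Uv; exact: (pderivD_on i Cf Ch Uv).
have e2 i j : pderiv i (pderiv j (fun v => f v + h v)) u =
    pderiv i (pderiv j f) u + pderiv i (pderiv j h) u.
  rewrite -(pderivD_on i (Cr_on_pderiv j Cf) (Cr_on_pderiv j Ch) Uu).
  by apply: (pderiv_near_eq i oU _ Uu) => v; rewrite inE => Uv; exact: e1.
rewrite /local_laplacian /mtrace -opprD -big_split; apply: (congr1 (@GRing.opp R)).
apply: eq_bigr => i _; rewrite -big_split; apply: eq_bigr => j _.
rewrite /= -scalerDr; apply: (congr1 (fun r : R => invmx (G u) i j *: r)).
rewrite /hessian e2.
have -> : nabla_deriv G (fun v => f v + h v) u i j =
   nabla_deriv G f u i j + nabla_deriv G h u i j.
  by rewrite /nabla_deriv -big_split; apply: eq_bigr => k _; rewrite /= -scalerDr e1.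
by rewrite opprD addrACA.
Qed.

Lemma local_laplacian_cst (a : R) u : local_laplacian G (fun=> a) u = 0.
Proof.
have e1 i : pderiv i (fun _ : 'rV[R]_n => a) = fun=> 0.
  by apply/funext => v; exact: derive_cst.
have e2 i : pderiv i (fun _ : 'rV[R]_n => 0 : R) = fun=> 0.
  by apply/funext => v; exact: derive_cst.
rewrite /local_laplacian /mtrace big1 ?oppr0// => i _; rewrite big1// => j _.
rewrite /hessian e1 e2 /nabla_deriv big1 ?subr0 ?scaler0// => k _.
by rewrite e1 scaler0.
Qed.

Lemma Cr_on_local_laplacian f :
  (forall u, U u -> (G u)^T = G u) -> (forall u, U u -> posdef (G u)) ->
  (forall k i j, Cr_on k U (fun u => G u i j : R)) ->
  Cr_on 2 U f -> Cr_on 0 U (local_laplacian G f).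
Proof.
move=> Gs Gp GC Cf.
have Cg i j := Cr_on_inv_metric oU Gp GC 0 i j.
have CG i j l : Cr_on 0 U (pderiv l (fun v => G v i j : R)).
  exact: (Cr_on_pderiv l (GC 1 i j)).
have C1 i : Cr_on 0 U (pderiv i f) := Cr_onW (Cr_on_pderiv i Cf).
have C2 i j : Cr_on 0 U (pderiv i (pderiv j f)) := Cr_on_pderiv i (Cr_on_pderiv j Cf).
have CC k i j : Cr_on 0 U (fun u => christoffel G u k i j).
  apply: Cr_onZ => //; apply: Cr_on_sum => // l; apply: Cr_onM => //.
  by apply: Cr_onB => //; apply: Cr_onD.
apply: Cr_onN => //; apply: Cr_on_sum => // i; apply: Cr_on_sum => // j.
apply: Cr_onM => //; apply: Cr_onB => //; apply: Cr_on_sum => // k.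
exact: Cr_onM.
Qed.

End LocalLaplacianRules.

Section Manifold.
Variables (R : realType) (n m : nat) (M : ptopologicalType).
Variables (A : smooth_atlas R n M) (g : riemannian_metric A).
Variable x : M -> 'rV[R]_m.
Hypothesis iso : isometric_immersion g x.
Implicit Types (c d : chart R n M) (f h : M -> R).

Notation loc c f := (fun u => f (cinv c u)).

Lemma chart_preimage_open c (O : set M) : open O ->
  open (cimg c `&` (cinv c @^-1` O)).
Proof.
move=> oO; rewrite openE => u [cu Ou]; rewrite /interior.
have N1 : nbhs u (cimg c) by apply: open_nbhs_nbhs; split=> //; exact: cimg_open.
have N2 : nbhs u (cinv c @^-1` O).
  by apply: (cinv_continuous cu); apply: open_nbhs_nbhs; split.
exact: filterI N1 N2.
Qed.

Lemma overlap_open c d : open (overlap c d).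
Proof. by apply: chart_preimage_open; exact: cdom_open. Qed.

Lemma chart_atP p : charts A (chart_at A p) /\ cdom (chart_at A p) p.
Proof. by rewrite /chart_at; case: cid2. Qed.

Section OneChart.
Variable c : chart R n M.
Hypothesis Ac : charts A c.

Lemma chart_sym u : cimg c u -> (metric g c u)^T = metric g c u.
Proof. by move=> cu; exact: (Defs.metric_sym g Ac cu). Qed.

Lemma chart_posdef u : cimg c u -> posdef (metric g c u).
Proof. by move=> cu v v0; exact: (Defs.metric_posdef g Ac cu v0). Qed.

Lemma chart_metric_smooth k i j : Cr_on k (cimg c) (fun u => metric g c u i j : R).
Proof. exact: (metric_smooth g Ac i j k). Qed.

Lemma chart_immersion_smooth k : Cr_on k (cimg c) (loc c x).
Proof. exact: (iso.1 c Ac k). Qed.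

Lemma chart_immersion_metric u i j : cimg c u ->
  edot (pderiv i (loc c x) u) (pderiv j (loc c x) u) = metric g c u i j.
Proof. by move=> cu; exact: (iso.2 c u i j Ac cu). Qed.

End OneChart.

(** Class C^2 rather than [smooth], because the bumps that cut functions into pieces are only
    C^2. *)
Definition C2 f := forall c, charts A c -> Cr_on 2 (cimg c) (loc c f).

Lemma C2D f h : C2 f -> C2 h -> C2 (fun p => f p + h p).
Proof. by move=> Cf Ch c Ac; apply: Cr_onD; [exact: cimg_open|exact: Cf|exact: Ch]. Qed.

Lemma C2M f h : C2 f -> C2 h -> C2 (fun p => f p * h p).
Proof. by move=> Cf Ch c Ac; apply: Cr_onM; [exact: cimg_open|exact: Cf|exact: Ch]. Qed.

Lemma C2_cst (a : R) : C2 (fun=> a).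
Proof. by move=> c Ac; exact: Cr_on_cst. Qed.

Lemma C2V f : C2 f -> (forall p, f p != 0) -> C2 (fun p => (f p)^-1).
Proof.
move=> Cf f0 c Ac.
exact: (Cr_onV (@cimg_open _ _ _ c) (fun u _ => f0 (cinv c u)) (Cf c Ac)).
Qed.

Lemma C2_sum (I : Type) (s : seq I) (f : I -> M -> R) :
  (forall i, C2 (f i)) -> C2 (fun p => \sum_(i <- s) f i p).
Proof.
move=> H; elim: s => [|i s IH].
  have -> : (fun p => \sum_(j <- [::]) f j p) = fun=> 0.
    by apply/funext => p; rewrite big_nil.
  exact: C2_cst.
have -> : (fun p => \sum_(j <- i :: s) f j p) = fun p => f i p + \sum_(j <- s) f j p.
  by apply/funext => p; rewrite big_cons.
exact: (C2D (H i) IH).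
Qed.

Lemma continuous_chart f :
  (forall c, charts A c -> Cr_on 0 (cimg c) (loc c f)) -> continuous f.
Proof.
move=> Cf p; have [Ac cp] := chart_atP p; set c := chart_at A p in Ac cp.
apply: (@near_eq_continuous _ _ (fun q => f (cinv c (cmap c q)))).
  have : nbhs p (cdom c) by apply: open_nbhs_nbhs; split=> //; exact: cdom_open.
  by apply: filterS => q cq; rewrite cmapK.
apply: (@continuous_comp _ _ _ (cmap c) (loc c f)); first exact: cmap_continuous.
exact: (Cr_on_continuous (Cf c Ac) (cmap_img cp)).
Qed.

Lemma C2_continuous f : C2 f -> continuous f.
Proof. by move=> Cf; apply: continuous_chart => c Ac; exact: (Cr_on0W (Cf c Ac)). Qed.

(** Releases [laplacian] from the chart chosen at p. A fixed chart around p can then be used at all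
    its points, as continuity and integration demand. *)
Lemma laplacian_chart f c p : C2 f -> charts A c -> cdom c p ->
  laplacian g f p = local_laplacian (metric g c) (loc c f) (cmap c p).
Proof.
move=> Cf Ac cp; rewrite /laplacian /at_chart.
have [Ad dp] := chart_atP p; set d := chart_at A p in Ad dp *.
have oU := @overlap_open d c; have oV := @cimg_open _ _ _ c.
have sub : overlap d c `<=` cimg d by move=> u [].
have Uu : overlap d c (cmap d p) by split; [exact: cmap_img|rewrite cmapK].
have tE : transition d c (cmap d p) = cmap c p by rewrite /transition cmapK.
rewrite -tE.
have E u (fT : M -> R) : overlap d c u -> fT (cinv d u) = fT (cinv c (transition d c u)).
  by move=> [du cdu]; rewrite /transition cmapK.
rewrite -(@local_laplacian_change R n m (overlap d c) (cimg c) (metric g d) (metric g c)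
  (loc d x) (loc c x) (transition d c)) //.
- apply: (local_laplacian_ext _ oU) => // u; rewrite inE => Ou; exact: E.

- by move=> u [du _]; exact: (chart_posdef Ad du).
- by move=> k; exact: (Cr_on_sub sub (chart_immersion_smooth Ad k)).
- by move=> u i j [du _]; exact: (chart_immersion_metric Ad i j du).
- by move=> u cu; exact: (chart_sym Ac cu).
- by move=> u cu; exact: (chart_posdef Ac cu).
- by move=> k; exact: (chart_immersion_smooth Ac k).
- by move=> u i j cu; exact: (chart_immersion_metric Ac i j cu).
- by move=> u [du cdu]; exact: cmap_img.
- exact: (charts_compat Ad Ac 2).
- by move=> u [du cdu]; rewrite /transition cmapK.
- exact: (Cf c Ac).
Qed.

Lemma laplacian_continuous f : C2 f -> continuous (laplacian g f).
Proof.
move=> Cf; apply: continuous_chart => c Ac.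
have oc := @cimg_open _ _ _ c.
apply: (Cr_on_ext oc _ (@Cr_on_local_laplacian R n (cimg c) (metric g c) oc (loc c f)
  (chart_sym Ac) (chart_posdef Ac) (chart_metric_smooth Ac) (Cf c Ac))).
move=> u; rewrite inE => cu.
by rewrite (laplacian_chart Cf Ac (cinv_dom cu)) cinvK.
Qed.

Lemma laplacianD f h p : C2 f -> C2 h ->
  laplacian g (fun q => f q + h q) p = laplacian g f p + laplacian g h p.
Proof.
move=> Cf Ch; have [Ac cp] := chart_atP p.
rewrite /laplacian /at_chart.
exact: (local_laplacianD _ (@cimg_open _ _ _ _) (cmap_img cp) (Cf _ Ac) (Ch _ Ac)).
Qed.

Lemma laplacian_cst (a : R) p : laplacian g (fun=> a) p = 0.
Proof. exact: local_laplacian_cst. Qed.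

Lemma laplacian_eq0 f (O : set M) p : open O -> (forall q, O q -> f q = 0) -> O p ->
  laplacian g f p = 0.
Proof.
move=> oO f0 Op; have [Ac cp] := chart_atP p; rewrite /laplacian /at_chart.
rewrite -(local_laplacian_cst (metric g (chart_at A p)) 0 (cmap (chart_at A p) p)).
apply: (local_laplacian_ext _ (@chart_preimage_open (chart_at A p) O oO)).
  by move=> u; rewrite inE => -[_ /f0].
by split; [exact: cmap_img|rewrite /= cmapK].
Qed.

Lemma laplacian_sum (I : Type) (s : seq I) (f : I -> M -> R) p :
  (forall i, C2 (f i)) ->
  laplacian g (fun q => \sum_(i <- s) f i q) p = \sum_(i <- s) laplacian g (f i) p.
Proof.
move=> Cf; elim: s => [|i s IH].
  have -> : (fun q => \sum_(j <- [::]) f j q) = fun=> 0.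
    by apply/funext => q; rewrite big_nil.
  by rewrite big_nil laplacian_cst.
have -> : (fun q => \sum_(j <- i :: s) f j q) = fun q => f i q + \sum_(j <- s) f j q.
  by apply/funext => q; rewrite big_cons.
by rewrite big_cons -IH (laplacianD _ (Cf i) (C2_sum s Cf)).
Qed.

Lemma laplacian_mul f h c p : C2 f -> C2 h -> charts A c -> cdom c p ->
  laplacian g (fun q => f q * h q) p = f p * laplacian g h p + h p * laplacian g f p
    - 2 * gradot (metric g c) (loc c f) (loc c h) (cmap c p).
Proof.
move=> Cf Ch Ac cp.
rewrite (laplacian_chart (C2M Cf Ch) Ac cp) (laplacian_chart Cf Ac cp)
  (laplacian_chart Ch Ac cp).
rewrite (laplacianM (@cimg_open _ _ _ c) (chart_sym Ac) (cmap_img cp) (Cf c Ac) (Ch c Ac)).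
by rewrite cmapK.
Qed.

Lemma laplacianZ (a : R) f p : C2 f ->
  laplacian g (fun q => a * f q) p = a * laplacian g f p.
Proof.
move=> Cf; have [Ac cp] := chart_atP p.
rewrite (laplacian_mul (C2_cst a) Cf Ac cp) laplacian_cst mulr0 addr0.
rewrite /gradot big1 ?mulr0 ?subr0// => i _; rewrite big1// => j _.
by rewrite (_ : pderiv i _ _ = 0) ?mul0r ?mulr0//; exact: derive_cst.
Qed.

Lemma C2_coord q (y : M -> 'rV[R]_q) j : smooth A y -> C2 (fun p => y p 0 j).
Proof.
move=> sy c Ac; exact: (Cr_on_coord j (@cimg_open _ _ _ c) (sy c Ac 2)).
Qed.

Lemma laplacian_coord q (y : M -> 'rV[R]_q) p j : smooth A y ->
  laplacian g y p 0 j = laplacian g (fun p => y p 0 j) p.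
Proof.
move=> sy; have [Ac cp] := chart_atP p; rewrite /laplacian /at_chart.
exact: (local_laplacian_coord _ _ (@cimg_open _ _ _ _) (sy _ Ac 2) (cmap_img cp)).
Qed.

(** By the mean value theorem along segments in a small coordinate cube, f is locally constant; its
    level sets are then open and closed. *)
Lemma gradient0_constant f : connected [set: M] -> C2 f ->
  (forall c u i, charts A c -> cimg c u -> pderiv i (loc c f) u = 0) ->
  forall p q, f p = f q.
Proof.
move=> conM Cf df p q.
have loc_cst p0 : \forall p1 \near p0, f p1 = f p0.
  have [Ac cp] := chart_atP p0; set c := chart_at A p0 in Ac cp.
  have cu := cmap_img cp; set u := cmap c p0 in cu.
  have Nu : nbhs u (cimg c) by apply: open_nbhs_nbhs; split=> //; exact: cimg_open.
  have /nbhs_normP[d /= d0 Hd] : \forall w \near u, cimg c w by [].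
  have Np : nbhs p0 (cdom c) by apply: open_nbhs_nbhs; split=> //; exact: cdom_open.
  have Nd : nbhs p0 (cmap c @^-1` [set w | `|w - u| < d]).
    by apply: (cmap_continuous cp); exact: nbhs_norm_ball.
  apply: filterS2 Np Nd => p1 cp1 /= p1d.
  pose v := cmap c p1 - u.
  have inU (s : R) : `|s| <= `|1 : R| -> cimg c (s *: v + u).
    move=> s1; apply: Hd; rewrite /ball_/= opprD addrCA subrr addr0 normrN normrZ.
    by apply: le_lt_trans p1d; rewrite ler_piMl// (le_trans s1)// normr1.
  have [s s1|s s1] := @MVT_line R _ (loc c f) u v 1.
    apply/diff_derivable/C1_differentiable.
    by apply: (Cr_on_C1_at (@cimg_open _ _ _ c) (inU s s1) (Cf c Ac)).
  have C1 := Cr_on_C1_at (@cimg_open _ _ _ c) (inU s s1) (Cf c Ac).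
  rewrite (C1_derive v C1) big1 => [|i _]; last by rewrite df ?mulr0//; exact: inU.
  rewrite mulr0 scale1r subrK /u !cmapK// => /eqP.
  by rewrite subr_eq0 => /eqP.
have clo : clopen [set p1 | f p1 = f q].
  split.
    rewrite openE => p1 /= E; rewrite /interior.
    by apply: filterS (loc_cst p1) => p2 /= ->.
  rewrite -openC openE => p1 /= E; rewrite /interior.
  by apply: filterS (loc_cst p1) => p2 /= ->.
have E : [set p1 | f p1 = f q] = setT.
  apply: (conM [set p1 | f p1 = f q]); first by exists q.
    by exists [set p1 | f p1 = f q]; [exact: clo.1|rewrite setTI].
  by exists [set p1 | f p1 = f q]; [exact: clo.2|rewrite setTI].
have : setT p by [].
by rewrite -E.
Qed.

End Manifold.

(** * Bump functions *)

Section PositivePart.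
Variable R : realType.

Definition pospart (t : R) : R := (t + `|t|) / 2.

Lemma pospart_ge0E t : 0 <= t -> pospart t = t.
Proof. by move=> t0; rewrite /pospart ger0_norm// -mulr2n -[t *+ 2]mulr_natr mulfK. Qed.

Lemma pospart_le0E t : t <= 0 -> pospart t = 0.
Proof. by move=> t0; rewrite /pospart ler0_norm// subrr mul0r. Qed.

Lemma pospart_ge0 t : 0 <= pospart t.
Proof.
have [t0|t0] := leP 0 t; first by rewrite pospart_ge0E.
by rewrite pospart_le0E// ltW.
Qed.

Lemma pospart_le_norm t : pospart t <= `|t|.
Proof.
have [t0|t0] := leP 0 t; first by rewrite pospart_ge0E// ger0_norm.
by rewrite pospart_le0E// ltW.
Qed.

Lemma pospart_continuous : continuous pospart.
Proof.
move=> t; apply: cvgM; last exact: cvg_cst.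
by apply: cvgD; [exact: cvg_id|exact: norm_continuous].
Qed.

(** Exponents start at 2 since [pospart] has a corner at 0. There the difference quotient is at most
    [|h| ^ (k + 1)] in absolute value, hence tends to 0. *)
Lemma is_derive_pospartX k (t : R) :
  is_derive t (1 : R) (fun s => pospart s ^+ k.+2) (k.+2%:R * pospart t ^+ k.+1).
Proof.
have [t0|t0|<-] := ltgtP 0 t.
- apply: (@near_eq_is_derive _ _ _ (fun s : R => s ^+ k.+2)).
    by apply: filterS (lt_nbhsr t0) => s s0; rewrite pospart_ge0E// ltW.
  rewrite pospart_ge0E ?ltW//; split; first exact: exprn_derivable.
  by rewrite exp_derive /GRing.scale/= ?mulr1.
- apply: (@near_eq_is_derive _ _ _ (fun s : R => 0)).
    by apply: filterS (lt_nbhsl t0) => s s0; rewrite pospart_le0E ?ltW// expr0n.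
  by rewrite pospart_le0E ?ltW// expr0n mulr0; exact: is_derive_cst.
rewrite pospart_le0E// expr0n mulr0.
have C : (fun h : R => h^-1 *: (((fun s => pospart s ^+ k.+2) \o shift 0) (h *: (1 : R))
    - pospart 0 ^+ k.+2)) @ 0^' --> (0 : R).
  apply/cvgrPdist_le => e e0; near=> h.
  have h1 : `|h| <= 1 by rewrite ltW//; near: h; exact: dnbhs0_lt.
  have he : `|h| <= e by rewrite ltW//; near: h; exact: dnbhs0_lt.
  have h0 : h != 0 by near: h; exact: nbhs_dnbhs_neq.
  rewrite /= addr0 [h *: 1]mulr1 (pospart_le0E (lexx 0)) expr0n /= subr0 sub0r normrN.
  rewrite normrM normfV ler_pdivrMl ?normr_gt0// normrX ger0_norm ?pospart_ge0//.
  rewrite exprS; apply: ler_pM; rewrite ?pospart_ge0// ?exprn_ge0 ?pospart_ge0//.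
    exact: pospart_le_norm.
  apply: le_trans he; rewrite exprS.
  apply: (@le_trans _ _ (`|h| * 1)); last by rewrite mulr1.
  apply: ler_pM; rewrite ?pospart_ge0// ?exprn_ge0 ?pospart_ge0// ?pospart_le_norm//.
  by rewrite exprn_ile1// ?pospart_ge0// (le_trans (pospart_le_norm _)).
by split; [apply/cvg_ex; exists 0|exact/cvg_lim].
Unshelve. all: by end_near. Qed.

End PositivePart.

Section Bump.
Variables (R : realType) (n : nat).
Implicit Types (u a : 'rV[R]_n).

Lemma is_derive_coord u (v : 'rV[R]_n) i :
  is_derive u v (fun w : 'rV[R]_n => w 0 i : R) (v 0 i).
Proof.
have H := @derivable_id R 'rV[R]_n u v.
split; first by have /derivable_mxP := H; exact.
by have := derive_mx H; rewrite derive_id => /matrixP/(_ 0 i); rewrite mxE.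
Qed.

Lemma Cr_on_coordinate k U i : Cr_on k U (fun w : 'rV[R]_n => w 0 i : R).
Proof.
case: k => [|k]; first by split=> // u _; exact: coord_continuous.
split=> [u _|j]; first exact: coord_continuous.
split=> [u _|]; first by have [] := is_derive_coord u (delta_mx 0 j) i.
have -> : pderiv j (fun w : 'rV[R]_n => w 0 i : R) = fun=> (delta_mx 0 j : 'rV[R]_n) 0 i.
  by apply/funext => u; have [_] := is_derive_coord u (delta_mx 0 j) i.
exact: Cr_on_cst.
Qed.

(** The cube of the positive part is C^2, which the square is not. The Euclidean distance is used
    because its square is polynomial; the Euclidean ball of radius d lies in the sup-norm ball,
    where supports are measured. *)
Definition bump a (d : R) u : R := pospart (d ^+ 2 - \sum_i (u 0 i - a 0 i) ^+ 2) ^+ 3.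

Lemma bump_smooth a d : Cr_on 2 setT (bump a d).
Proof.
pose phi (j : nat) : R -> R := match j with
  | 0 => fun t => pospart t ^+ 3 | 1 => fun t => 3 * pospart t ^+ 2
  | _ => fun t => 3 * (2 * pospart t) end.
have o : open [set: 'rV[R]_n] by exact: openT.
apply: (@Cr_on_comp1 _ _ 2 setT setT _ phi) => //.
- case=> [|[|//]] t _ _; first exact: is_derive_pospartX.
  have := is_deriveZ 3 (is_derive_pospartX 0 t).
  by rewrite expr1.
- move=> t _; rewrite /phi; apply: continuousM; first exact: cst_continuous.
  apply: continuousM; first exact: cst_continuous.
  exact: pospart_continuous.
- apply: Cr_onB => //; first exact: Cr_on_cst.
  apply: Cr_on_sum => // i.
  have C : Cr_on 2 setT (fun u => u 0 i - a 0 i).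
    by apply: Cr_onB => //; [exact: Cr_on_coordinate|exact: Cr_on_cst].
  have -> : (fun u => (u 0 i - a 0 i) ^+ 2) = fun u => (u 0 i - a 0 i) * (u 0 i - a 0 i).
    by apply/funext => u; rewrite expr2.
  exact: Cr_onM.
Qed.

Lemma bump_ge0 a d u : 0 <= bump a d u.
Proof. by rewrite exprn_ge0// pospart_ge0. Qed.

Lemma bump_le a d u : bump a d u <= (d ^+ 2) ^+ 3.
Proof.
rewrite lerXn2r ?nnegrE ?pospart_ge0 ?sqr_ge0//.
set s := \sum_i _; have s0 : 0 <= s by apply: sumr_ge0 => i _; exact: sqr_ge0.
have [t0|t0] := leP 0 (d ^+ 2 - s); first by rewrite pospart_ge0E// lerBlDr lerDl.
by rewrite pospart_le0E ?sqr_ge0//; exact: ltW.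
Qed.

Lemma bump_center a d : 0 < d -> 0 < bump a d a.
Proof.
move=> d0; rewrite /bump exprn_gt0// big1 ?subr0 => [|i _].
  by rewrite pospart_ge0E ?exprn_gt0// ?exprn_ge0// ltW.
by rewrite subrr expr0n.
Qed.

Lemma bump_out a d u : 0 < d -> d < `|u - a| -> bump a d u = 0.
Proof.
move=> d0 du; rewrite /bump pospart_le0E ?expr0n// subr_le0 leNgt; apply/negP => sd.
suff : `|u - a| <= d by rewrite leNgt du.
apply: norm_rV_le => [|i]; first exact: ltW.
rewrite -ler_sqr ?nnegrE ?normr_ge0 ?(ltW d0)// real_normK ?num_real//.
apply: le_trans (ltW sd); rewrite !mxE (bigD1 i)//= lerDl.
by apply: sumr_ge0 => j _; exact: sqr_ge0.
Qed.

End Bump.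

(** * Extension by zero from a chart *)

Section ZeroExtension.
Variables (R : realType) (n : nat).
Implicit Types (U B : set 'rV[R]_n) (F : 'rV[R]_n -> R).

(** U and the complement of B form an open cover; the extension is F on the first and 0 on the
    second. *)
Lemma Cr_on_zero_ext k U B F : open U -> closed B -> B `<=` U -> Cr_on k U F ->
  (forall u, U u -> ~ B u -> F u = 0) -> Cr_on k setT (F \_ U).
Proof.
move=> oU cB BU CF F0.
apply: Cr_on_local => u _; have [Uu|nUu] := pselect (U u).
  exists U; split=> //; apply: Cr_on_ext CF => // v; rewrite inE => Uv.
  by rewrite patchE mem_set.
exists (~` B); split; first by move=> /BU.
have oB : open (~` B) by exact: closed_openC.
apply: (Cr_on_ext oB _ (Cr_on_cst k (~` B) (0 : R))) => v; rewrite inE => nBv.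
rewrite patchE; case: ifPn => // /set_mem Uv; by rewrite F0.
Qed.

End ZeroExtension.

Section ChartBall.
Variables (R : realType) (n : nat) (M : ptopologicalType) (A : smooth_atlas R n M).
Hypothesis hausdorffM : hausdorff_space M.

Lemma closed_norm_ball (a : 'rV[R]_n) (d : R) : closed [set u | `|u - a| <= d].
Proof.
rewrite -[X in closed X]/((fun u : 'rV[R]_n => `|u - a|) @^-1` [set x | x <= d]).
apply: preimage_closed; last exact: closed_le.
move=> v _; apply: (@continuous_comp _ _ _ (fun u : 'rV[R]_n => u - a) (fun w => `|w|)).
  apply: (@continuousB _ _ _ id (fun=> a)); [exact: cvg_id|exact: cst_continuous].
exact: norm_continuous.
Qed.

Lemma compact_norm_ball (a : 'rV[R]_n) (d : R) : compact [set u | `|u - a| <= d].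
Proof.
apply: bounded_closed_compact; last exact: closed_norm_ball.
exists (`|a| + d); split; first exact: num_real.
move=> r ar v /= vd; rewrite -(subrK a v) (le_trans (ler_normD _ _))// ltW//.
by apply: le_lt_trans ar; rewrite addrC lerD2l.
Qed.

Lemma chart_ball_exists (c : chart R n M) p : cdom c p ->
  exists2 d : R, 0 < d & [set u | `|u - cmap c p| <= d] `<=` cimg c.
Proof.
move=> cp; have : \forall w \near cmap c p, cimg c w.
  apply: open_nbhs_nbhs; split; [exact: cimg_open|exact: cmap_img].
move=> /nbhs_normP[d /= d0 Hd]; exists (d / 2); first by rewrite divr_gt0.
move=> u /= ud; apply: Hd; rewrite /ball_/= distrC (le_lt_trans ud)//.
by rewrite ltr_pdivrMr// ltr_pMr// ltr1n.
Qed.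

Section Ball.
Variables (c : chart R n M) (a : 'rV[R]_n) (d : R).
Hypothesis Ac : charts A c.
Hypothesis ballc : [set u | `|u - a| <= d] `<=` cimg c.

Definition chart_ball : set M := [set p | cdom c p /\ `|cmap c p - a| <= d].

(** The ball is the image of a compact cube in a Hausdorff space. Closedness is what makes the zero
    extension regular at points outside the chart domain. *)
Lemma chart_ball_closed : closed chart_ball.
Proof.
have -> : chart_ball = cinv c @` [set u | `|u - a| <= d].
  apply/seteqP; split=> [p [cp pd]|_ [u ud <-]].
    by exists (cmap c p) => //; exact: cmapK.
  by split; [exact/cinv_dom/ballc|rewrite cinvK//; exact: ballc].
apply: compact_closed => //; apply: continuous_compact; last exact: compact_norm_ball.
apply: continuous_in_subspaceT => u; rewrite inE => /ballc cu.
exact: cinv_continuous.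
Qed.

Lemma C2_zero_ext (b : 'rV[R]_n -> R) : Cr_on 2 (cimg c) b ->
  (forall u, d < `|u - a| -> b u = 0) -> C2 A ((fun p => b (cmap c p)) \_ (cdom c)).
Proof.
move=> Cb b0 e Ae; apply: Cr_on_local => u eu.
have [cu|ncu] := pselect (cdom c (cinv e u)).
  exists (overlap e c); split; first by split.
  have oO := @overlap_open R n M e c.
  have Ct := charts_compat Ae Ac 2.
  have OV v : overlap e c v -> cimg c (transition e c v) by move=> [_ /cmap_img].
  apply: (Cr_on_ext oO _ (Cr_on_comp oO (@cimg_open _ _ _ c) OV Ct Cb)).
  by move=> v; rewrite inE => -[_ cv]; rewrite patchE mem_set.
exists (cimg e `&` (cinv e @^-1` (~` chart_ball))); split.
  by split=> // -[].
have oO : open (cimg e `&` (cinv e @^-1` (~` chart_ball))).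
  by apply: chart_preimage_open; exact/closed_openC/chart_ball_closed.
apply: (Cr_on_ext oO _ (Cr_on_cst 2 _ (0 : R))) => v; rewrite inE => -[ev vb].
rewrite patchE; case: ifPn => // /set_mem cv; rewrite b0// ltNge.
by apply/negP => vd; apply: vb.
Qed.

End Ball.

End ChartBall.

(** * The divergence theorem *)

Section Integration.
Variables (R : realType) (n m : nat) (M : ptopologicalType).
Variables (A : smooth_atlas R n M) (g : riemannian_metric A).
Variable dV : {measure set (borel M) -> \bar R}.
Variable x : M -> 'rV[R]_m.
Hypothesis hausdorffM : hausdorff_space M.
Hypothesis compactM : compact [set: M].
Hypothesis volume_dV : riemannian_volume g dV.
Hypothesis iso : isometric_immersion g x.
Implicit Types (c : chart R n M) (f h k : M -> R).

Notation vol c u := (Num.sqrt (\det (metric g c u))).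

Lemma continuous_borel_measurable f : continuous f ->
  measurable_fun [set: borel M] (f : borel M -> R).
Proof.
move=> cf; apply: (measurability _ (RGenOpens.measurableE R)).
move=> _ [_ [a [b ->] <-]]; rewrite setTI; apply: sub_sigma_algebra.
by apply: open_comp; [move=> p _; exact: cf|exact: interval_open].
Qed.

(** W is the integrand times the volume density, read in the chart and extended by zero. Sign and
    support of k are those that the characterisation of [dV] requires. *)
Lemma integral_in_chart c k (W : 'rV[R]_n -> R) (L : R) : charts A c ->
  continuous k -> (forall q, 0 <= k q) -> (forall q, ~ cdom c q -> k q = 0) ->
  0 < L -> cc L W ->
  (forall u, cimg c u -> W u = k (cinv c u) * vol c u) ->
  (forall u, ~ cimg c u -> W u = 0) ->
  (\int[dV]_(q in [set: borel M]) (k q)%:E = (iint W)%:E)%E.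
Proof.
move=> Ac ck k0 kout L0 cW Win Wout.
transitivity (\int[dV]_(q in (cdom c : set (borel M))) (k q)%:E)%E.
  rewrite [RHS]integral_mkcond; congr (integral dV _ _); apply/funext => q.
  rewrite patchE; case: ifPn => // /negP cq; rewrite kout// => cq'.
  by apply: cq; rewrite mem_set.
rewrite (volume_dV (f := fun q => (k q)%:E) Ac); first last.
- by move=> q; rewrite lee_fin.
- by apply/measurable_EFinP; exact: continuous_borel_measurable.
rewrite -(integral_Rn_iint L0 cW); congr integral_Rn; apply/funext => u.
rewrite patchE; case: ifPn => [/set_mem cu|/negP cu].
  by rewrite Win// EFinM.
by rewrite Wout// => cu'; apply: cu; rewrite mem_set.
Qed.

Section OneBall.
Variables (c : chart R n M) (a : 'rV[R]_n) (d : R).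
Hypothesis Ac : charts A c.
Hypothesis d0 : 0 < d.
Hypothesis ballc : [set u | `|u - a| <= d] `<=` cimg c.

Let B : set 'rV[R]_n := [set u | `|u - a| <= d].
Let L : R := `|a| + d + 1.

Let L0 : 0 < L.
Proof. by rewrite /L -addrA ltr_wpDl// addr_gt0. Qed.

Let outB u : L < `|u| -> ~ B u.
Proof.
move=> Lu /= ud; move: Lu; rewrite ltNge => /negP; apply.
rewrite -(subrK a u) (le_trans (ler_normD _ _))// /L addrC -addrA lerD2l.
by rewrite (le_trans ud)// lerDl.
Qed.

Let cB : closed B := @closed_norm_ball R n a d.

(** In the chart, the Laplacian times the volume density is minus the divergence of the field [V],
    which is C^1 and supported in a cube, so its iterated integral is 0. What remains is to pass
    from iterated integrals to [dV] for a signed function. *)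
Lemma laplacian_ball (phi : M -> R) : C2 A phi ->
  (forall q, ~ chart_ball c a d q -> phi q = 0) ->
  dV.-integrable [set: borel M] (fun q => (laplacian g phi q)%:E) /\
  (\int[dV]_(q in [set: borel M]) (laplacian g phi q)%:E = 0)%E.
Proof.
move=> Cphi phi0.
have oU := @cimg_open _ _ _ c.
have oB : open (~` B) by exact: closed_openC.
pose F u := phi (cinv c u).
have CF : Cr_on 2 (cimg c) F := Cphi c Ac.
have F0 u : cimg c u -> ~ B u -> F u = 0.
  by move=> cu nB; apply: phi0 => -[_]; rewrite cinvK.
pose gi u := invmx (metric g c u).
pose Fi i u := vol c u * \sum_j gi u i j * pderiv j F u.
have Gs := chart_sym g Ac; have Gp := chart_posdef g Ac.
have GC := chart_metric_smooth g Ac.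
have CFi i : Cr_on 1 (cimg c) (Fi i).
  apply: (Cr_onM oU (Cr_on_vol oU Gp GC)); apply: (Cr_on_sum oU) => j.
  exact: (Cr_onM oU (Cr_on_inv_metric oU Gp GC 1 i j) (Cr_on_pderiv j CF)).
have dF0 j u : cimg c u -> ~ B u -> pderiv j F u = 0.
  move=> cu nB.
  have oO : open (cimg c `&` ~` B) by exact: openI.
  have FE : {in cimg c `&` ~` B, F =1 fun=> 0 : R}.
    by move=> v; rewrite inE => -[cv nBv]; exact: F0.
  have Ou : (cimg c `&` ~` B) u by split.
  rewrite (pderiv_near_eq j oO FE Ou); exact: derive_cst.
have Fi0 i u : cimg c u -> ~ B u -> Fi i u = 0.
  move=> cu nB; rewrite /Fi big1 ?mulr0// => j _.
  by rewrite (dF0 j u cu nB) mulr0.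
(* F vanishes on the open set [cimg c] minus B, hence so do its derivatives and [Fi]; the zero
   extension is therefore C^1 on all of R^n. *)
pose V i := Fi i \_ (cimg c).
have CV i : Cr_on 1 setT (V i) := Cr_on_zero_ext oU cB ballc (CFi i) (Fi0 i).
have V0 i u : ~ B u -> V i u = 0.
  move=> nB; rewrite /V patchE; case: ifPn => // /set_mem cu; exact: Fi0.
have ccV i : cc L (V i).
  split=> [u|u Lu]; first exact: (Cr_on_continuous (CV i) I).
  by apply: V0; exact: outB.
have dV0 i u : ~ B u -> pderiv i (V i) u = 0.
  move=> nB; have VE : {in ~` B, V i =1 fun=> 0 : R}.
    by move=> v; rewrite inE => nBv; exact: V0.
  by rewrite (pderiv_near_eq i oB VE nB); exact: derive_cst.
have ccdV i : cc L (pderiv i (V i)).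
  split=> [u|u Lu]; first exact: (Cr_on_continuous (Cr_on_pderiv i (CV i)) I).
  by apply: dV0; exact: outB.
pose W u := \sum_i pderiv i (V i) u.
have ccW : cc L W by apply: cc_sum.
have iW : iint W = 0.
  rewrite (iint_sum L0 ccdV) big1// => i _.
  apply: (iint_pderiv L0 (ccV i) (ccdV i)) => u.
  exact: (Cr_on_derivable i (CV i) I).
pose h := laplacian g phi.
have Win u : cimg c u -> - W u = vol c u * h (cinv c u).
  move=> cu; rewrite /h (laplacian_chart iso Cphi Ac (cinv_dom cu)) cinvK//.
  have := divergence_laplacian oU Gs Gp GC cu CF.
  rewrite -[local_laplacian _ _ _]/(local_laplacian (metric g c) F u).
  move=> E; apply/eqP; rewrite eqr_oppLR -E; apply/eqP; apply: eq_bigr => i _.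
  apply: (pderiv_near_eq i oU _ cu) => v; rewrite inE => cv.
  by rewrite /V patchE mem_set.
have Wout u : ~ cimg c u -> W u = 0.
  move=> ncu; rewrite /W big1// => i _; apply: dV0 => Bu; apply: ncu; exact: ballc.
have ch : continuous h := laplacian_continuous iso Cphi.
have h0 q : ~ cdom c q -> h q = 0.
  move=> cq; apply: (@laplacian_eq0 _ _ _ _ g phi (~` chart_ball c a d)).
  - exact/closed_openC/(@chart_ball_closed R n M hausdorffM c a d ballc).
  - by move=> p; exact: phi0.
  - by move=> [].
have ccNW : cc L (fun u => -1 * W u) := ccZ (-1) ccW.
(* The volume formula accepts nonnegative integrands, so it is applied to theta(h) for theta the
   absolute value, the positive part and the negative part. Positive homogeneity carries theta past
   the volume density. *)
have key (theta : R -> R) : continuous theta -> (forall t, 0 <= theta t) ->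
    theta 0 = 0 -> (forall s t, 0 <= s -> theta (s * t) = s * theta t) ->
    cc L (fun u => theta (-1 * W u)) /\
    (\int[dV]_(q in [set: borel M]) (theta (h q))%:E =
     (iint (fun u => theta (-1 * W u)))%:E)%E.
  move=> ct t_ge0 t0 thom.
  have ccT : cc L (fun u => theta (-1 * W u)).
    split=> [u|u Lu]; last by rewrite ccNW.2.
    by apply: continuous_comp; [exact: ccNW.1|exact: ct].
  split=> //; apply: (integral_in_chart Ac _ _ _ L0 ccT).
  - by move=> q; apply: continuous_comp; [exact: ch|exact: ct].
  - by move=> q; exact: t_ge0.
  - by move=> q cq; rewrite h0.
  - by move=> u cu; rewrite mulN1r Win// thom ?sqrtr_ge0// mulrC.
  - by move=> u cu; rewrite Wout// mulr0.
have mh : measurable_fun [set: borel M] (h : borel M -> R).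
  exact: continuous_borel_measurable.
split.
  apply/integrableP; split; first exact/measurable_EFinP.
  have [|//|||_ E] := key (fun t => `|t|).
  - exact: norm_continuous.
  - by rewrite normr0.
  - by move=> s t s0; rewrite normrM ger0_norm.
  have -> : (\int[dV]_(q in [set: borel M]) `|(laplacian g phi q)%:E| =
      \int[dV]_(q in [set: borel M]) (`|h q|%:E))%E by [].
  by rewrite E ltry.
have hom (s t : R) : 0 <= s -> pospart (s * t) = s * pospart t.
  by move=> s0; rewrite /pospart normrM (ger0_norm s0) -mulrDr mulrA.
have [||||ccP EP] := key (@pospart R).
- exact: pospart_continuous.
- exact: pospart_ge0.
- exact: pospart_ge0E.
- exact: hom.
have [||||ccN EN] := key (fun t => pospart (- t)).
- move=> t; apply: continuous_comp; last exact: pospart_continuous.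
  by apply: continuousN; exact: cvg_id.
- by move=> t; exact: pospart_ge0.
- by rewrite oppr0 pospart_ge0E.
- by move=> s t s0; rewrite -mulrN hom.
have posE q : (fun p => (h p)%:E)^\+%E q = (pospart (h q))%:E.
  rewrite funeposE -EFin_max; congr EFin.
  have [hq|hq] := leP 0 (h q); first by rewrite pospart_ge0E.
  by rewrite pospart_le0E// ltW.
have negE q : (fun p => (h p)%:E)^\-%E q = (pospart (- h q))%:E.
  rewrite funenegE -EFinN -EFin_max; congr EFin.
  have [hq|hq] := leP 0 (- h q); first by rewrite pospart_ge0E.
  by rewrite pospart_le0E// ltW.
rewrite integralE.
under eq_integral do rewrite posE.
under [X in (_ - X)%E]eq_integral do rewrite negE.
rewrite EP EN -EFinB; congr EFin.
(* The positive part is the negative part plus the function itself, so the two integrals differ by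
   that of -W, which is 0. *)
have -> : (fun u => pospart (-1 * W u)) =
    fun u => pospart (- (-1 * W u)) + -1 * W u.
  apply/funext => u; have [w0|w0] := leP 0 (-1 * W u).
    by rewrite (pospart_ge0E w0) pospart_le0E ?add0r// oppr_le0.
  rewrite pospart_le0E ?ltW// pospart_ge0E; last by rewrite oppr_ge0 ltW.
  by rewrite addNr.
by rewrite (iintD L0 ccN ccNW) (iintZ L0 _ ccW) iW mulr0 addr0 subrr.
Qed.

(** h need not be supported in a chart, but its product with a bump [psi] is, and has positive
    integral by [iint_gt0]. As [psi <= K], this integral is at most K times that of h, which may be
    infinite. *)
Lemma bump_integral h : continuous h -> (forall q, 0 <= h q) ->
  0 < h (cinv c a) ->
  (0 < \int[dV]_(q in [set: borel M]) (h q)%:E)%E.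
Proof.
move=> ch h0 ha.
have oU := @cimg_open _ _ _ c.
have ca : cimg c a by apply: ballc; rewrite /= subrr normr0 ltW.
have Gp := chart_posdef g Ac; have GC := chart_metric_smooth g Ac.
pose b := bump a d.
have Cb : Cr_on 2 (cimg c) b := Cr_on_sub (fun _ _ => I) (bump_smooth a d).
have b0 u : d < `|u - a| -> b u = 0 by exact: bump_out.
have Cpsi := C2_zero_ext hausdorffM Ac ballc Cb b0.
pose psi := (fun p => b (cmap c p)) \_ (cdom c).
pose K := (d ^+ 2) ^+ 3.
have K0 : 0 < K by rewrite !exprn_gt0.
have psi_ge0 q : 0 <= psi q by rewrite /psi patchE; case: ifP => // _; exact: bump_ge0.
have psi_le q : psi q <= K.
  by rewrite /psi patchE; case: ifP => _; [exact: bump_le|rewrite ltW].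
have cpsi : continuous psi := C2_continuous Cpsi.
pose k q := h q * psi q.
have ck : continuous k.
  by move=> q; apply: continuousM; [exact: ch|exact: cpsi].
pose w u := h (cinv c u) * b u * vol c u.
have Cw : Cr_on 0 (cimg c) w.
  apply: (Cr_onM oU); last exact: (Cr_on0W (Cr_on_vol oU Gp GC)).
  apply: (Cr_onM oU); last exact: (Cr_on0W Cb).
  split=> // u cu; apply: continuous_comp; first exact: cinv_continuous.
  exact: ch.
have w0 u : cimg c u -> ~ B u -> w u = 0.
  move=> cu /negP; rewrite -ltNge => du; by rewrite /w b0// mulr0 mul0r.
have CW := Cr_on_zero_ext oU cB ballc Cw w0.
pose W := w \_ (cimg c).
have W_in u : cimg c u -> W u = w u by move=> cu; rewrite /W patchE mem_set.
have W_out u : ~ cimg c u -> W u = 0.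
  by move=> cu; rewrite /W patchE; case: ifPn => // /set_mem.
have ccW : cc L W.
  split=> [u|u Lu]; first exact: (Cr_on_continuous CW I).
  have [cu|cu] := pselect (cimg c u); last exact: W_out.
  by rewrite W_in// w0//; exact: outB.
have vol_ge0 u : 0 <= vol c u by exact: sqrtr_ge0.
have b_ge0 u : 0 <= b u := bump_ge0 a d u.
have w_ge0 u : 0 <= w u.
  by apply: mulr_ge0 (vol_ge0 u); apply: mulr_ge0 (h0 _) (b_ge0 u).
have Ek : (\int[dV]_(q in [set: borel M]) (k q)%:E = (iint W)%:E)%E.
  apply: (integral_in_chart Ac ck _ _ L0 ccW) => //.
  - by move=> q; rewrite mulr_ge0.
  - by move=> q cq; rewrite /k /psi patchE memNset// mulr0.
  - move=> u cu; rewrite W_in// /w /k /psi patchE mem_set; last exact: cinv_dom.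
    by rewrite cinvK.
have iW : 0 < iint W.
  apply: (iint_gt0 L0 (u := a) ccW).
    move=> v; have [cv|cv] := pselect (cimg c v); last by rewrite W_out.
    by rewrite W_in.
  rewrite W_in//; apply: mulr_gt0 (vol_gt0 Gp ca).
  by apply: mulr_gt0 ha _; exact: bump_center.
have mh : measurable_fun [set: borel M] (fun q => (h q)%:E).
  by apply/measurable_EFinP; exact: continuous_borel_measurable.
have le : ((iint W)%:E <= K%:E * \int[dV]_(q in [set: borel M]) (h q)%:E)%E.
  rewrite -ge0_integralZl//; last 2 first.
  - by move=> q _; rewrite lee_fin.
  - by rewrite lee_fin ltW.
  rewrite -Ek; apply: ge0_le_integral => //.
  - by move=> q _; rewrite lee_fin mulr_ge0.
  - by apply/measurable_EFinP; exact: continuous_borel_measurable.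
  - exact: measurable_funeM.
  - by move=> q _; rewrite -EFinM lee_fin /k mulrC ler_wpM2r.
have i_ge0 : (0 <= \int[dV]_(q in [set: borel M]) (h q)%:E)%E.
  by apply: integral_ge0 => q _; rewrite lee_fin.
rewrite lt_neqAle i_ge0 andbT; apply/eqP => E.
by move: le; rewrite -E mule0 lee_fin leNgt iW.
Qed.

End OneBall.

Lemma integral_eq0 h : continuous h -> (forall q, 0 <= h q) ->
  (\int[dV]_(q in [set: borel M]) (h q)%:E = 0)%E -> forall p, h p = 0.
Proof.
move=> ch h0 ih p; apply/eqP; apply/negPn/negP => hp.
have [Ac cp] := chart_atP A p; have [d d0 Hd] := chart_ball_exists cp.
have := bump_integral Ac d0 Hd ch h0.
by rewrite ih ltxx cmapK// lt_neqAle eq_sym hp h0 => /(_ isT).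
Qed.

Let bump_at p (psi : M -> R) := [/\ C2 A psi, forall q, 0 <= psi q, 0 < psi p &
  exists c a d, [/\ charts A c, 0 < d, [set u | `|u - a| <= d] `<=` cimg c &
    forall q, ~ chart_ball c a d q -> psi q = 0]].

Let bump_at_exists p : exists psi, bump_at p psi.
Proof.
have [Ac cp] := chart_atP A p; set c := chart_at A p in Ac cp.
have [d d0 Hd] := chart_ball_exists cp; set a := cmap c p in Hd.
have Cb : Cr_on 2 (cimg c) (bump a d) := Cr_on_sub (fun _ _ => I) (bump_smooth a d).
have b0 u : d < `|u - a| -> bump a d u = 0 by exact: bump_out.
exists ((fun q => bump a d (cmap c q)) \_ (cdom c)); split.
- exact: (C2_zero_ext hausdorffM Ac Hd Cb b0).
- by move=> q; rewrite patchE; case: ifP => // _; exact: bump_ge0.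
- by rewrite patchE mem_set// bump_center.
- exists c, a, d; split=> // q nq; rewrite patchE; case: ifPn => // /set_mem cq.
  by apply: b0; rewrite ltNge; apply/negP => qd; apply: nq.
Qed.

(* With bumps psi_i supported in charts and S = sum_i psi_i > 0,
   f = sum_i psi_i f / S reduces the claim to functions supported in one chart. *)
Lemma integral_laplacian f : C2 A f ->
  dV.-integrable [set: borel M] (fun q => (laplacian g f q)%:E) /\
  (\int[dV]_(q in [set: borel M]) (laplacian g f q)%:E = 0)%E.
Proof.
move=> Cf; have [psi Hpsi] := choice bump_at_exists.
have cov : [set: M] `<=` cover [set: M] (fun p => [set q | 0 < psi p q]).
  by move=> p _; exists p => //=; have [] := Hpsi p.
have op p : [set: M] p -> open [set q | 0 < psi p q].
  move=> _; have [Cp _ _ _] := Hpsi p.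
  apply: (@open_comp _ _ (psi p) [set t | 0 < t]); last exact: open_gt.
  by move=> q _; exact: (C2_continuous Cp).
have cpt := compactM; rewrite compact_cover in cpt.
have [D' _ Dcov] := cpt M setT _ op cov.
pose s : seq M := finmap.enum_fset D'.
pose S q := \sum_(p <- s) psi p q.
have Cpsi p : C2 A (psi p) by have [] := Hpsi p.
have CS : C2 A S := C2_sum s Cpsi.
have S0 q : S q != 0.
  have [p /= pD pq] := Dcov q I.
  rewrite gt_eqF// /S (big_rem p)//= ltr_pwDl// sumr_ge0// => p' _.
  by have [_ + _ _] := Hpsi p'; exact.
have CfS : C2 A (fun q => f q * (S q)^-1) := C2M Cf (C2V CS S0).
pose fp p q := psi p q * (f q * (S q)^-1).
have Cfp p : C2 A (fp p) := C2M (Cpsi p) CfS.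
have Hfp p : dV.-integrable [set: borel M] (fun q => (laplacian g (fp p) q)%:E) /\
    (\int[dV]_(q in [set: borel M]) (laplacian g (fp p) q)%:E = 0)%E.
  have [_ _ _ [c [a [d [Ac d0 Hd p0]]]]] := Hpsi p.
  apply: (laplacian_ball Ac d0 Hd (Cfp p)) => q nq.
  by rewrite /fp p0// mul0r.
have fE : f = fun q => \sum_(p <- s) fp p q.
  apply/funext => q; rewrite /fp -mulr_suml mulrCA.
  by rewrite -/(S q) divff// mulr1.
have lE q : laplacian g f q = \sum_(p <- s) laplacian g (fp p) q.
  by rewrite {1}fE (laplacian_sum _ _ _ Cfp).
have lE' : (fun q => (laplacian g f q)%:E) =
    (fun q => (\sum_(p <- s) laplacian g (fp p) q)%:E).
  by apply/funext => q; rewrite lE.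
rewrite lE'; elim: (s) => [|p t [IH1 IH2]].
  have -> : (fun q => (\sum_(p <- [::]) laplacian g (fp p) q)%:E) = fun=> 0%E.
    by apply/funext => q; rewrite big_nil.
  by split; [exact: integrable0|rewrite integral0].
have [Hp1 Hp2] := Hfp p.
have -> : (fun q => (\sum_(p <- p :: t) laplacian g (fp p) q)%:E) =
   ((fun q => (laplacian g (fp p) q)%:E) \+
    (fun q => (\sum_(p <- t) laplacian g (fp p) q)%:E))%E.
  by apply/funext => q; rewrite big_cons EFinD.
split; first exact: integrableD.
by rewrite integralD//= [X in (X + _)%E]Hp2 [X in (_ + X)%E]IH2 adde0.
Qed.

End Integration.

(** * Eigenmaps of the Laplacian *)

Section GradientForm.
Variables (R : realType) (n : nat) (G : 'rV[R]_n -> 'M[R]_n).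

(** Written with the gradient vector [v *m invmx (G u)], the form involves G rather than its
    inverse, so positive definiteness of G applies directly. *)
Lemma gradot_quadratic (f : 'rV[R]_n -> R) u : (G u)^T = G u -> G u \in unitmx ->
  let v := \row_i pderiv i f u in
  gradot G f f u = ((v *m invmx (G u)) *m G u *m (v *m invmx (G u))^T) 0 0.
Proof.
move=> Gs uG v; rewrite mulmxKV// trmx_mul trmx_inv Gs mulmxA mxE.
rewrite /gradot exchange_big; apply: eq_bigr => j _.
rewrite [(v^T) j 0]mxE [v 0 j]mxE mxE mulr_suml; apply: eq_bigr => i _.
by rewrite [v 0 i]mxE mulrA (mulrC (pderiv i f u)).
Qed.

Lemma gradot_ge0 (f : 'rV[R]_n -> R) u : (G u)^T = G u -> posdef (G u) ->
  0 <= gradot G f f u.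
Proof.
move=> Gs Gp; have uG : G u \in unitmx by rewrite unitmxE unitfE posdef_det_neq0.
rewrite gradot_quadratic//; set w := _ *m invmx _.
have [->|w0] := eqVneq w 0; first by rewrite !mul0mx mxE.
by rewrite ltW// Gp.
Qed.

Lemma gradot_eq0 (f : 'rV[R]_n -> R) u : (G u)^T = G u -> posdef (G u) ->
  gradot G f f u = 0 -> forall i, pderiv i f u = 0.
Proof.
move=> Gs Gp; have uG : G u \in unitmx by rewrite unitmxE unitfE posdef_det_neq0.
rewrite gradot_quadratic//; set v := \row_i _; set w := v *m invmx _ => E i.
have w0 : w = 0.
  by apply/eqP/negPn/negP => /Gp; rewrite E ltxx.
have v0 : v = 0 by rewrite -(mulmxKV uG v) -/w w0 mul0mx.
by have /rowP/(_ i) := v0; rewrite !mxE.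
Qed.

End GradientForm.

Section VectorMaps.
Variables (R : realType) (n m : nat) (M : ptopologicalType).
Variables (A : smooth_atlas R n M) (g : riemannian_metric A).
Variable x : M -> 'rV[R]_m.
Hypothesis iso : isometric_immersion g x.

Notation loc c f := (fun u => f (cinv c u)).

Lemma laplacian_vec_chart q (y : M -> 'rV[R]_q) c p : smooth A y -> charts A c ->
  cdom c p -> laplacian g y p = local_laplacian (metric g c) (loc c y) (cmap c p).
Proof.
move=> sy Ac cp; apply/rowP => a.
apply: (etrans (laplacian_coord g p a sy)).
apply: (etrans (laplacian_chart iso (C2_coord a sy) Ac cp)); apply/esym.
exact: (local_laplacian_coord _ a (@cimg_open _ _ _ c) (sy c Ac 2) (cmap_img cp)).
Qed.

Lemma edot_C2 q (y : M -> 'rV[R]_q) : smooth A y -> C2 A (fun p => edot (y p) (y p)).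
Proof.
move=> sy.
have -> : (fun p => edot (y p) (y p)) = fun p => \sum_a y p 0 a * y p 0 a.
  by apply/funext => p; exact: edotE.
by apply: C2_sum => a; exact: (C2M (C2_coord a sy) (C2_coord a sy)).
Qed.

Lemma pderiv_edot_sq q (y : M -> 'rV[R]_q) c u i : smooth A y -> charts A c ->
  cimg c u -> pderiv i (loc c (fun p => edot (y p) (y p))) u =
  2 * edot (pderiv i (loc c y) u) (y (cinv c u)).
Proof.
move=> sy Ac cu.
rewrite (pderiv_edot i (@cimg_open _ _ _ c) (sy c Ac 1) (sy c Ac 1) cu).
by rewrite [X in _ + X]edotC -mulr2n mulr_natl.
Qed.

(** Delta |y|^2 = 2 <Delta y, y> - 2 |dy|^2. For the immersion the last term is 2n; for an eigenmap
    of constant norm the left side is 0 and |dy|^2 is determined. *)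
Lemma laplacian_edot_sq q (y : M -> 'rV[R]_q) c p : smooth A y -> charts A c ->
  cdom c p -> laplacian g (fun q => edot (y q) (y q)) p =
  2 * edot (laplacian g y p) (y p) - 2 * \sum_i \sum_j invmx (metric g c (cmap c p)) i j *
    edot (pderiv i (loc c y) (cmap c p)) (pderiv j (loc c y) (cmap c p)).
Proof.
move=> sy Ac cp.
have -> : (fun q => edot (y q) (y q)) = fun q => \sum_a y q 0 a * y q 0 a.
  by apply/funext => p'; exact: edotE.
have Ca a := C2_coord a sy.
rewrite (laplacian_sum _ _ _ (fun a => C2M (Ca a) (Ca a))).
rewrite edotE [in RHS]mulr_sumr.
have -> : \sum_i \sum_j invmx (metric g c (cmap c p)) i j *
    edot (pderiv i (loc c y) (cmap c p)) (pderiv j (loc c y) (cmap c p)) =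
   \sum_a gradot (metric g c) (loc c (fun q => y q 0 a))
     (loc c (fun q => y q 0 a)) (cmap c p).
  rewrite /gradot [RHS]exchange_big; apply: eq_bigr => i _.
  rewrite [RHS]exchange_big; apply: eq_bigr => j _.
  rewrite edotE mulr_sumr; apply: eq_bigr => a _.
  rewrite (pderiv_coord a (Cr_on_derivable i (sy c Ac 1) (cmap_img cp))).
  by rewrite (pderiv_coord a (Cr_on_derivable j (sy c Ac 1) (cmap_img cp))).
rewrite [X in _ - X]mulr_sumr -sumrB; apply: eq_bigr => a _.
rewrite (laplacian_mul iso (Ca a) (Ca a) Ac cp) (laplacian_coord g p a sy).
by move: (gradot _ _ _ _) (laplacian _ _ _) => b l; ring.
Qed.

End VectorMaps.

Section SphericalEigenmap.
Variables (R : realType) (n m q : nat) (M : ptopologicalType).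
Variables (A : smooth_atlas R n M) (g : riemannian_metric A).
Variable x : M -> 'rV[R]_m.
Hypothesis iso : isometric_immersion g x.
Variables (y : M -> 'rV[R]_q) (lambda s : R).
Hypothesis sy : smooth A y.
Hypothesis eigen : forall p, laplacian g y p = lambda *: y p.
Hypothesis s0 : 0 < s.
Hypothesis ys : forall p, edot (y p) (y p) = s.

Notation loc c f := (fun u => f (cinv c u)).

Let normal c u i : charts A c -> cimg c u ->
  edot (pderiv i (loc c y) u) (y (cinv c u)) = 0.
Proof.
move=> Ac cu; have := pderiv_edot_sq i sy Ac cu.
have -> : (loc c (fun p => edot (y p) (y p))) = fun=> s by apply/funext.
rewrite (_ : pderiv i _ u = 0); last exact: derive_cst.
by move=> /esym/eqP; rewrite mulf_eq0 pnatr_eq0/= => /eqP.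
Qed.

(** The tension is the part of - Delta y tangent to the sphere, and Delta y = lambda y is radial. *)
Lemma eigenmap_tension p : sphere_tension g y p = 0.
Proof.
rewrite /sphere_tension /at_chart.
have [Ac cp] := chart_atP A p; set c := chart_at A p in Ac cp *.
set G := metric g c; set F := loc c y; set u := cmap c p.
have cu : cimg c u := cmap_img cp.
have Fu : F u = y p by rewrite /F /u cmapK.
have FF : edot (F u) (F u) = s by rewrite Fu ys.
have lapE : local_laplacian G F u = lambda *: F u.
  by rewrite -(laplacian_vec_chart iso sy Ac cp) eigen Fu.
(* Since |y| is constant, first derivatives are orthogonal to y and the connection term drops out of
   <Delta y, y> = lambda s. *)
have T : \sum_i \sum_j invmx (G u) i j * edot (pderiv i (pderiv j F) u) (F u)
    = - (lambda * s).
  rewrite -FF -edotZl -lapE /local_laplacian edotNl opprK /mtrace edot_suml.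
  apply: eq_bigr => i _; rewrite edot_suml; apply: eq_bigr => j _.
  rewrite edotZl; apply: (congr1 (fun r : R => invmx (G u) i j * r)).
  rewrite /hessian edotBl /nabla_deriv edot_suml big1 ?subr0// => k _.
  by rewrite edotZl (normal k Ac cu) mulr0.
(* [sphere_map_hessian] projects only the second derivative, the connection term being tangent
   already; the radial part removed is that of the trace in [T]. *)
have -> : local_sphere_tension G F u = - local_laplacian G F u -
   ((\sum_i \sum_j invmx (G u) i j * edot (pderiv i (pderiv j F) u) (F u)) / s) *: F u.
  rewrite /local_laplacian opprK /local_sphere_tension /mtrace mulr_suml scaler_suml -sumrB.
  apply: eq_bigr => i _; rewrite mulr_suml scaler_suml -sumrB; apply: eq_bigr => j _.
  rewrite /sphere_map_hessian /sphere_tangent /hessian FF.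
  by rewrite addrAC scalerBr; congr (_ - _); rewrite scalerA mulrA.
by rewrite T lapE mulNr mulfK ?gt_eqF// scaleNr opprK addNr.
Qed.

Lemma eigenmap_in_sphere : in_hypersphere 0 (Num.sqrt s) y.
Proof. by split=> [|p]; [rewrite sqrtr_gt0|rewrite subr0 /enorm ys]. Qed.

Lemma eigenmap_harmonic : harmonic_into_sphere g (Num.sqrt s) y.
Proof.
by split; [exact: eigenmap_in_sphere|exact: sy|exact: eigenmap_tension].
Qed.

Lemma eigenmap_energy : constant_energy_density g y.
Proof.
(* Delta |y|^2 = 0 gives |dy|^2 = lambda s, and the energy density is half of it. *)
exists (2^-1 * (lambda * s)) => p; rewrite /energy_density /at_chart.
have [Ac cp] := chart_atP A p; set c := chart_at A p in Ac cp *.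
have := laplacian_edot_sq iso sy Ac cp.
have -> : (fun q => edot (y q) (y q)) = fun=> s by apply/funext.
rewrite laplacian_cst eigen edotZl ys => /esym/eqP; rewrite subr_eq0 => /eqP E.
apply: (congr1 (fun r : R => 2^-1 * r)).
by apply: (@mulfI _ (2 : R)); rewrite ?pnatr_eq0// -E.
Qed.

End SphericalEigenmap.

(** * Consequences of the divergence theorem on a closed manifold *)

Section Harmonic.
Variables (R : realType) (n m : nat) (M : ptopologicalType).
Variables (A : smooth_atlas R n M) (g : riemannian_metric A).
Variable dV : {measure set (borel M) -> \bar R}.
Variable x : M -> 'rV[R]_m.
Hypothesis hausdorffM : hausdorff_space M.
Hypothesis compactM : compact [set: M].
Hypothesis connectedM : connected [set: M].
Hypothesis volume_dV : riemannian_volume g dV.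
Hypothesis iso : isometric_immersion g x.

Notation loc c f := (fun u => f (cinv c u)).

Lemma laplacian_ge0_eq0 f : C2 A f -> (forall p, 0 <= laplacian g f p) ->
  forall p, laplacian g f p = 0.
Proof.
move=> Cf f0; have [_ If] := integral_laplacian hausdorffM compactM volume_dV iso Cf.
exact: (integral_eq0 hausdorffM volume_dV (laplacian_continuous iso Cf) f0 If).
Qed.

(** A constant of one sign with integral 0 vanishes; a negative one is reduced to the positive case
    by changing f to -f. *)
Lemma laplacian_constant_eq0 f (a : R) : C2 A f -> (forall p, laplacian g f p = a) ->
  a = 0.
Proof.
move=> Cf fa; have [a0|a0] := leP 0 a.
  by rewrite -(fa point); apply: laplacian_ge0_eq0 => // p; rewrite fa.
have CNf := C2M (C2_cst (-1)) Cf.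
have := laplacian_ge0_eq0 CNf; rewrite /=.
have E p : laplacian g (fun q => -1 * f q) p = - a.
  by rewrite (laplacianZ iso _ _ Cf) fa mulN1r.
move=> /(_ _ point); rewrite E => H; apply/eqP; rewrite -oppr_eq0; apply/eqP/H => p.
by rewrite E oppr_ge0 ltW.
Qed.

(** For harmonic f, Delta(-f^2) = 2 |grad f|^2 is nonnegative with integral 0, so the gradient
    vanishes everywhere. *)
Lemma harmonic_constant f : C2 A f -> (forall p, laplacian g f p = 0) ->
  forall p q, f p = f q.
Proof.
move=> Cf f0; apply: (gradient0_constant connectedM Cf) => c u i Ac cu.
have Gs := chart_sym g Ac cu; have Gp := chart_posdef g Ac cu.
have E c' p : charts A c' -> cdom c' p ->
    laplacian g (fun q => -1 * (f q * f q)) p =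
    2 * gradot (metric g c') (loc c' f) (loc c' f) (cmap c' p).
  move=> Ac' cp; rewrite (laplacianZ iso _ _ (C2M Cf Cf)).
  by rewrite (laplacian_mul iso Cf Cf Ac' cp) !f0 mulr0 addr0 sub0r mulN1r opprK.
have ge0 p : 0 <= laplacian g (fun q => -1 * (f q * f q)) p.
  have [Ac' cp] := chart_atP A p; rewrite (E _ p Ac' cp) mulr_ge0//.
  apply: gradot_ge0; first exact: (chart_sym g Ac' (cmap_img cp)).
  exact: (chart_posdef g Ac' (cmap_img cp)).
have := laplacian_ge0_eq0 (C2M (C2_cst (-1)) (C2M Cf Cf)) ge0 (cinv c u).
rewrite (E c _ Ac (cinv_dom cu)) cinvK// => /eqP.
rewrite mulf_eq0 pnatr_eq0/= => /eqP H.
exact: gradot_eq0 Gs Gp H i.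
Qed.

Lemma laplacian_center_of_mass q (y : M -> 'rV[R]_q) (f : 'I_q -> M -> R) :
  (forall a, C2 A (f a)) -> (forall p a, y p 0 a = laplacian g (f a) p) ->
  center_of_mass dV y = 0.
Proof.
move=> Cf yE; apply/rowP => a; rewrite !mxE /Rintegral.
have [_ If] := integral_laplacian hausdorffM compactM volume_dV iso (Cf a).
have -> : (fun p : M => (y p 0 a)%:E) = fun p => (laplacian g (f a) p)%:E.
  by apply/funext => p; rewrite yE.
by rewrite If mulr0.
Qed.

(** For eigenvalue 0 the coordinates would be harmonic, hence constant. *)
Lemma eigenvalue_neq0 q (y : M -> 'rV[R]_q) lambda : smooth A y ->
  (forall p, laplacian g y p = lambda *: y p) -> nonconstant y -> lambda != 0.
Proof.
move=> sy yE ny; apply/eqP => l0; apply: ny; exists (y point) => p.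
apply/rowP => a; apply: (harmonic_constant (C2_coord a sy)) => p'.
by rewrite -laplacian_coord// yE l0 scale0r mxE.
Qed.

Lemma eigenmap_center_of_mass q (y : M -> 'rV[R]_q) lambda : smooth A y ->
  (forall p, laplacian g y p = lambda *: y p) -> lambda != 0 ->
  center_of_mass dV y = 0.
Proof.
move=> sy yE l0.
apply: (@laplacian_center_of_mass _ _ (fun a p => lambda^-1 * y p 0 a)).
  by move=> a; exact: (C2M (C2_cst _) (C2_coord a sy)).
move=> p a; rewrite (laplacianZ iso _ _ (C2_coord a sy)) -laplacian_coord//.
by rewrite yE mxE mulKf.
Qed.

End Harmonic.

(** * Orthogonal immersions of 2-type *)

Section TwoType.
Variables (R : realType) (n m : nat) (M : ptopologicalType).
Variables (A : smooth_atlas R n M) (g : riemannian_metric A).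
Variables (x x1 x2 : M -> 'rV[R]_m) (lambda1 lambda2 : R).
Hypothesis iso : isometric_immersion g x.
Hypothesis two_type : two_type_decomposition g x x1 x2 lambda1 lambda2.
Hypothesis orth : orthogonal_decomposition x1 x2.

Notation loc c f := (fun u => f (cinv c u)).

Let s1 : smooth A x1. Proof. by have [[]] := two_type. Qed.
Let s2 : smooth A x2. Proof. by have [[]] := two_type. Qed.
Let xE p : x p = x1 p + x2 p. Proof. by have [_ _ _ /(_ p)] := two_type. Qed.
Let L1 p : laplacian g x1 p = lambda1 *: x1 p.
Proof. by have [_ _ _ _ [/(_ p)]] := two_type. Qed.
Let L2 p : laplacian g x2 p = lambda2 *: x2 p.
Proof. by have [_ _ _ _ [_ /(_ p)]] := two_type. Qed.

Lemma laplace_map p : laplacian g x p = lambda1 *: x1 p + lambda2 *: x2 p.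
Proof.
apply/rowP => a; rewrite (laplacian_coord g p a iso.1).
have -> : (fun p => x p 0 a) = fun p => x1 p 0 a + x2 p 0 a.
  by apply/funext => q; rewrite xE mxE.
rewrite (laplacianD g p (C2_coord a s1) (C2_coord a s2)) -!laplacian_coord//.
by rewrite L1 L2 [in RHS]mxE.
Qed.

Let span_mem (y : M -> 'rV[R]_m) p : span_image y (y p).
Proof. by exists 1%N, (fun=> 1), (fun=> p); rewrite big_ord1 scale1r. Qed.

(** The two points are independent, which is what orthogonality of the spans provides and what
    [orth_deriv] relies on when it differentiates one factor against a fixed vector. *)
Lemma orth_points p q : edot (x1 p) (x2 q) = 0.
Proof. by apply: orth; exact: span_mem. Qed.

Let orth_deriv (y : M -> 'rV[R]_m) w c u i : smooth A y ->
  (forall p, edot (y p) w = 0) -> charts A c -> cimg c u ->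
  edot (pderiv i (loc c y) u) w = 0.
Proof.
move=> sy yw Ac cu.
have := pderiv_edot i (@cimg_open _ _ _ c) (sy c Ac 1) (Cr_on_cst 1 (cimg c) w) cu.
rewrite (_ : pderiv i (fun=> w) u = 0); last exact: derive_cst.
rewrite [edot _ 0]edotC edot0l addr0 => <-.
have -> : (fun v => edot (y (cinv c v)) w) = fun=> 0 by apply/funext.
exact: derive_cst.
Qed.

Lemma weighted_norms_gradient c u i : charts A c -> cimg c u ->
  lambda1 * edot (pderiv i (loc c x1) u) (x1 (cinv c u)) +
  lambda2 * edot (pderiv i (loc c x2) u) (x2 (cinv c u)) = 0.
Proof.
move=> Ac cu; have oU := @cimg_open _ _ _ c.
have T := edot_laplacian_tangent oU (chart_sym g Ac) (chart_posdef g Ac)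
  (chart_immersion_smooth iso Ac) (chart_immersion_metric iso Ac) i cu.
have := laplacian_vec_chart iso iso.1 Ac (cinv_dom cu).
rewrite (cinvK cu) laplace_map => LE; move: T; rewrite -{}LE.
have -> : pderiv i (loc c x) u = pderiv i (loc c x1) u + pderiv i (loc c x2) u.
  rewrite -[RHS](deriveD (Cr_on_derivable i (s1 Ac 1) cu) (Cr_on_derivable i (s2 Ac 1) cu)).
  by congr (pderiv i _ u); apply/funext => v; rewrite xE.
have e12 := orth_deriv i s1 (fun p => orth_points p (cinv c u)) Ac cu.
have e21 : edot (pderiv i (loc c x2) u) (x1 (cinv c u)) = 0.
  by apply: (orth_deriv i s2 _ Ac cu) => p; rewrite edotC orth_points.
rewrite edotDl !edotZl !edotDr !(edotC (x1 (cinv c u))) !(edotC (x2 (cinv c u))) e12 e21.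
by rewrite addr0 add0r.
Qed.

Lemma weighted_norms_constant : connected [set: M] -> forall p q,
  lambda1 * edot (x1 p) (x1 p) + lambda2 * edot (x2 p) (x2 p) =
  lambda1 * edot (x1 q) (x1 q) + lambda2 * edot (x2 q) (x2 q).
Proof.
move=> connectedM.
have Z (y : M -> 'rV[R]_m) (l : R) : smooth A y -> C2 A (fun p => l * edot (y p) (y p)).
  by move=> sy; exact: (C2M (C2_cst l) (edot_C2 sy)).
have dZ (y : M -> 'rV[R]_m) (l : R) c u i : smooth A y -> charts A c -> cimg c u ->
    pderiv i (loc c (fun p => l * edot (y p) (y p))) u =
    2 * (l * edot (pderiv i (loc c y) u) (y (cinv c u))).
  move=> sy Ac cu.
  rewrite (pderivM_on i (Cr_on_cst 2 (cimg c) l) (edot_C2 sy Ac) cu).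
  rewrite (pderiv_edot_sq i sy Ac cu) (_ : pderiv i (fun=> l) u = 0) ?mulr0 ?addr0.
    by rewrite mulrCA.
  exact: derive_cst.
apply: (gradient0_constant connectedM (C2D (Z _ lambda1 s1) (Z _ lambda2 s2))).
move=> c u i Ac cu.
rewrite (pderivD_on i (Z _ lambda1 s1 c Ac) (Z _ lambda2 s2 c Ac) cu).
rewrite (dZ _ _ _ _ _ s1 Ac cu) (dZ _ _ _ _ _ s2 Ac cu) -mulrDr.
by rewrite (weighted_norms_gradient i Ac cu) mulr0.
Qed.

Lemma edot_sum_orth p : edot (x p) (x p) = edot (x1 p) (x1 p) + edot (x2 p) (x2 p).
Proof.
by rewrite xE !edotDl !edotDr orth_points (edotC (x2 p) (x1 p)) orth_points addr0 add0r.
Qed.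

Lemma laplacian_edot_immersion p : laplacian g (fun q => edot (x q) (x q)) p =
  2 * (lambda1 * edot (x1 p) (x1 p) + lambda2 * edot (x2 p) (x2 p)) - 2 * n%:R.
Proof.
have [Ac cp] := chart_atP A p; have cu := cmap_img cp.
rewrite (laplacian_edot_sq iso iso.1 Ac cp).
rewrite (trace_metric (chart_sym g Ac) (chart_posdef g Ac)
  (chart_immersion_metric iso Ac) cu).
congr (2 * _ - _).
rewrite laplace_map xE edotDl !edotZl !edotDr orth_points (edotC (x2 p) (x1 p)).
by rewrite orth_points addr0 add0r.
Qed.

End TwoType.

Theorem mainTheorem20 (R : realType) (n m : nat) (M : ptopologicalType)
    (A : smooth_atlas R n M) (g : riemannian_metric A)
    (dV : {measure set (borel M) -> \bar R})
    (x x1 x2 : M -> 'rV[R]_m) (lambda1 lambda2 : R)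
    (hausdorffM : hausdorff_space M) (second_countableM : @second_countable M)
    (compactM : compact [set: M]) (connectedM : connected [set: M])
    (volume_dV : riemannian_volume g dV)
    (isometric_x : isometric_immersion g x)
    (two_type_x : two_type_decomposition g x x1 x2 lambda1 lambda2)
    (orthogonal_x : orthogonal_decomposition x1 x2) :
  exists r alpha r1 r2 : R,
    [/\ mass_symmetric_in dV 0 r x,
        (forall p, enorm (mean_curvature g x p) = alpha) /\
        alpha ^+ 2 = n%:R^-1 * (lambda1 + lambda2)
                     - (r / n%:R) ^+ 2 * (lambda1 * lambda2),
        mass_symmetric_in dV 0 r1 x1 /\ mass_symmetric_in dV 0 r2 x2,
        (forall p, x1 p = (lambda2 - lambda1)^-1 *:
                            (lambda2 *: x p - laplacian g x p)) /\
        (forall p, x2 p = (lambda1 - lambda2)^-1 *: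
                            (lambda1 *: x p - laplacian g x p))
      & (harmonic_into_sphere g r1 x1 /\ constant_energy_density g x1) /\
        (harmonic_into_sphere g r2 x2 /\ constant_energy_density g x2)].
Proof.
have [[s1 s2] [nc1 nc2] l12 xE [L1 L2]] := two_type_x.
have l21 : lambda2 - lambda1 != 0 by rewrite subr_eq0 gt_eqF.
have l12' : lambda1 - lambda2 != 0 by rewrite subr_eq0 lt_eqF.
have LE := laplace_map isometric_x two_type_x.
pose N1 p := edot (x1 p) (x1 p); pose N2 p := edot (x2 p) (x2 p).
have fE := weighted_norms_constant isometric_x two_type_x orthogonal_x connectedM.
have lapN := laplacian_edot_immersion isometric_x two_type_x orthogonal_x.
have CN := edot_C2 isometric_x.1.
have fn p : lambda1 * N1 p + lambda2 * N2 p = n%:R.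
  have lapC q : laplacian g (fun q => edot (x q) (x q)) q =
      2 * (lambda1 * N1 p + lambda2 * N2 p) - 2 * n%:R.
    by rewrite lapN (fE q p).
  have /eqP := laplacian_constant_eq0 hausdorffM compactM volume_dV isometric_x CN lapC.
  by rewrite -mulrBr mulf_eq0 pnatr_eq0/= subr_eq0 => /eqP.
have NE p q : N1 p + N2 p = N1 q + N2 q.
  rewrite -!(edot_sum_orth two_type_x orthogonal_x).
  apply: (harmonic_constant hausdorffM compactM connectedM volume_dV isometric_x CN).
  by move=> p'; rewrite lapN fn subrr.
pose t1 := N1 point; pose t2 := N2 point.
have N1E p : N1 p = t1.
  apply: (mulfI l21); apply/eqP; rewrite -subr_eq0; apply/eqP.
  (* Eliminates [N2] between the two constant combinations; the factor left on [N1] is lambda2 -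
     lambda1. *)
  transitivity (lambda2 * ((N1 p + N2 p) - (t1 + t2)) -
    ((lambda1 * N1 p + lambda2 * N2 p) - (lambda1 * t1 + lambda2 * t2))).
    ring.
  by rewrite (NE p point) !fn !subrr mulr0 subr0.
have N2E p : N2 p = t2.
  by apply: (addrI (N1 p)); rewrite (NE p point) !N1E.
(* A map of constant norm 0 is constant, so non-constancy makes the radii positive. *)
have pos (y : M -> 'rV[R]_m) (t : R) : nonconstant y ->
    (forall p, edot (y p) (y p) = t) -> 0 < t.
  move=> ny yt; rewrite lt_neqAle -{2}(yt point) edot_ge0 andbT eq_sym.
  apply/eqP => t0; apply: ny; exists 0 => p.
  by apply: edot_eq0; rewrite yt.
have t1_gt0 : 0 < t1 := pos _ _ nc1 N1E.
have t2_gt0 : 0 < t2 := pos _ _ nc2 N2E.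
have r_gt0 : 0 < t1 + t2 by rewrite addr_gt0.
have l1n : lambda1 != 0.
  exact: (eigenvalue_neq0 hausdorffM compactM connectedM volume_dV isometric_x s1 L1 nc1).
have l2n : lambda2 != 0.
  exact: (eigenvalue_neq0 hausdorffM compactM connectedM volume_dV isometric_x s2 L2 nc2).
have com1 : center_of_mass dV x1 = 0.
  exact: (eigenmap_center_of_mass hausdorffM compactM volume_dV isometric_x s1 L1 l1n).
have com2 : center_of_mass dV x2 = 0.
  exact: (eigenmap_center_of_mass hausdorffM compactM volume_dV isometric_x s2 L2 l2n).
have C1 a := C2_coord a s1; have C2' a := C2_coord a s2.
have comx : center_of_mass dV x = 0.
  (* x is the Laplacian of x1 / lambda1 + x2 / lambda2, both eigenvalues being nonzero. *)
  apply: (@laplacian_center_of_mass _ _ _ _ _ _ _ _ hausdorffM compactM volume_dV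
    isometric_x _ _ (fun a p => lambda1^-1 * x1 p 0 a + lambda2^-1 * x2 p 0 a)).
    by move=> a; exact: (C2D (C2M (C2_cst _) (C1 a)) (C2M (C2_cst _) (C2' a))).
  move=> p a.
  rewrite (laplacianD g p (C2M (C2_cst _) (C1 a)) (C2M (C2_cst _) (C2' a))).
  rewrite (laplacianZ isometric_x _ _ (C1 a)) (laplacianZ isometric_x _ _ (C2' a)).
  rewrite -(laplacian_coord g p a s1) -(laplacian_coord g p a s2) L1 L2.
  by rewrite xE !mxE !mulKf.
(* The value of |H|^2: H is - L / n, and the two components of L are orthogonal. *)
pose h2 := n%:R^-1 ^+ 2 * (lambda1 ^+ 2 * t1 + lambda2 ^+ 2 * t2).
have h2_ge0 : 0 <= h2.
  by rewrite mulr_ge0 ?sqr_ge0// addr_ge0// mulr_ge0 ?sqr_ge0// ltW.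
have orthP := orth_points orthogonal_x.
have LL p : edot (laplacian g x p) (laplacian g x p) = lambda1 ^+ 2 * t1 + lambda2 ^+ 2 * t2.
  rewrite LE edotDl !edotZl !edotDr !edotZr orthP (edotC (x2 p) (x1 p)) orthP.
  rewrite -/(N1 p) -/(N2 p) N1E N2E.
  by rewrite !mulr0 addr0 add0r !mulrA -!expr2.
exists (Num.sqrt (t1 + t2)), (Num.sqrt h2), (Num.sqrt t1), (Num.sqrt t2).
have ht1 := eigenmap_harmonic isometric_x s1 L1 t1_gt0 N1E.
have ht2 := eigenmap_harmonic isometric_x s2 L2 t2_gt0 N2E.
split.
- split=> //; split=> [|p]; first by rewrite sqrtr_gt0.
  rewrite subr0 /enorm (edot_sum_orth two_type_x orthogonal_x).
  by rewrite -/(N1 p) -/(N2 p) N1E N2E.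
- split=> [p|].
    have [Ac cp] := chart_atP A p.
    have -> : mean_curvature g x p = - (n%:R^-1 *: laplacian g x p).
      exact: (mean_curvature_laplacian (@cimg_open _ _ _ _)
        (chart_immersion_smooth isometric_x Ac)
        (chart_immersion_metric isometric_x Ac) (cmap_img cp)).
    rewrite /enorm edotNl edotC edotNl opprK edotZl edotC edotZl LL.
    by rewrite mulrA -expr2.
  rewrite sqr_sqrtr// /h2 exprMn sqr_sqrtr ?ltW//.
  (* For n = 0 the inverse is 0 by convention and both sides are 0. *)
  have [n0|n0] := eqVneq (n%:R : R) 0.
    by rewrite n0 invr0 expr0n !mul0r mulr0 mul0r subr0.
  (* With n replaced by l1 t1 + l2 t2, the claim is the identity (l1 + l2) (l1 t1 + l2 t2) = l1^2 t1
     + l2^2 t2 + l1 l2 (t1 + t2), divided by n^2. *)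
  have <- := fn point; rewrite -/t1 -/t2 in n0 *.
  have n0' : lambda1 * t1 + lambda2 * t2 != 0 by rewrite /t1 /t2 fn.
  by field.
- split; split=> //; exact: eigenmap_in_sphere.
- split=> p; rewrite LE xE (scalerDr _ (x1 p)) opprD addrACA -!scalerBl.
    by rewrite subrr scale0r addr0 scalerA mulVf// scale1r.
  by rewrite subrr scale0r add0r scalerA mulVf// scale1r.
- split; split=> //.
    exact: (eigenmap_energy isometric_x s1 L1 N1E).
  exact: (eigenmap_energy isometric_x s2 L2 N2E).
Qed.
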